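(* Assume the standing assumptions in the context with case (CI), where $w_n=n^p$ for some $p>1$, and assume $\sum_{n=1}^{j-1}nb_{n,j}\le j$ for all $j\ge2$. Let $\mu:(0,T)\to(0,\infty)$ be a monotone increasing function such that for each $t'\in(0,T)$, $k_{n,j}(t)\le\mu(t')(n+j)$ for all $n,j\in\mathbb N$ and $t\in[0,t']$. Let $\mathring u\in(\ell^1_w)_+$ and let $u$ be the unique mild solution of $u'=G^{(w)}u+K(t,u)$, $u(0)=\mathring u$, on its maximal interval $[0,t_{\max})$. Then $t_{\max}=T$, and $\|u(t)\|_w\le\|\mathring u\|_we^{c_p\mu(t)\phi_{[1]}(\mathring u)t}$ for $t\in[0,T)$, where $\phi_{[1]}(f)=\sum_{n}nf_n$ and $c_p=p$ if $p\in(1,2]$, $c_p=2^p-2$ if $p\in(2,\infty)$.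
   Context: Let $0<T\le\infty$, $a_n\ge0$, $b_{n,j}\ge0$ with $b_{n,j}=0$ for $j\le n$, $k_{n,j}:[0,T)\to[0,\infty)$ continuous with $k_{n,j}=k_{j,n}$. $\ell^1_w=\{f:\|f\|_w=\sum w_n|f_n|<\infty\}$ with componentwise order, $w_n=n^p$. Standing assumptions: there is $\kappa\in(0,1]$ with $\sum_{n=1}^{j-1}w_nb_{n,j}\le\kappa w_j$ for all $j\ge2$; case (CI): for every $t'\in(0,T)$ there is $c(t')>0$ with $k_{n,j}(t)\le c(t')w_nw_j/w_{n+j}$ for all $n,j$ and $t\in[0,t']$. $G^{(w)}$ is the closure in $\ell^1_w$ of $A^{(w)}+B^{(w)}$, $A^{(w)}f=(-a_nf_n)_n$, $B^{(w)}f=(\sum_{j>n}a_jb_{n,j}f_j)_n$ on maximal domains; it generates a substochastic $C_0$-semigroup $(S^{(w)}(t))_{t\ge 0}$. $K(t,f)=(\tfrac12\sum_{j=1}^{n-1}k_{n-j,j}(t)f_{n-j}f_j-\sum_{j\ge1}k_{n,j}(t)f_nf_j)_n$. A mild solution on $[0,t_1)$ is $u\in C([0,t_1),\ell^1_w)$ with $u(t)=S^{(w)}(t)\mathring u+\int_0^tS^{(w)}(t-s)K(s,u(s))\,ds$; a unique maximal one exists on some $[0,t_{\max})$, $t_{\max}\in(0,T]$. *)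

(* Defs.v *)
From HB Require Import structures.
From mathcomp Require Import all_boot all_order all_algebra.
From mathcomp Require Import all_classical all_reals all_analysis.
Set Implicit Arguments. Unset Strict Implicit. Unset Printing Implicit Defensive.
Import Order.TTheory GRing.Theory Num.Theory.
Import numFieldNormedType.Exports.
Local Open Scope classical_set_scope.
Local Open Scope ring_scope.

(* Sequences f = (f_n)_{n >= 1} are represented by f : nat -> R; the
   component f 0 is not part of the sequence (elements of the space have
   f 0 = 0, and all sums run over n >= 1). *)

Section Defs.
Variable R : realType.

Definition wgt (p : R) (n : nat) : R := (n%:R) `^ p.

Definition normw (p : R) (f : nat -> R) : \bar R :=
  (\sum_(1 <= n <oo) ((wgt p n * `|f n|)%:E))%E.

Definition inl1w (p : R) (f : nat -> R) : Prop :=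
  f 0%N = 0 /\ (normw p f < +oo)%E.

Definition seqsub (f g : nat -> R) : nat -> R := fun n => f n - g n.

Definition l1w_cvg_seq (p : R) (F : nat -> nat -> R) (f : nat -> R) : Prop :=
  (fun k => normw p (seqsub (F k) f)) @ \oo --> 0%E.

Definition Aop (a : nat -> R) (f : nat -> R) : nat -> R :=
  fun n => if (n == 0)%N then 0 else - (a n * f n).

Definition Bop (a : nat -> R) (b : nat -> nat -> R) (f : nat -> R) : nat -> R :=
  fun n => if (n == 0)%N then 0 else limn (fun N => \sum_(n.+1 <= j < N) (a j * b n j * f j)).

Definition domA (p : R) (a : nat -> R) (f : nat -> R) : Prop :=
  inl1w p f /\ inl1w p (Aop a f).

Definition domB (p : R) (a : nat -> R) (b : nat -> nat -> R) (f : nat -> R) : Prop :=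
  inl1w p f /\
  (forall n, (1 <= n)%N ->
     cvgn (fun N => \sum_(n.+1 <= j < N) (a j * b n j * f j))) /\
  inl1w p (Bop a b f).

Definition ABop (a : nat -> R) (b : nat -> nat -> R) (f : nat -> R) : nat -> R :=
  fun n => Aop a f n + Bop a b f n.

(* graph of the closure G^(w) of A^(w)+B^(w) (domain D(A) /\ D(B)) in l^1_w *)
Definition Gclos (p : R) (a : nat -> R) (b : nat -> nat -> R)
  (f g : nat -> R) : Prop :=
  inl1w p f /\ inl1w p g /\
  exists F : nat -> nat -> R,
    (forall k, domA p a (F k) /\ domB p a b (F k)) /\
    l1w_cvg_seq p F f /\ l1w_cvg_seq p (fun k => ABop a b (F k)) g.

Definition C0_semigroup (p : R) (S : R -> (nat -> R) -> (nat -> R)) : Prop :=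
  (forall t f, 0 <= t -> inl1w p f -> inl1w p (S t f)) /\
  (forall t f g c, 0 <= t -> inl1w p f -> inl1w p g ->
     S t (fun n => c * f n + g n) = (fun n => c * S t f n + S t g n)) /\
  (forall t, 0 <= t -> exists M : R,
     forall f, inl1w p f -> (normw p (S t f) <= M%:E * normw p f)%E) /\
  (forall f, inl1w p f -> S 0 f = f) /\
  (forall t s f, 0 <= t -> 0 <= s -> inl1w p f -> S (t + s) f = S t (S s f)) /\
  (forall f, inl1w p f ->
     (fun h => normw p (seqsub (S h f) f)) @ (0 : R)^'+ --> 0%E).

Definition generator_rel (p : R) (S : R -> (nat -> R) -> (nat -> R))
  (f g : nat -> R) : Prop :=
  inl1w p f /\ inl1w p g /\
  (fun h : R => normw p (seqsub (fun n => (S h f n - f n) / h) g))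
     @ (0 : R)^'+ --> 0%E.

Definition generated_by_G (p : R) (a : nat -> R) (b : nat -> nat -> R)
  (S : R -> (nat -> R) -> (nat -> R)) : Prop :=
  C0_semigroup p S /\
  forall f g, generator_rel p S f g <-> Gclos p a b f g.

Definition Kop (k : nat -> nat -> R -> R) (t : R) (f : nat -> R) : nat -> R :=
  fun n => if (n == 0)%N then 0 else
    2^-1 * (\sum_(1 <= j < n) (k (n - j)%N j t * f (n - j)%N * f j))
    - limn (fun N => \sum_(1 <= j < N) (k n j t * f n * f j)).

Definition mild_solution (p : R) (S : R -> (nat -> R) -> (nat -> R))
  (k : nat -> nat -> R -> R) (u0 : nat -> R) (t1 : \bar R)
  (u : R -> nat -> R) : Prop :=
  (forall t, 0 <= t -> (t%:E < t1)%E -> inl1w p (u t)) /\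
  (forall t, 0 <= t -> (t%:E < t1)%E ->
     forall e : R, 0 < e -> exists d : R, 0 < d /\
       forall s, 0 <= s -> (s%:E < t1)%E -> `|s - t| < d ->
         (normw p (seqsub (u s) (u t)) < e%:E)%E) /\
  (forall t, 0 <= t -> (t%:E < t1)%E -> forall n, (1 <= n)%N ->
     u t n = S t u0 n +
       Rintegral lebesgue_measure `[0, t]
         (fun s => S (t - s) (Kop k s (u s)) n)).

Definition maximal_mild_solution (p : R) (T : \bar R)
  (S : R -> (nat -> R) -> (nat -> R))
  (k : nat -> nat -> R -> R) (u0 : nat -> R) (tmax : \bar R)
  (u : R -> nat -> R) : Prop :=
  (0 < tmax)%E /\ (tmax <= T)%E /\ mild_solution p S k u0 tmax u /\
  forall t1 : \bar R, (tmax < t1)%E -> (t1 <= T)%E ->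
    ~ exists v, mild_solution p S k u0 t1 v /\
        forall t, 0 <= t -> (t%:E < tmax)%E -> v t = u t.

Definition phi1 (f : nat -> R) : R := limn (fun N => \sum_(1 <= n < N) (n%:R * f n)).

Definition cp (p : R) : R := if p <= 2 then p else 2 `^ p - 2.

End Defs.

(* Main.v *)
Require Import Defs.
From HB Require Import structures.
From mathcomp Require Import all_boot all_order all_algebra.
From mathcomp Require Import all_classical all_reals all_analysis.
From mathcomp Require Import ring lra.
Set Implicit Arguments. Unset Strict Implicit. Unset Printing Implicit Defensive.
Import Order.TTheory GRing.Theory Num.Theory.
Import numFieldNormedType.Exports.
Local Open Scope classical_set_scope.
Local Open Scope ring_scope.

(** For [W n = n^r] with [r = p] or [r = 1], the functional [q x = sum W n max(0, x n)]
    satisfies [q x <= q (x - h (A + B) x)], because fragmentation does not increase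
    [W]-moments.  Differentiating along [S t x] shows that [S] decreases every such [q];
    with [r = p] this makes [S] a positive contraction semigroup, with [r = 1] the mass
    does not grow.  If [u] is a mild solution with forcing [g], then
    [q (u (t + h)) <= q (u t + h g t) + o(h)], so a bound on [q (x + h K x)] at a single
    time integrates to a bound along [u]: the negative part of [u] stays zero, the mass
    does not grow, and the inequality
    [(x + y) ((x + y)^p - x^p - y^p) <= c_p (x y^p + y x^p)] gives the exponential bound
    on the norm.  Were [tmax < T], the Picard solution for [K] composed with a radial
    retraction would agree with [u] before [tmax] and solve the original equation
    slightly beyond it. *)

(** A mild solution need not lie in the domain of the generator, so [q (u t)] cannot be
    differentiated. Only one-sided increments are used: after time [h] the solution is
    [S h (u t + h g t)] up to [o(h)], [q] does not grow under [S h], and Dini forms of monotonicity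
    and Gronwall integrate what remains. Thus [K] enters only through the explicit Euler step
    [x + h K x]. The order of the bounds is forced: the steps for mass and norm need [x >= 0], and
    the growth rate of the norm contains the mass. With [k <= m (i + j)], the moment inequality
    bounds the sum of [(w (i + j) - w i - w j) k x_i x_j] by [2 c_p m] times mass times norm. The
    constant [c_p] is the ratio of the two sides of that inequality in the limit [x / y -> 0] when
    [p <= 2], and at [x = y] when [p > 2]. Continuity of [k] in time is not uniform in the indices,
    so time regularity of [K] is proved on finitely supported sequences and spread by density. Data
    given on a window [[0, tau]] are extended to the line by clamping the time. *)

Section NonnegativeSums.
Context {R : realType}.
Implicit Types f g : nat -> R.

Definition psum f N : R := \sum_(1 <= n < N) f n.
(** As a supremum it is bounded above by bounding partial sums, without a convergence argument. It
    is the sum of the series for nonnegative terms under [bdsum], and carries no information when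
    the partial sums are unbounded. *)
Definition tsum f : R := sup (range (psum f)).
Definition bdsum f := exists C, forall N, psum f N <= C.

Lemma le_psum f g N : (forall n, (1 <= n < N)%N -> f n <= g n) ->
  psum f N <= psum g N.
Proof. by move=> fg; rewrite /psum !big_nat; apply: ler_sum. Qed.

Lemma eq_psum f g N : (forall n, f n = g n) -> psum f N = psum g N.
Proof. by move=> fg; apply: eq_bigr => n _; exact: fg. Qed.

Lemma psum_ge0 f N : (forall n, (1 <= n)%N -> 0 <= f n) -> 0 <= psum f N.
Proof.
by move=> f0; rewrite /psum big_nat; apply: sumr_ge0 => n /andP[n1 _]; exact: f0.
Qed.

Lemma psumD f g N : psum (fun n => f n + g n) N = psum f N + psum g N.
Proof. exact: big_split. Qed.

Lemma psumZ c f N : psum (fun n => c * f n) N = c * psum f N.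
Proof. by rewrite /psum mulr_sumr. Qed.

Lemma psum0 f : psum f 0 = 0.
Proof. by rewrite /psum big_geq. Qed.

Lemma psumS f N : (1 <= N)%N -> psum f N.+1 = psum f N + f N.
Proof. by move=> N1; rewrite /psum big_nat_recr. Qed.

Lemma nondecreasing_psum f : (forall n, (1 <= n)%N -> 0 <= f n) ->
  nondecreasing_seq (psum f).
Proof.
move=> f0; apply/nondecreasing_seqP => N; case: N => [|N].
  by rewrite psum0; exact: psum_ge0.
by rewrite (psumS f (ltn0Sn N)) lerDl f0.
Qed.

Lemma tsum_le f C : (forall N, psum f N <= C) -> tsum f <= C.
Proof.
by move=> fC; apply: ge_sup => [|_ [N _ <-]//]; exists (psum f 0), 0%N.
Qed.

Lemma psum_le_tsum f N : bdsum f -> psum f N <= tsum f.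
Proof.
move=> [C fC]; apply: ub_le_sup; last by exists N.
by exists C => _ [M _ <-].
Qed.

Lemma cvg_psum_term (T : Type) (F : set_system T) (FF : Filter F)
    (h : T -> nat -> R) (l : nat -> R) N :
  (forall n, (1 <= n)%N -> h t n @[t --> F] --> l n) ->
  psum (h t) N @[t --> F] --> psum l N.
Proof.
move=> hl; elim: N => [|[|N] IH].
- by rewrite psum0 (_ : (fun _ => _) = cst 0)
    ?funeqE => [|t]; [exact: cvg_cst|rewrite psum0].
- rewrite /psum big_geq// (_ : (fun _ => _) = cst 0)
    ?funeqE => [|t]; [exact: cvg_cst|by rewrite big_geq].
- rewrite psumS// (_ : (fun _ => _) = (fun t => psum (h t) N.+1 + h t N.+1)).
    by apply: cvgD; [exact: IH|exact: hl].
  by apply/funext => t; rewrite psumS.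
Qed.

Lemma tsum_ge0 f : bdsum f -> 0 <= tsum f.
Proof. by move=> /psum_le_tsum => /(_ 0%N); rewrite psum0. Qed.

Lemma cvg_psum f : (forall n, (1 <= n)%N -> 0 <= f n) -> bdsum f ->
  psum f @ \oo --> tsum f.
Proof.
move=> f0 [C fC]; apply: nondecreasing_cvgn; first exact: nondecreasing_psum.
by exists C => _ [N _ <-].
Qed.

Lemma tsum_approx f e : (forall n, (1 <= n)%N -> 0 <= f n) -> bdsum f -> 0 < e ->
  exists N0, forall N, (N0 <= N)%N -> tsum f < psum f N + e.
Proof.
move=> f0 bf e0; have /cvgrPdist_lt/(_ e e0)[N0 _ H] := cvg_psum f0 bf.
exists N0 => N /H /= /ltr_normlW; rewrite ltrBlDl; exact.
Qed.

Lemma le_tsum_term f n : (forall n, (1 <= n)%N -> 0 <= f n) -> bdsum f ->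
  (1 <= n)%N -> f n <= tsum f.
Proof.
move=> f0 bf n1; apply: le_trans (psum_le_tsum n.+1 bf).
by rewrite psumS// lerDr psum_ge0.
Qed.

Lemma bdsum_le f g : (forall n, (1 <= n)%N -> f n <= g n) -> bdsum g -> bdsum f.
Proof.
move=> fg [C gC]; exists C => N; apply: le_trans (gC N).
by apply: le_psum => n /andP[n1 _]; exact: fg.
Qed.

Lemma bdsum_fin f M : (forall n, (M <= n)%N -> f n = 0) -> bdsum f.
Proof.
move=> fM; exists (\sum_(0 <= n < M) `|f n|) => N.
have H K : (M <= K)%N -> psum f K <= \sum_(0 <= n < M) `|f n|.
  move=> MK; rewrite (le_trans (_ : _ <= \sum_(0 <= n < K) `|f n|))//.
    case: K MK => [|K] _; first by rewrite psum0 big_geq.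
    rewrite big_nat_recl// -[leLHS]add0r lerD//.
    by rewrite /psum big_add1/= ler_sum// => i _; exact: ler_norm.
  rewrite (big_cat_nat (leq0n M) MK)/= [X in _ + X]big1_seq ?addr0// => n /=.
  by rewrite mem_index_iota => /andP[/fM ->]; rewrite normr0.
have [/H//|NM] := leqP M N.
apply: le_trans (_ : psum (fun n => `|f n|) N <= _).
  by apply: le_psum => n _; exact: ler_norm.
rewrite /psum (le_trans (_ : _ <= \sum_(0 <= n < N) `|f n|))//.
  by case: N NM => [|N] _; [rewrite !big_geq|rewrite [leRHS]big_ltn// lerDr].
by rewrite [leRHS](big_cat_nat (leq0n N) (ltnW NM))/= lerDl sumr_ge0.
Qed.

Lemma nneseries_tsum f : (forall n, (1 <= n)%N -> 0 <= f n) -> bdsum f ->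
  (\sum_(1 <= n <oo) (f n)%:E = (tsum f)%:E)%E.
Proof.
move=> f0 bf; apply/cvg_lim => //.
rewrite (_ : (fun N => _) = EFin \o psum f); last first.
  by apply/funext => N /=; rewrite /psum -sumEFin.
by apply: cvg_EFin; [exact: nearW|exact: cvg_psum].
Qed.

Lemma bdsum_nneseries f : (forall n, (1 <= n)%N -> 0 <= f n) ->
  (\sum_(1 <= n <oo) (f n)%:E < +oo)%E -> bdsum f.
Proof.
move=> f0 fo; exists (fine (\sum_(1 <= n <oo) (f n)%:E)%E) => N.
rewrite -lee_fin fineK; last first.
  by rewrite ge0_fin_numE//; apply: nneseries_ge0 => n n1 _; rewrite lee_fin f0.
rewrite /psum -sumEFin; apply: nneseries_lim_ge => n n1 _.
by rewrite lee_fin f0.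
Qed.

End NonnegativeSums.

(** * The weighted sequence space as a complete normed module *)

Section WeightedSpace.
Context {R : realType} (p : R).
Implicit Types f g : nat -> R.

Let wf f := fun n => wgt p n * `|f n|.

Lemma wgt_ge0 n : 0 <= wgt p n.
Proof. exact: powR_ge0. Qed.

Lemma wgt_gt0 n : (1 <= n)%N -> 0 < wgt p n.
Proof. by move=> n1; rewrite powR_gt0// ltr0n. Qed.

Lemma wf_ge0 f n : (1 <= n)%N -> 0 <= wgt p n * `|f n|.
Proof. by move=> _; rewrite mulr_ge0// wgt_ge0. Qed.

Lemma inl1wP f : inl1w p f <-> f 0%N = 0 /\ bdsum (wf f).
Proof.
split=> -[f0 H]; split=> //.
  by apply: bdsum_nneseries => // n n1; exact: wf_ge0.
by rewrite /normw nneseries_tsum ?ltry// => n; exact: wf_ge0.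
Qed.

Definition l1pred : {pred nat -> R} := fun f => `[< inl1w p f >].

Lemma l1_submod_closed : submod_closed l1pred.
Proof.
split; first apply/asboolP/inl1wP.
  split=> //; apply: (@bdsum_fin _ _ 0) => n _; by rewrite /wf normr0 mulr0.
move=> c f g /asboolP/inl1wP[f0 [C fC]] /asboolP/inl1wP[g0 [D gD]].
apply/asboolP/inl1wP.
have E n : (c *: f + g) n = c * f n + g n by [].
rewrite E f0 g0 addr0 mulr0; split=> //.
exists (`|c| * C + D) => N.
apply: le_trans (_ : psum (fun n => `|c| * wf f n + wf g n) N <= _).
  apply: le_psum => n _; rewrite /wf fctE mulrCA -mulrDr ler_wpM2l ?wgt_ge0//.
  by rewrite (le_trans (ler_normD _ _))// normrM.
by rewrite psumD psumZ lerD// ler_wpM2l.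
Qed.

HB.instance Definition _ := GRing.isSubmodClosed.Build _ _ l1pred l1_submod_closed.

(** Bundling membership gives a type that can carry the normed and complete structures, so that
    convergence, continuity and Banach-Steinhaus apply to it directly. *)
Record l1w := L1w { l1fun :> nat -> R ; l1funP : l1fun \in l1pred }.
HB.instance Definition _ := [isSub for l1fun].
HB.instance Definition _ := [Choice of l1w by <:].
HB.instance Definition _ := [SubChoice_isSubLmodule of l1w by <:].
Implicit Types x y : l1w.

Lemma l1w_in x : inl1w p x.
Proof. exact/asboolP/l1funP. Qed.

Lemma l1w_coord0 x : x 0%N = 0.
Proof. by case: (l1w_in x). Qed.

Lemma l1wDE x y n : (x + y) n = x n + y n. Proof. by []. Qed.
Lemma l1wNE x n : (- x) n = - x n. Proof. by []. Qed.
Lemma l1wBE x y n : (x - y) n = x n - y n. Proof. by []. Qed.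
Lemma l1wZE c x n : (c *: x) n = c * x n. Proof. by []. Qed.
Lemma l1w0E n : (0 : l1w) n = 0. Proof. by []. Qed.

Lemma l1wP x y : (forall n, (1 <= n)%N -> x n = y n) -> x = y.
Proof.
move=> xy; apply/val_inj/funext => -[|n]; last exact: xy.
by rewrite [LHS]l1w_coord0 [RHS]l1w_coord0.
Qed.

Definition l1norm x : R := tsum (wf x).

Lemma l1w_bdsum x : bdsum (wf x).
Proof. by have /inl1wP[] := l1w_in x. Qed.

Lemma l1normD x y : l1norm (x + y) <= l1norm x + l1norm y.
Proof.
apply: tsum_le => N.
apply: le_trans (lerD (psum_le_tsum N (l1w_bdsum x)) (psum_le_tsum N (l1w_bdsum y))).
rewrite -psumD; apply: le_psum => n _.
by rewrite /wf -mulrDr ler_wpM2l ?wgt_ge0// ler_normD.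
Qed.

Lemma l1normZ c x : l1norm (c *: x) = `|c| * l1norm x.
Proof.
have H d y : l1norm (d *: y) <= `|d| * l1norm y.
  apply: tsum_le => N; apply: le_trans (ler_wpM2l _ (psum_le_tsum N (l1w_bdsum y))) => //.
  by rewrite -psumZ le_psum// => n _; rewrite /wf l1wZE normrM mulrCA.
apply/eqP; rewrite eq_le H/=; have [->|c0] := eqVneq c 0.
  by rewrite normr0 mul0r tsum_ge0//; exact: l1w_bdsum.
rewrite -ler_pdivlMl ?normr_gt0// -normfV.
by rewrite -{1}[x](scalerK c0) H.
Qed.

Lemma l1norm0_eq0 x : l1norm x = 0 -> x = 0.
Proof.
move=> x0; apply: l1wP => n n1.
have := le_tsum_term (@wf_ge0 x) (l1w_bdsum x) n1.
rewrite -/(l1norm x) x0 pmulr_rle0 ?wgt_gt0// normr_le0 => /eqP ->//.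
Qed.

HB.instance Definition _ :=
  Lmodule_isNormed.Build R l1w l1normD l1normZ l1norm0_eq0.

Lemma norm_l1wE x : `|x| = tsum (fun n => wgt p n * `|x n|).
Proof. by []. Qed.

Lemma norm_l1w_le x C : (forall N, psum (fun n => wgt p n * `|x n|) N <= C) ->
  `|x| <= C.
Proof. exact: tsum_le. Qed.

Lemma psum_le_norm_l1w x N : psum (fun n => wgt p n * `|x n|) N <= `|x|.
Proof. exact/psum_le_tsum/l1w_bdsum. Qed.

Lemma coord_le_norm_l1w x n : wgt p n * `|x n| <= `|x|.
Proof.
case: n => [|n]; first by rewrite l1w_coord0 normr0 mulr0.
by apply: (le_tsum_term (@wf_ge0 x)) => //; exact: l1w_bdsum.
Qed.

Lemma normw_l1w x : normw p x = (`|x|)%:E.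
Proof.
rewrite /normw nneseries_tsum//; [exact: wf_ge0 | exact: l1w_bdsum].
Qed.

Lemma normr_coord n x : (1 <= n)%N -> `|x n| <= (wgt p n)^-1 * `|x|.
Proof.
by move=> n1; rewrite -ler_pdivrMl ?invr_gt0 ?wgt_gt0// invrK coord_le_norm_l1w.
Qed.

Lemma l1w_coord_continuous n : continuous (fun x : l1w => x n).
Proof.
case: n => [|n] x; apply/(@cvgrPdist_lt _ _ _ (nbhs x)) => e e0; near=> y.
  by rewrite !l1w_coord0 subrr normr0.
rewrite -l1wBE (le_lt_trans (normr_coord _ _))// ltr_pdivrMl ?wgt_gt0//.
near: y; apply: (@cvgr_dist_lt _ _ _ (nbhs x) _ id x); first exact: cvg_id.
by rewrite mulr_gt0// wgt_gt0.
Unshelve. all: by end_near. Qed.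

(** Total constructor with default value [0]: only under [inl1w] does it return the given sequence.
    The lock keeps conversion from unfolding the default. *)
Definition mkl1w : (nat -> R) -> l1w := locked (fun f => insubd 0 f).

Lemma mkl1wE f : inl1w p f -> mkl1w f = f :> (nat -> R).
Proof. by move=> fin; rewrite /mkl1w -lock insubdK//; exact/asboolP. Qed.

Lemma inl1w_le f C : f 0%N = 0 ->
  (forall N, psum (fun n => wgt p n * `|f n|) N <= C) -> inl1w p f.
Proof. by move=> f0 fC; apply/inl1wP; split=> //; exists C. Qed.

Lemma inl1w_fin f M : f 0%N = 0 -> (forall n, (M <= n)%N -> f n = 0) -> inl1w p f.
Proof.
move=> f0 fM; apply/inl1wP; split=> //; apply: (@bdsum_fin _ _ M) => n /fM.
by rewrite /wf => ->; rewrite normr0 mulr0.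
Qed.

Definition truncl1w M x : l1w := mkl1w (fun n => if (n < M)%N then x n else 0).

Lemma truncl1wE M x n : truncl1w M x n = if (n < M)%N then x n else 0.
Proof.
rewrite mkl1wE//; apply: (@inl1w_fin _ M) => [|k Mk]; last by rewrite ltnNge Mk.
by case: ifP; rewrite ?l1w_coord0.
Qed.

Lemma truncl1w_cvg x e : 0 < e ->
  exists M0, forall M, (M0 <= M)%N -> `|x - truncl1w M x| < e.
Proof.
move=> e0; have [M0 H] := tsum_approx (@wf_ge0 x) (l1w_bdsum x) (divr_gt0 e0 (ltr0n _ 2)).
exists M0 => M MM; apply: (@le_lt_trans _ _ (e / 2)); last first.
  by rewrite gtr_pMr// invf_lt1// ltr1n.
apply: norm_l1w_le => N; have {H}H := H _ MM.
pose g n := wgt p n * `|(x - truncl1w M x) n|.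
have gE n : g n = if (n < M)%N then 0 else wf x n.
  by rewrite /g l1wBE truncl1wE; case: ifP; rewrite ?subrr ?normr0 ?mulr0 ?subr0.
have g0 n : (1 <= n)%N -> 0 <= g n by exact: wf_ge0.
rewrite -/g; apply: (@le_trans _ _ (psum g (maxn N M))).
  exact/(nondecreasing_psum g0)/leq_maxl.
have := psum_le_tsum (maxn N M) (l1w_bdsum x); rewrite -/(wf x) => H2.
have : psum (wf x) (maxn N M) = psum (wf x) M + psum g (maxn N M).
  rewrite /psum; clearbody g; case: M {MM H2} gE H g0 => [|M] gE H g0.
    by rewrite maxn0 (@big_geq _ _ _ 1 0)// add0r; apply: eq_bigr => i _; rewrite gE.
  have MN : (M.+1 <= maxn N M.+1)%N by exact: leq_maxr.
  rewrite (big_cat_nat _ MN)//= [in RHS](big_cat_nat _ MN)//=.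
  rewrite [X in _ = _ + (X + _)]big1_seq ?add0r => [|i /=]; last first.
    by rewrite mem_index_iota => /andP[_ iM]; rewrite gE iM.
  congr (_ + _); apply: eq_big_seq => i; rewrite mem_index_iota => /andP[Mi _].
  by rewrite gE ltnNge Mi.
by lra.
Qed.

(** Coordinates converge in [R]. A bound on [x - y] for [y] near the filter passes to the
    coordinatewise limit in each finite partial sum, which shows both that the limit lies in the
    space and that it is a limit in norm. *)
Lemma l1w_complete (F : set_system l1w) : ProperFilter F -> cauchy F -> cvg F.
Proof.
move=> FF Fc.
have Fe e : 0 < e -> \forall x & y \near F, `|x - y| < e.
  move=> e0; move/cauchy_ballP : Fc => /(_ e e0).
  by apply: filterS => -[x y]; rewrite -ball_normE.
have cF n : cauchy ((fun x : l1w => x n) @ F).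
  apply: cauchy_exP => e e0; case: n => [|n].
    exists 0; apply: (@filterS _ F _ setT); last exact: filterT.
    by move=> x _ /=; rewrite l1w_coord0; exact: ballxx.
  have we0 : 0 < wgt p n.+1 * e by rewrite mulr_gt0 ?wgt_gt0.
  near F => x; exists (x n.+1).
  have : \forall y \near F, `|x - y| < wgt p n.+1 * e.
    by near: x; apply: nearP_dep; exact: Fe.
  apply: filterS => y xy; rewrite -ball_normE/= -l1wBE.
  by rewrite (le_lt_trans (normr_coord _ _))// ltr_pdivrMl ?wgt_gt0.
have {cF} cvF n : (fun x : l1w => x n) @ F --> lim ((fun x : l1w => x n) @ F).
  exact: cauchy_cvg (cF n).
pose l n := lim ((fun x : l1w => x n) @ F).
have close e x : (\forall y \near F, `|x - y| <= e) ->
    forall N, psum (fun n => wgt p n * `|x n - l n|) N <= e.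
  move=> Fx N.
  have H : (fun y : l1w => psum (fun n => wgt p n * `|x n - y n|) N) @ F -->
      psum (fun n => wgt p n * `|x n - l n|) N.
    apply: cvg_psum_term => n _; apply: cvgMr; apply: cvg_norm.
    by apply: cvgB; [exact: cvg_cst|exact: cvF].
  rewrite -(cvg_lim _ H)//; apply: limr_le; first by apply/cvg_ex; eexists; exact: H.
  by apply: filterS Fx => y; apply: le_trans; exact: psum_le_norm_l1w (x - y) N.
have l0 : l 0%N = 0.
  apply/cvg_lim => //; rewrite (_ : (fun x : l1w => x 0%N) = fun=> 0); first exact: cvg_cst.
  by apply/funext => x; rewrite l1w_coord0.
near F => x0.
have x01 : \forall y \near F, `|x0 - y| <= 1.
  near: x0; apply: nearP_dep; apply: filterS (Fe 1 ltr01) => -[x y] /=; exact: ltW.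
have lin : inl1w p l.
  have H : inl1w p (fun n => x0 n - l n).
    apply: (@inl1w_le _ 1); first by rewrite l1w_coord0 l0 subr0.
    exact: close.
  rewrite (_ : l = x0 - mkl1w (fun n => x0 n - l n)); first exact: l1w_in.
  by apply/funext => n; rewrite l1wBE mkl1wE// opprB addrC subrK.
apply/cvg_ex; exists (mkl1w l); apply/cvgrPdist_le => e e0.
near=> x; rewrite distrC; apply: norm_l1w_le => N.
rewrite (eq_psum (g := fun n => wgt p n * `|x n - l n|)); last first.
  by move=> n; rewrite l1wBE mkl1wE.
apply: close; near: x; apply: nearP_dep.
by apply: filterS (Fe e e0) => -[x y] /=; exact: ltW.
Unshelve. all: by end_near. Qed.

HB.instance Definition _ := Uniform_isComplete.Build l1w l1w_complete.

End WeightedSpace.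

(** * Monotonicity and Gronwall from one-sided increments *)

Section DiniDerivatives.
Context {R : realType}.
Implicit Types (phi : R -> R) (a b t h e d : R).

(** Continuous induction on the set of points where [phi s <= phi a + e (s - a)]: the second
    hypothesis, excluding upward jumps from the left, puts the supremum into the set, and the first
    moves beyond a supremum smaller than [b]. *)
Lemma dini_nonincreasing phi a b : a <= b ->
  (forall t, a <= t -> t < b -> forall e, 0 < e -> exists2 d, 0 < d &
     forall h, 0 < h -> h < d -> phi (t + h) <= phi t + e * h) ->
  (forall t, a < t -> t <= b -> forall e, 0 < e -> exists2 d, 0 < d &
     forall h, 0 < h -> h < d -> phi t <= phi (t - h) + e) ->
  phi b <= phi a.
Proof.
move=> ab dr dl; apply/ler_addgt0Pr => e0 e00.
(* A slope whose total loss [e (b - a)] stays below [e0]; the [+ 1] covers [a = b]. *)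
pose e := e0 / (b - a + 1).
have ba1 : 0 < b - a + 1 by lra.
have e_gt0 : 0 < e by exact: divr_gt0.
have ee : e * (b - a) <= e0.
  rewrite /e mulrAC ler_pdivrMr// ler_wpM2l; lra.
apply: le_trans (_ : phi a + e * (b - a) <= _); last by lra.
pose E := [set s | [/\ a <= s, s <= b & phi s <= phi a + e * (s - a)]].
have Ea : E a by split => //; rewrite subrr mulr0 addr0.
have supE : has_sup E by split; [exists a|exists b => s []].
pose s := sup E.
have as_ : a <= s by apply: ub_le_sup => //; case: supE.
have sb : s <= b by apply: ge_sup; [exists a|move=> x []].
have Es : E s.
  split => //; have [->|sa] := eqVneq s a; first by rewrite subrr mulr0 addr0.
  have {sa}as_ : a < s by rewrite lt_neqAle eq_sym sa.
  apply/ler_addgt0Pr => e' e'0; have [d d0 H] := dl s as_ sb e' e'0.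
  have [x Ex xs] := sup_adherent d0 supE.
  have xs' : x <= s by apply: ub_le_sup => //; case: supE.
  move: xs'; rewrite le_eqVlt => /predU1P[xs'|xs'].
    by move: Ex; rewrite xs' => -[_ _]; lra.
  case: Ex => ax xb phx; rewrite -/s in xs.
  have := H (s - x); rewrite subr_gt0 opprB addrCA subrr addr0.
  have xsd : s - x < d by lra.
  move=> /(_ xs' xsd) H2.
  have : e * (x - a) <= e * (s - a) by rewrite ler_wpM2l//; lra.
  by lra.
have [->|sb'] := eqVneq b s; first by case: Es.
have {sb'}sb' : s < b by rewrite lt_neqAle sb eq_sym sb'.
have [d d0 H] := dr s as_ sb' e e_gt0.
pose h := Num.min (d / 2) (b - s).
have h0 : 0 < h by rewrite lt_min divr_gt0// subr_gt0.
have hd : h < d by rewrite gt_min; apply/orP; left; lra.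
have hb : h <= b - s by rewrite ge_min lexx orbT.
have : E (s + h).
  split; [lra|lra|].
  case: Es => _ _ phs; have := H h h0 hd; lra.
move=> /(ub_le_sup supE.2); rewrite -/s; lra.
Qed.

(** Replaces the integration of a bound [G]: the majorant [Gam] is explicit and grows at least at
    rate [G], so [phi - Gam] is nonincreasing. *)
Lemma dini_le phi (Gam G : R -> R) a b : a <= b ->
  continuous phi -> continuous Gam ->
  (forall t, a <= t -> t < b -> forall e, 0 < e -> exists2 d, 0 < d &
     forall h, 0 < h -> h < d -> phi (t + h) <= phi t + h * G t + e * h) ->
  (forall t h, a <= t -> t < b -> 0 < h -> Gam t + h * G t <= Gam (t + h)) ->
  phi b - phi a <= Gam b - Gam a.
Proof.
move=> ab cphi cGam H1 H2.
have : phi b - Gam b <= phi a - Gam a; last by lra.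
apply: (@dini_nonincreasing (fun t => phi t - Gam t)) => //.
  move=> t at_ tb e e0; have [d d0 H] := H1 t at_ tb e e0.
  exists d => // h h0 hd; have := H h h0 hd; have := H2 t h at_ tb h0; lra.
move=> t at_ tb e e0.
have : {for t, continuous (fun t => phi t - Gam t)}.
  by apply: cvgB; [exact: cphi|exact: cGam].
move=> /cvgrPdist_le /(_ e e0) /nbhs_ballP[d /= d0 H].
exists d => // h h0 hd; have := H (t - h).
rewrite /ball/= opprB addrCA subrr addr0 gtr0_norm// => /(_ hd)/ler_normlW.
lra.
Qed.

(** With the integrating factor [E t], the growth factor is absorbed by [1 + K h <= expR (K h)], and
    [phi t * E t] is nonincreasing. *)
Lemma dini_gronwall phi K a b : a <= b -> 0 <= K -> continuous phi ->
  (forall t, 0 <= phi t) ->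
  (forall t, a <= t -> t < b -> forall e, 0 < e -> exists2 d, 0 < d &
     forall h, 0 < h -> h < d -> phi (t + h) <= (1 + K * h) * phi t + e * h) ->
  phi b <= phi a * expR (K * (b - a)).
Proof.
move=> ab K0 cphi phi0 H.
pose E t := expR (- (K * (t - a))).
have cE : continuous E.
  move=> t; apply: continuous_comp; last exact: continuous_expR.
  apply: cvgN; apply: cvgMr; apply: cvgB; [exact: cvg_id|exact: cvg_cst].
have E0 t : 0 < E t by exact: expR_gt0.
have ED t h : E (t + h) = E t * expR (- (K * h)).
  by rewrite /E -expRD; congr expR; ring.
have Kh h : 0 <= h -> (1 + K * h) * expR (- (K * h)) <= 1.
  move=> h0; rewrite expRN ler_pdivrMr ?expR_gt0// mul1r; exact: expR_ge1Dx.
have E1 h : 0 <= h -> expR (- (K * h)) <= 1.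
  by move=> h0; rewrite -expR0 ler_expR oppr_le0 mulr_ge0.
have : phi b * E b - phi a * E a <= cst 0 b - cst 0 a.
  apply: (@dini_le (fun t => phi t * E t) (cst 0) (cst 0)) => //.
  - by move=> t; apply: cvgM; [exact: cphi|exact: cE].
  - by move=> t; exact: cvg_cst.
  - move=> t at_ tb e e0.
    (* The error term is multiplied by [E t] below, hence the tolerance divided by it. *)
    have [d d0 {}H] := H t at_ tb (e / E t) (divr_gt0 e0 (E0 t)).
    exists d => // h h0 hd; have {}H := H h h0 hd.
    rewrite mulr0 addr0 ED.
    apply: le_trans (_ : ((1 + K * h) * phi t + e / E t * h) *
                          (E t * expR (- (K * h))) <= _).
      by rewrite ler_wpM2r// mulr_ge0// ?expR_ge0// ltW.
    rewrite mulrDl lerD//.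
      rewrite [leLHS](_ : _ = phi t * E t * ((1 + K * h) * expR (- (K * h)))); last by ring.
      by rewrite ler_piMr ?Kh ?(ltW h0)// mulr_ge0 ?phi0// ltW.
    rewrite [leLHS](_ : _ = e * h * expR (- (K * h))); last first.
      by field; rewrite gt_eqF.
    by rewrite ler_piMr ?E1 ?mulr_ge0 ?(ltW h0) ?(ltW e0).
  - by move=> t h _ _ _; rewrite mulr0 addr0.
rewrite subrr {2}/E subrr mulr0 oppr0 expR0 mulr1 subr_le0 /E expRN.
by rewrite ler_pdivrMr ?expR_gt0.
Qed.

End DiniDerivatives.

(** * Integrals of real functions continuous on the line *)

Section ContinuousIntegrals.
Context {R : realType}.
Implicit Types (f g : R -> R) (a b c : R).
Local Notation mu := (@lebesgue_measure R).

(** The lemmas ask for continuity on the whole line, which makes integrability on every segment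
    automatic; functions known only on a window are first composed with a clamp. *)
Definition rint a b f : R := \int[mu]_(s in `[a, b]) f s.

Lemma continuous_itv_integrable a b f : continuous f ->
  mu.-integrable `[a, b] (EFin \o f).
Proof.
move=> cf; apply: continuous_compact_integrable; first exact: segment_compact.
exact: continuous_subspaceT.
Qed.

Lemma eq_rint a b f g : (forall s, a <= s -> s <= b -> f s = g s) ->
  rint a b f = rint a b g.
Proof.
move=> fg; apply: eq_Rintegral => s; rewrite inE/= in_itv/= => /andP[]; exact: fg.
Qed.

Lemma rint_cat a b c f : a <= b -> b <= c -> continuous f ->
  rint a c f = rint a b f + rint b c f.
Proof.
move=> ab bc cf; apply/eqP; rewrite addrC -subr_eq; apply/eqP.
rewrite /rint Rintegral_itvB ?bnd_simp//; last exact: continuous_itv_integrable.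
apply: Rintegral_itv_obnd_cbnd; apply: integrableS (continuous_itv_integrable b c cf) => //.
exact: subset_itv_oc_cc.
Qed.

Lemma rintD a b f g : continuous f -> continuous g ->
  rint a b (fun s => f s + g s) = rint a b f + rint a b g.
Proof. by move=> cf cg; apply: RintegralD => //; exact: continuous_itv_integrable. Qed.

Lemma rintB a b f g : continuous f -> continuous g ->
  rint a b (fun s => f s - g s) = rint a b f - rint a b g.
Proof. by move=> cf cg; apply: RintegralB => //; exact: continuous_itv_integrable. Qed.

Lemma rintZ a b c f : continuous f ->
  rint a b (fun s => c * f s) = c * rint a b f.
Proof. by move=> cf; apply: RintegralZl => //; exact: continuous_itv_integrable. Qed.

Lemma rint_cst a b c : a <= b -> rint a b (fun=> c) = c * (b - a).
Proof.
move=> ab; rewrite /rint Rintegral_cst//= lebesgue_measure_itv/= lte_fin.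
by case: ltP => //= ba; rewrite (@le_anti _ _ a b) ?ab// subrr.
Qed.

Lemma rint_refl a f : rint a a f = 0.
Proof. by rewrite /rint set_itv1 Rintegral_set1. Qed.

Lemma le_rint a b f g : continuous f -> continuous g ->
  (forall s, a <= s -> s <= b -> f s <= g s) -> rint a b f <= rint a b g.
Proof.
move=> cf cg fg; apply: le_Rintegral => //; try exact: continuous_itv_integrable.
by move=> s /=; rewrite in_itv/= => /andP[]; exact: fg.
Qed.

Lemma continuous_norm f : continuous f -> continuous (fun s => `|f s|).
Proof. by move=> cf s; apply: cvg_norm; exact: cf. Qed.

Lemma norm_rint_le a b f : continuous f -> `|rint a b f| <= rint a b (fun s => `|f s|).
Proof. by move=> cf; apply: le_normr_Rintegral => //; exact: continuous_itv_integrable. Qed.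

Lemma continuous_psum (F : R -> nat -> R) N : (forall n, continuous (F^~ n)) ->
  continuous (fun s => psum (F s) N).
Proof. by move=> cF s; apply: cvg_psum_term => n _; exact: cF. Qed.

Lemma rint_psum a b (F : R -> nat -> R) N : (forall n, continuous (F^~ n)) ->
  rint a b (fun s => psum (F s) N) = psum (fun n => rint a b (F^~ n)) N.
Proof.
move=> cF; have Z : rint a b (fun=> 0) = 0.
  have cz : continuous (fun _ : R => 0 : R) by move=> x; exact: cvg_cst.
  rewrite -[RHS](mul0r (rint a b (fun=> 0))) -rintZ//.
  by apply: eq_rint => s _ _; rewrite mul0r.
elim: N => [|[|N] IH].
- by rewrite psum0 -[RHS]Z; apply: eq_rint => s _ _; rewrite psum0.
- rewrite [RHS]/psum big_geq// -[RHS]Z.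
  by apply: eq_rint => s _ _; rewrite /psum big_geq.
- rewrite psumS// -IH -rintD//; last exact: continuous_psum.
  by apply: eq_rint => s _ _; rewrite psumS.
Qed.

End ContinuousIntegrals.

(** * Integrals of continuous curves in the sequence space *)

Section VectorIntegrals.
Context {R : realType} {p : R}.
Local Notation X := (l1w p).
Implicit Types (x y : R -> X) (a b c : R).

(** Coordinatewise substitute for the Bochner integral; for continuous [x] the estimate of
    [psum_rint_le] shows that the coordinates form an element of the space. *)
Definition vint a b x : X := mkl1w p (fun n => rint a b (fun s => x s n)).

Lemma continuous_coord x n : continuous x -> continuous (fun s => x s n).
Proof.
move=> cx s; apply: (@continuous_comp _ _ _ x (fun y : X => y n)); first exact: cx.
exact: (@l1w_coord_continuous R p n (x s)).
Qed.

Lemma continuous_normX x : continuous x -> continuous (fun s => `|x s|).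
Proof. by move=> cx s; apply: cvg_norm; exact: cx. Qed.

(** Minkowski's integral inequality on finite partial sums, where sum and integral commute; the
    bound is free of [N], hence a bound on the norm. *)
Lemma psum_rint_le a b x N : continuous x ->
  psum (fun n => wgt p n * `|rint a b (fun s => x s n)|) N <= rint a b (fun s => `|x s|).
Proof.
move=> cx.
have cn n : continuous (fun s => wgt p n * `|x s n|).
  by move=> s; apply: cvgMr; apply: continuous_norm; exact: continuous_coord.
apply: le_trans (_ : rint a b (fun s => psum (fun n => wgt p n * `|x s n|) N) <= _).
  rewrite rint_psum//; apply: le_psum => n _.
  rewrite rintZ; last by apply: continuous_norm; exact: continuous_coord.
  rewrite ler_wpM2l ?wgt_ge0//; apply: norm_rint_le; exact: continuous_coord.
apply: le_rint; [exact: continuous_psum|exact: continuous_normX|] => s _ _.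
exact: psum_le_norm_l1w.
Qed.

Lemma vintE a b x n : continuous x -> vint a b x n = rint a b (fun s => x s n).
Proof.
move=> cx; rewrite mkl1wE//; apply: (@inl1w_le _ _ _ (rint a b (fun s => `|x s|))).
  rewrite -(mul0r (rint a b (fun=> 0))) -rintZ; last by move=> ?; exact: cvg_cst.
  by apply: eq_rint => s _ _; rewrite l1w_coord0 mul0r.
by move=> N; exact: psum_rint_le.
Qed.

Lemma norm_vint_le a b x : continuous x -> `|vint a b x| <= rint a b (fun s => `|x s|).
Proof.
move=> cx; apply: norm_l1w_le => N; apply: le_trans (psum_rint_le a b N cx).
by apply: le_psum => n _; rewrite vintE.
Qed.

Lemma norm_vint_le_cst a b x C : a <= b -> continuous x ->
  (forall s, a <= s -> s <= b -> `|x s| <= C) -> `|vint a b x| <= C * (b - a).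
Proof.
move=> ab cx xC; rewrite -rint_cst//; apply: le_trans (norm_vint_le a b cx) _.
by apply: le_rint => //; [exact: continuous_normX|move=> s; exact: cvg_cst].
Qed.

Lemma eq_vint a b x y : (forall s, a <= s -> s <= b -> x s = y s) ->
  vint a b x = vint a b y.
Proof.
move=> xy; congr mkl1w; apply/funext => n; apply: eq_rint => s sa sb.
by rewrite xy.
Qed.

Lemma vintB a b x y : continuous x -> continuous y ->
  vint a b (fun s => x s - y s) = vint a b x - vint a b y.
Proof.
move=> cx cy; apply: l1wP => n _; rewrite l1wBE (vintE _ _ _ cx) (vintE _ _ _ cy) vintE.
  by rewrite -rintB//; exact: continuous_coord.
by move=> s; apply: cvgB; [exact: cx|exact: cy].
Qed.

Lemma vint_cat a b c x : a <= b -> b <= c -> continuous x ->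
  vint a c x = vint a b x + vint b c x.
Proof.
move=> ab bc cx; apply: l1wP => n _.
rewrite l1wDE (vintE a c n cx) (vintE a b n cx) (vintE b c n cx).
by apply: rint_cat => //; exact: continuous_coord.
Qed.

Lemma vint_cst a b (v : X) : a <= b -> vint a b (fun=> v) = (b - a) *: v.
Proof.
move=> ab; apply: l1wP => n _; rewrite vintE; last by move=> ?; exact: cvg_cst.
by rewrite rint_cst// l1wZE mulrC.
Qed.

Lemma vint_refl a x : vint a a x = 0.
Proof.
apply: l1wP => n _; rewrite mkl1wE ?rint_refl//.
by apply: (@inl1w_fin _ _ _ 0) => *; rewrite rint_refl.
Qed.

(** The right derivative of the integral at [b] is [x b], since [h *: x b] is itself the integral of
    a constant and [x] varies little on a short interval. *)
Lemma continuous_vint a x : continuous x ->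
  forall b, a <= b -> forall e, 0 < e -> exists2 d, 0 < d &
    forall h, 0 < h -> h < d -> `|vint b (b + h) x - h *: x b| <= e * h.
Proof.
move=> cx b ab e e0.
have /cvgrPdist_le/(_ e e0)/nbhs_ballP[d /= d0 H] := cx b.
exists d => // h h0 hd.
have bh : b <= b + h by rewrite lerDl ltW.
rewrite (_ : h *: x b = vint b (b + h) (fun=> x b)); last first.
  by rewrite vint_cst// addrAC subrr add0r.
have cc : continuous (fun _ : R => x b) by move=> ?; exact: cvg_cst.
rewrite -vintB// (_ : e * h = e * (b + h - b)); last by congr (_ * _); ring.
apply: norm_vint_le_cst => //.
  by move=> s; apply: cvgB; [exact: cx|exact: cvg_cst].
move=> s bs sh; rewrite distrC; apply: H; rewrite /ball/= distrC ger0_norm; lra.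
Qed.

Lemma vint_left_small x t e : continuous x -> 0 < e -> exists2 d, 0 < d &
  forall h, 0 < h -> h < d -> `|vint (t - h) t x| <= e.
Proof.
move=> cx e0; have /cvgrPdist_le/(_ 1 ltr01)/nbhs_ballP[d /= d0 H] := cx t.
have C0 : 0 < `|x t| + 1 by rewrite ltr_wpDl.
exists (Num.min d (e / (`|x t| + 1))); first by rewrite lt_min d0 divr_gt0.
move=> h h0; rewrite lt_min => /andP[hd he].
apply: (@le_trans _ _ ((`|x t| + 1) * (t - (t - h)))).
  apply: norm_vint_le_cst => //; first by lra.
  move=> s hs st; have {H} : `|x t - x s| <= 1.
    by apply: H; rewrite /ball/= ger0_norm; lra.
  have := ler_normB (x t) (x t - x s); rewrite opprB addrC subrK; lra.
rewrite opprB addrCA subrr addr0 mulrC -ler_pdivlMr//; exact: ltW.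
Qed.

(* The defect |L (vint a t x) - vint a t (L \o x)| has zero right derivative in t. *)
Lemma vint_linear (L : X -> X) M a b x : a <= b ->
  (forall u v, L (u - v) = L u - L v) -> (forall r u, L (r *: u) = r *: L u) ->
  0 <= M -> (forall u, `|L u| <= M * `|u|) -> continuous x ->
  L (vint a b x) = vint a b (L \o x).
Proof.
move=> ab LB LZ M0 LM cx.
have L0 : L 0 = 0 by rewrite -{1}(subrr (0 : X)) LB subrr.
have LN u : L (- u) = - L u by rewrite -[- u]sub0r LB L0 sub0r.
have LD u v : L (u + v) = L u + L v by rewrite -{1}[v]opprK LB LN opprK.
have cL : continuous (L \o x).
  move=> s; apply/cvgrPdist_lt => e e0.
  have M1 : 0 < M + 1 by lra.
  have /cvgrPdist_lt/(_ (e / (M + 1)) (divr_gt0 e0 M1)) := cx s.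
  apply: filterS => r /= H; rewrite -LB; apply: le_lt_trans (LM _) _.
  apply: (@le_lt_trans _ _ ((M + 1) * `|x s - x r|)).
    by rewrite ler_wpM2r//; lra.
  by rewrite mulrC -ltr_pdivlMr.
pose D t := L (vint a t x) - vint a t (L \o x).
have DD s t : a <= s -> s <= t -> D t = D s + (L (vint s t x) - vint s t (L \o x)).
  move=> as_ st; rewrite /D (vint_cat as_ st cx) (vint_cat as_ st cL) LD.
  by rewrite opprD addrACA.
have Da : `|D a| = 0 by rewrite /D !vint_refl L0 subrr normr0.
suff : `|D b| <= `|D a|.
  by rewrite Da normr_le0 subr_eq0 => /eqP.
apply: (@dini_nonincreasing _ (fun t => `|D t|)) => //.
  move=> t at_ tb e e0.
  have e'0 : 0 < e / (M + 1) by apply: divr_gt0 => //; lra.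
  have [d1 d10 H1] := continuous_vint cx at_ e'0.
  have [d2 d20 H2] := continuous_vint cL at_ e'0.
  exists (Num.min d1 d2); first by rewrite lt_min d10.
  move=> h h0; rewrite lt_min => /andP[hd1 hd2].
  rewrite (DD t) ?lerDl ?(ltW h0)//; apply: le_trans (ler_normD _ _) _.
  rewrite lerD2l; have {}H1 := H1 h h0 hd1; have {}H2 := H2 h h0 hd2.
  rewrite (_ : L _ - _ = L (vint t (t + h) x - h *: x t) -
                         (vint t (t + h) (L \o x) - h *: L (x t))); last first.
    by rewrite LB LZ opprB addrA subrK.
  apply: le_trans (ler_normB _ _) _.
  apply: (@le_trans _ _ (M * (e / (M + 1) * h) + e / (M + 1) * h)).
    by rewrite lerD//; apply: le_trans (LM _) _; rewrite ler_wpM2l.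
  rewrite le_eqVlt; apply/orP; left; apply/eqP; field; apply/eqP; lra.
move=> t at_ tb e e0.
have e'0 : 0 < e / (M + 1) by apply: divr_gt0 => //; lra.
have [d1 d10 H1] := vint_left_small t cx e'0.
have [d2 d20 H2] := vint_left_small t cL e'0.
exists (Num.min (Num.min d1 d2) (t - a)); first by rewrite !lt_min d10 d20 subr_gt0.
move=> h h0; rewrite !lt_min => /andP[/andP[hd1 hd2] hta].
rewrite (DD (t - h) t); [|lra|lra].
apply: le_trans (ler_normD _ _) _.
rewrite lerD2l; have {}H1 := H1 h h0 hd1; have {}H2 := H2 h h0 hd2.
apply: le_trans (ler_normB _ _) _.
apply: (@le_trans _ _ (M * (e / (M + 1)) + e / (M + 1))).
  by rewrite lerD//; apply: le_trans (LM _) _; rewrite ler_wpM2l.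
rewrite le_eqVlt; apply/orP; left; apply/eqP; field; apply/eqP; lra.
Qed.

End VectorIntegrals.

(** * Contraction semigroups, the Duhamel formula and monitored functionals *)

Section MildEquations.
Context {R : realType} {p : R}.
Local Notation X := (l1w p).
Implicit Types (x y : X) (u v f g : R -> X) (t s h tau : R).

(* The family is extended by the identity to negative times, so that
   [s |-> S (t - s) (g s)] is continuous on the whole line. *)
Record contraction_semigroup (S : R -> X -> X) : Prop := ContractionSemigroup {
  csg_linear : forall t c x y, S t (c *: x + y) = c *: S t x + S t y ;
  csg_norm : forall t x, `|S t x| <= `|x| ;
  csg_0 : forall x, S 0 x = x ;
  csg_D : forall t s x, 0 <= t -> 0 <= s -> S (t + s) x = S t (S s x) ;
  csg_continuous : forall x, continuous (fun t => S t x) }.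

Variable S : R -> X -> X.
Hypothesis Ssg : contraction_semigroup S.

Let SZD := csg_linear Ssg.
Let Snorm := csg_norm Ssg.

Lemma csgD t x y : S t (x + y) = S t x + S t y.
Proof. by rewrite -[in LHS](scale1r x) SZD scale1r. Qed.

Lemma csg_zero t : S t 0 = 0.
Proof. by have := SZD t (-1) 0 0; rewrite scaler0 addr0 scaleN1r addNr. Qed.

Lemma csgZ t c x : S t (c *: x) = c *: S t x.
Proof. by have := SZD t c x 0; rewrite csg_zero !addr0. Qed.

Lemma csgB t x y : S t (x - y) = S t x - S t y.
Proof. by rewrite csgD -scaleN1r csgZ scaleN1r. Qed.

Lemma csg_dist t x y : `|S t x - S t y| <= `|x - y|.
Proof. by rewrite -csgB. Qed.

Lemma csg_continuous_comp (r : R -> R) g : continuous r -> continuous g ->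
  continuous (fun s => S (r s) (g s)).
Proof.
move=> cr cg s; apply/(@cvgrPdist_lt _ _ _ (nbhs s)) => e e0.
have e20 : 0 < e / 2 by rewrite divr_gt0.
have c1 : {for s, continuous (fun s' => S (r s') (g s))}.
  apply: (@continuous_comp _ _ _ r (fun t => S t (g s))); first exact: cr.
  exact: csg_continuous.
have /cvgrPdist_lt/(_ _ e20) H1 := c1.
have /cvgrPdist_lt/(_ _ e20) H2 := cg s.
near=> s'.
rewrite -[X in `|X|](subrKA (S (r s') (g s))) (le_lt_trans (ler_normD _ _))//.
rewrite [e]splitr ltrD//; first by near: s'.
by apply: le_lt_trans (csg_dist _ _ _) _; near: s'.
Unshelve. all: by end_near. Qed.

Definition duhamel t x g : X := S t x + vint 0 t (fun s => S (t - s) (g s)).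

Lemma continuous_integrand t g : continuous g ->
  continuous (fun s => S (t - s) (g s)).
Proof.
move=> cg; apply: csg_continuous_comp => // s.
by apply: cvgB; [exact: cvg_cst|exact: cvg_id].
Qed.

Lemma duhamel0 x g : duhamel 0 x g = x.
Proof. by rewrite /duhamel vint_refl csg_0// addr0. Qed.

Lemma duhamelB t x y f g : continuous f -> continuous g ->
  duhamel t x f - duhamel t y g = duhamel t (x - y) (fun s => f s - g s).
Proof.
move=> cf cg; rewrite /duhamel opprD addrACA -csgB; congr (_ + _).
rewrite -vintB; [|exact: continuous_integrand|exact: continuous_integrand].
by apply: eq_vint => s _ _; rewrite csgB.
Qed.

Lemma eq_duhamel t x f g : (forall s, 0 <= s -> s <= t -> f s = g s) ->
  duhamel t x f = duhamel t x g.
Proof. by move=> fg; congr (_ + _); apply: eq_vint => s s0 st; rewrite fg. Qed.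

(** Restarting at time [t]: [S h] is moved inside the integral over [[0, t]] and merged with
    [S (t - s)] by the semigroup law. This is what makes later estimates local in time. *)
Lemma duhamel_step t h x g : 0 <= t -> 0 <= h -> continuous g ->
  duhamel (t + h) x g =
  S h (duhamel t x g) + vint t (t + h) (fun s => S (t + h - s) (g s)).
Proof.
move=> t0 h0 cg; rewrite /duhamel (vint_cat (b := t))//; last 2 first.
  by rewrite lerDl.
  exact: continuous_integrand.
rewrite addrA csgD addrC [t + h]addrC csg_D// addrC; congr (_ + _ + _).
rewrite (@vint_linear _ _ (S h) 1)//.
- by apply: eq_vint => s s0 st /=; rewrite -csg_D ?subr_ge0// addrA.
- exact: csgB.
- by move=> c x'; exact: csgZ.
- by move=> y; rewrite mul1r.
- exact: continuous_integrand.
Qed.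

(** First-order expansion that never applies the generator: the semigroup acts on the Euler step as
    a whole. The remainder is an integral over [[t, t + h]] of a difference that is small by
    continuity of [g] and of one orbit. *)
Lemma duhamel_tangent t x g : 0 <= t -> continuous g ->
  forall e, 0 < e -> exists2 d, 0 < d & forall h, 0 < h -> h < d ->
    `|duhamel (t + h) x g - S h (duhamel t x g + h *: g t)| <= e * h.
Proof.
move=> t0 cg e e0; have e20 : 0 < e / 2 by rewrite divr_gt0.
have /cvgrPdist_le/(_ _ e20)/nbhs_ballP[d1 /= d10 H1] := cg t.
have cS : (fun s => S s (g t)) @ (0 : R) --> g t.
  by rewrite -[X in _ --> X](csg_0 Ssg); exact: csg_continuous.
have /cvgrPdist_le/(_ _ e20)/nbhs_ballP[d2 /= d20 H2] := cS.
exists (Num.min d1 d2); first by rewrite lt_min d10.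
move=> h h0; rewrite lt_min => /andP[hd1 hd2].
have tth : t <= t + h by rewrite lerDl ltW.
have ci := @continuous_integrand (t + h) g cg.
have cc : continuous (fun _ : R => S h (g t)) by move=> ?; exact: cvg_cst.
have -> : duhamel (t + h) x g - S h (duhamel t x g + h *: g t) =
    vint t (t + h) (fun s => S (t + h - s) (g s) - S h (g t)).
  rewrite (duhamel_step x t0 (ltW h0) cg) csgD csgZ vintB// vint_cst//.
  by rewrite opprD addrACA subrr add0r addrAC subrr add0r.
rewrite (_ : e * h = e * (t + h - t)); last by congr (_ * _); ring.
apply: norm_vint_le_cst => //.
  by move=> s; apply: cvgB; [exact: ci|exact: cvg_cst].
move=> s ts sh.
(* Factoring out the common [S (t + h - s)] lets contractivity reduce the difference to [g s]
   against [S (s - t) (g t)]. *)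
have -> : S h (g t) = S (t + h - s) (S (s - t) (g t)).
  rewrite -(csg_D Ssg) ?subr_ge0//; congr S; ring.
rewrite -csgB (le_trans (Snorm _ _))//.
apply: le_trans (ler_distD (g t) _ _) _; rewrite [e]splitr lerD//.
  by rewrite distrC; apply: H1; rewrite /ball/= distrC ger0_norm; lra.
by apply: H2; rewrite /ball/= sub0r normrN ger0_norm; lra.
Qed.

(* The nonlinear functionals along which the evolution is monitored. *)
Record monitor (q : X -> R) : Prop := Monitor {
  mon_D : forall x y, q (x + y) <= q x + q y ;
  mon_ge0 : forall x, 0 <= q x ;
  mon_norm : forall x, q x <= `|x| ;
  mon_S : forall t x, 0 <= t -> q (S t x) <= q x }.

Lemma monitor_norm : monitor (fun x => `|x|).
Proof. by split=> //; exact: ler_normD. Qed.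

Lemma monitor_dist q x y : monitor q -> q x <= q y + `|x - y|.
Proof.
move=> mq; rewrite -{1}(subrK y x) addrC (le_trans (mon_D mq _ _))//.
by rewrite lerD2l mon_norm.
Qed.

Lemma monitor_continuous q u : monitor q -> continuous u ->
  continuous (fun t => q (u t)).
Proof.
move=> mq cu t; apply/cvgrPdist_le => e e0.
have /cvgrPdist_le/(_ _ e0) := cu t; apply: filterS => s H.
have := monitor_dist (u t) (u s) mq; have := monitor_dist (u s) (u t) mq.
rewrite [`|u s - u t|]distrC ler_norml; lra.
Qed.

(** The generator disappears here: [q] is 1-Lipschitz, which absorbs the remainder, and does not
    increase under [S h], so only the explicit step is left. *)
Lemma monitor_tangent q tau u x g t : monitor q -> 0 <= t -> t < tau ->
  continuous g -> (forall s, 0 <= s -> s <= tau -> u s = duhamel s x g) ->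
  forall e, 0 < e -> exists2 d, 0 < d & forall h, 0 < h -> h < d ->
    q (u (t + h)) <= q (u t + h *: g t) + e * h.
Proof.
move=> mq t0 ttau cg ue e e0; have [d d0 H] := duhamel_tangent x t0 cg e0.
exists (Num.min d (tau - t)); first by rewrite lt_min d0 subr_gt0.
move=> h h0; rewrite lt_min => /andP[hd ht]; have {}H := H h h0 hd.
rewrite ue; [|lra|lra]; rewrite (ue t) ?(ltW ttau)//.
apply: le_trans (monitor_dist _ (S h (duhamel t x g + h *: g t)) mq) _.
by rewrite lerD// mon_S// ltW.
Qed.

(** Reduces a bound along the trajectory to an inequality for one Euler step at a frozen time; the
    admissible step size may depend on that time. *)
Lemma monitor_gronwall q K tau u x g : monitor q -> 0 <= tau -> 0 <= K ->
  continuous u -> continuous g ->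
  (forall s, 0 <= s -> s <= tau -> u s = duhamel s x g) ->
  (forall t, 0 <= t -> t < tau -> exists2 d, 0 < d & forall h, 0 < h -> h < d ->
    q (u t + h *: g t) <= (1 + K * h) * q (u t)) ->
  forall t, 0 <= t -> t <= tau -> q (u t) <= q x * expR (K * t).
Proof.
move=> mq tau0 K0 cu cg ue H t t0 ttau.
have u0 : u 0 = x by rewrite ue// duhamel0.
have := @dini_gronwall _ (fun t => q (u t)) K 0 t t0 K0.
rewrite u0 subr0; apply.
- exact: monitor_continuous.
- by move=> s; exact: mon_ge0.
- move=> s s0 st e e0.
  have stau : s < tau by exact: lt_le_trans ttau.
  have [d1 d10 H1] := monitor_tangent mq s0 stau cg ue e0.
  have [d2 d20 H2] := H s s0 stau.
  exists (Num.min d1 d2); first by rewrite lt_min d10.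
  move=> h h0; rewrite lt_min => /andP[hd1 hd2].
  by apply: le_trans (H1 h h0 hd1) _; rewrite lerD2r H2.
Qed.

Lemma continuous_bounded a b u : a <= b -> continuous u ->
  exists2 C, 0 < C & forall s, a <= s -> s <= b -> `|u s| <= C.
Proof.
move=> ab cu.
have [|c _ H] := @EVT_max R (fun s => `|u s|) a b ab.
  by apply: continuous_subspaceT; exact: continuous_normX.
exists (`|u c| + 1); first by rewrite ltr_wpDl.
move=> s as_ sb; apply: le_trans (_ : `|u c| <= _); last by lra.
by apply: H; rewrite in_itv/= as_.
Qed.

(** For [tau >= 0], the 1-Lipschitz projection of the line onto [[0, tau]]; composing with it turns
    data on the window into data on the line. *)
Definition clamp tau t : R := Num.max 0 (Num.min t tau).

Lemma clamp_ge0 tau t : 0 <= clamp tau t.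
Proof. by rewrite le_max lexx. Qed.

Lemma clamp_le tau t : 0 <= tau -> clamp tau t <= tau.
Proof. by move=> tau0; rewrite ge_max tau0/= ge_min lexx orbT. Qed.

Lemma clampE tau t : 0 <= t -> t <= tau -> clamp tau t = t.
Proof. by move=> t0 tt; rewrite /clamp min_l// max_r. Qed.

Lemma clampK tau t : 0 <= tau -> clamp tau (clamp tau t) = clamp tau t.
Proof. by move=> tau0; rewrite clampE ?clamp_ge0 ?clamp_le. Qed.

Lemma clamp_dist tau t s : `|clamp tau t - clamp tau s| <= `|t - s|.
Proof.
rewrite /clamp /Order.max /Order.min.
by repeat case: ifPn; rewrite -?leNgt => *; rewrite ler_norml; have := ler_norm (t - s);
  have := lerNnormlW (lexx `|t - s|); lra.
Qed.

Lemma continuous_clamp tau : continuous (clamp tau).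
Proof.
move=> t; apply/(@cvgrPdist_lt _ _ _ (nbhs t)) => e e0; near=> s.
apply: le_lt_trans (clamp_dist _ _ _) _; near: s.
exact: (@cvgr_dist_lt _ _ _ (nbhs t) _ id t).
Unshelve. all: by end_near. Qed.

(** The time occurs both as upper limit and inside the integrand. The first dependence costs at most
    a bound [C] times the change of time; the second needs the integrands to be close uniformly on
    [[0, tau]], which compactness provides. *)
Lemma continuous_duhamel tau x g : 0 <= tau -> continuous g ->
  continuous (fun t => duhamel (clamp tau t) x g).
Proof.
move=> tau0 cg; move=> t0; apply: cvgD.
  exact: (csg_continuous_comp (@continuous_clamp tau) (fun=> @cvg_cst _ _ _ _ _)).
apply/(@cvgrPdist_le _ _ _ (nbhs t0)) => e e0.
pose k t s := S (clamp tau t - s) (g s).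
have tau1 : 0 < tau + 1 by lra.
(* Integrated over a length of at most [tau], a uniform error [e'] costs at most [e / 2]. *)
pose e' := e / 2 / (tau + 1).
have e'0 : 0 < e' by rewrite !divr_gt0.
have kc t : continuous (k t) by exact: continuous_integrand.
have [C C0 HC] := continuous_bounded tau0 (kc t0).
have unif : \forall t \near t0, `[0, tau]%classic `<=`
    (fun s => `|k t0 s - k t s| <= e').
  have Hnc := (@compact_near_coveringP _ `[0, tau]%classic).1 (@segment_compact R 0 tau).
  apply: (Hnc _ (nbhs t0) (fun t s => `|k t0 s - k t s| <= e')) => s0 _.
  have e40 : 0 < e' / 4 by rewrite divr_gt0.
  have /cvgrPdist_le/(_ _ e40)/nbhs_ballP[d /= d0 H1] :=
    @csg_continuous _ Ssg (g s0) (clamp tau t0 - s0).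
  have /cvgrPdist_le/(_ _ e40) H2 := cg s0.
  (* The intermediate point applies the new time to the fixed vector [g s0]: contractivity handles
     the change of vector, orbit continuity the change of time. Two time shifts add up, hence
     [d / 2] for each. *)
  have B t s : `|t0 - t| < d / 2 -> `|s0 - s| < d / 2 ->
      `|g s0 - g s| <= e' / 4 -> `|k t0 s0 - k t s| <= e' / 2.
    move=> td sd gs.
    rewrite -[X in `|X|](subrKA (S (clamp tau t - s) (g s0))).
    rewrite (le_trans (ler_normD _ _))//.
    have A1 := csg_dist (clamp tau t - s) (g s0) (g s).
    suff : `|k t0 s0 - S (clamp tau t - s) (g s0)| <= e' / 4.
      by move: A1 gs; rewrite -/(k t s); lra.
    apply: H1; rewrite /ball/=.
    rewrite (_ : _ - _ = (clamp tau t0 - clamp tau t) - (s0 - s)); last by ring.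
    have := clamp_dist tau t0 t; have := ler_normB (clamp tau t0 - clamp tau t) (s0 - s).
    by lra.
  have d20 : 0 < d / 2 by rewrite divr_gt0.
  near=> s t => /=.
  have A1 : `|t0 - t| < d / 2.
    by near: t; exact: (@cvgr_dist_lt _ _ _ (nbhs t0) _ id t0).
  have A2 : `|s0 - s| < d / 2.
    by near: s; exact: (@cvgr_dist_lt _ _ _ (nbhs s0) _ id s0).
  have A3 : `|g s0 - g s| <= e' / 4 by near: s.
  rewrite -[X in `|X|](subrKA (k t0 s0)) (le_trans (ler_normD _ _))//.
  rewrite [e']splitr lerD ?B// distrC B// subrr normr0//.
have near_t : \forall t \near t0, `|t0 - t| <= e / 2 / (C + 1).
  by apply: (@cvgr_dist_le _ _ _ (nbhs t0) _ id t0) => //; rewrite !divr_gt0//; lra.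
near=> t.
have U : `[0, tau]%classic `<=` (fun s => `|k t0 s - k t s| <= e') by near: t.
have D : `|t0 - t| <= e / 2 / (C + 1) by near: t.
have [ct0 ct] := (clamp_ge0 tau t0, clamp_ge0 tau t).
have [ctt0 ctt] := (clamp_le t0 tau0, clamp_le t tau0).
have I1 : `|vint 0 (clamp tau t) (k t0) - vint 0 (clamp tau t) (k t)| <= e / 2.
  rewrite -vintB//; apply: (@le_trans _ _ (e' * (clamp tau t - 0))).
    apply: norm_vint_le_cst => //.
      by move=> s; apply: cvgB; exact: kc.
    by move=> s s0 st; apply: U; rewrite /= in_itv/= s0 (le_trans st).
  rewrite subr0 /e' mulrAC ler_pdivrMr// ler_wpM2l; lra.
have I2 : `|vint 0 (clamp tau t0) (k t0) - vint 0 (clamp tau t) (k t0)| <= e / 2.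
  have CE : C * `|clamp tau t0 - clamp tau t| <= e / 2.
    apply: (@le_trans _ _ (C * (e / 2 / (C + 1)))).
      by rewrite ler_wpM2l ?(ltW C0)//; apply: le_trans (clamp_dist _ _ _) _.
    rewrite mulrA ler_pdivrMr; last by lra.
    by rewrite mulrC ler_wpM2l; lra.
  have [tt|tt] := leP (clamp tau t) (clamp tau t0).
    rewrite (vint_cat ct tt (kc t0)) addrC addKr.
    apply: le_trans CE; rewrite ger0_norm ?subr_ge0//.
    by apply: norm_vint_le_cst => // s s1 s2; apply: HC; lra.
  rewrite (vint_cat ct0 (ltW tt) (kc t0)) opprD addrA subrr add0r normrN.
  apply: le_trans CE; rewrite distrC ger0_norm ?subr_ge0 ?(ltW tt)//.
  by apply: norm_vint_le_cst => // [|s s1 s2]; [exact: ltW|apply: HC; lra].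
rewrite -[X in `|X|](subrKA (vint 0 (clamp tau t) (k t0))).
by rewrite (le_trans (ler_normD _ _))// [e]splitr; exact: (lerD I2 I1).
Unshelve. all: by end_near. Qed.

(** * Picard iteration for a globally Lipschitz nonlinearity *)

Section Picard.
Variables (F : R -> X -> X) (L tau : R) (x0 : X).
Hypotheses (L0 : 0 < L) (tau0 : 0 <= tau).
Hypothesis Fcont : forall v, continuous v -> continuous (fun s => F s (v s)).
Hypothesis Flip : forall s x y, `|F s x - F s y| <= L * `|x - y|.

Let Phi v t := duhamel (clamp tau t) x0 (fun s => F s (v s)).

Lemma Phi_continuous v : continuous v -> continuous (Phi v).
Proof. by move=> cv; apply: continuous_duhamel => //; exact: Fcont. Qed.

(* The weight [expR (2 L t)] makes the Picard map a contraction of ratio 1/2. *)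
Lemma Phi_contract v w C : continuous v -> continuous w -> 0 <= C ->
  (forall t, 0 <= t -> t <= tau -> `|v t - w t| <= C * expR (2 * L * t)) ->
  forall t, 0 <= t -> t <= tau ->
    `|Phi v t - Phi w t| <= C / 2 * expR (2 * L * t).
Proof.
move=> cv cw C0 vw t t0 ttau.
pose D t := Phi v t - Phi w t.
pose g s := F s (v s) - F s (w s).
have cg : continuous g by move=> s; apply: cvgB; exact: Fcont.
have cD : continuous D by move=> s; apply: cvgB; exact: Phi_continuous.
have DE s : 0 <= s -> s <= tau -> D s = duhamel s 0 g.
  move=> s0 st; rewrite /D /Phi clampE// duhamelB ?subrr//; exact: Fcont.
(* Its derivative [2 * L * Gam s] equals [L * (C * expR (2 * L * s))], the Lipschitz bound on the
   forcing [g]; this is where the ratio 1/2 comes from. *)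
pose Gam s := C / 2 * expR (2 * L * s).
have cGam : continuous Gam.
  move=> s; apply: cvgMr; apply: continuous_comp; last exact: continuous_expR.
  by apply: cvgMr; exact: cvg_id.
have D0 : D 0 = 0 by rewrite DE// duhamel0.
have : `|D t| - `|D 0| <= Gam t - Gam 0.
  apply: (@dini_le _ (fun s => `|D s|) Gam (fun s => 2 * L * Gam s)) => //.
  - exact: continuous_normX.
  - move=> s s0 st e e0; have stau : s < tau by exact: lt_le_trans ttau.
    have [d d0 H] := monitor_tangent monitor_norm s0 stau cg DE e0.
    exists d => // h h0 hd; apply: le_trans (H h h0 hd) _; rewrite lerD2r.
    apply: le_trans (ler_normD _ _) _; rewrite lerD2l normrZ gtr0_norm//.
    rewrite ler_wpM2l ?(ltW h0)//; apply: le_trans (Flip _ _ _) _.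
    rewrite (_ : 2 * L * Gam s = L * (C * expR (2 * L * s))); last first.
      by rewrite /Gam; field.
    by rewrite ler_wpM2l ?(ltW L0)// vw// ltW.
  - move=> s h s0 st h0; rewrite /Gam.
    rewrite (_ : expR (2 * L * (s + h)) = expR (2 * L * s) * expR (2 * L * h)); last first.
      by rewrite -expRD mulrDr.
    rewrite (_ : _ + _ = C / 2 * expR (2 * L * s) * (1 + 2 * L * h)); last by ring.
    rewrite [leRHS]mulrA ler_wpM2l ?expR_ge1Dx//.
    by rewrite mulr_ge0 ?expR_ge0// divr_ge0.
rewrite D0 normr0 subr0 => H; apply: le_trans H _.
by rewrite lerBlDr lerDl mulr_ge0 ?expR_ge0// divr_ge0.
Qed.

(** Successive iterates differ by at most [E / 2 ^+ k], uniformly in time, so they converge to a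
    continuous limit. The limit is a fixed point because [Phi (v_ n)] is close both to [Phi v] and,
    as the next iterate, to [v]. *)
Theorem picard : exists2 v, continuous v & forall t, 0 <= t -> t <= tau ->
  v t = duhamel t x0 (fun s => F s (v s)).
Proof.
pose v_ k := iter k Phi (fun=> x0).
have cv k : continuous (v_ k).
  by elim: k => [t|k IH]; [exact: cvg_cst|exact: Phi_continuous].
(* Every iterate depends on time through the clamp only, so estimates on [[0, tau]] hold on the
   whole line. *)
have cl k t : v_ k t = v_ k (clamp tau t).
  by case: k => // k; rewrite /v_/= /Phi clampK.
have [C C0 HC] := @continuous_bounded 0 tau (fun t => v_ 1%N t - v_ 0%N t) tau0
  (fun t => cvgB (cv 1%N t) (cv 0%N t)).
pose E := C * expR (2 * L * tau).
have E0 : 0 < E by rewrite mulr_gt0 ?expR_gt0.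
have step k t : `|v_ k.+1 t - v_ k t| <= E / 2 ^+ k.
  rewrite !(cl _ t); set s := clamp tau t.
  have s0 : 0 <= s by exact: clamp_ge0.
  have st : s <= tau by exact: clamp_le.
  apply: (@le_trans _ _ (C / 2 ^+ k * expR (2 * L * s))); last first.
    rewrite /E mulrAC ler_wpM2r ?invr_ge0 ?exprn_ge0// ler_wpM2l ?(ltW C0)//.
    by rewrite ler_expR ler_wpM2l// mulr_ge0// ltW.
  elim: k s s0 st => [|k IH] s s0 st.
    rewrite expr0 divr1; apply: le_trans (HC s s0 st) _.
    rewrite ler_peMr ?(ltW C0)// -expR0 ler_expR !mulr_ge0//; exact: ltW.
  have -> : C / 2 ^+ k.+1 = C / 2 ^+ k / 2 by rewrite exprS invfM; ring.
  apply: Phi_contract => //; first exact: (cv k.+1).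
  by rewrite divr_ge0 ?exprn_ge0// ltW.
have tail n j t : `|v_ n t - v_ (n + j)%N t| <= 2 * E / 2 ^+ n.
  (* The geometric tail in telescoping form, with the remainder subtracted, is what the induction on
     [j] can carry. *)
  suff : `|v_ n t - v_ (n + j)%N t| <= 2 * E / 2 ^+ n - 2 * E / 2 ^+ (n + j).
    move=> H; apply: le_trans H _; rewrite gerBl divr_ge0 ?exprn_ge0// mulr_ge0//.
    exact: ltW.
  elim: j => [|j IH]; first by rewrite addn0 !subrr normr0.
  rewrite addnS -[X in `|X|](subrKA (v_ (n + j)%N t)) (le_trans (ler_normD _ _))//.
  have -> : 2 * E / 2 ^+ (n + j).+1 = E / 2 ^+ (n + j).
    by rewrite exprS invfM mulrACA divff ?pnatr_eq0// mul1r.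
  have := step (n + j)%N t; rewrite distrC; move: IH.
  by set A := _ / 2 ^+ n; set B := (2 ^+ (n + j))^-1; lra.
have small e : 0 < e -> exists n, 2 * E / 2 ^+ n <= e.
  move=> e0; have h1 : `|2^-1 : R| < 1 by rewrite ger0_norm// invf_lt1// ltr1n.
  have /cvgrPdist_le/(_ _ e0)[n _ /(_ n (leqnn n))] := cvg_geometric (2 * E) h1.
  rewrite sub0r normrN /geometric/= => /(le_trans (ler_norm _)) H.
  by exists n; rewrite -exprVn.
have cvg_v t : cvg ((fun k => v_ k t) @ \oo).
  apply: cauchy_cvg; apply: cauchy_exP => e e0.
  have e20 : 0 < e / 2 by rewrite divr_gt0.
  have [n Hn] := small _ e20; exists (v_ n t); exists n => // k /= nk.
  rewrite -ball_normE /=; apply: (@le_lt_trans _ _ (e / 2)); last by lra.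
  by apply: le_trans Hn; rewrite -(subnKC nk); exact: tail.
pose v t := lim ((fun k => v_ k t) @ \oo).
have close n t : `|v_ n t - v t| <= 2 * E / 2 ^+ n.
  apply/ler_addgt0Pr => e e0.
  have /cvgrPdist_le/(_ e e0)[m _ Hm] := cvg_v t.
  have {}Hm := Hm (n + m)%N (leq_addl _ _).
  rewrite -[X in `|X|](subrKA (v_ (n + m)%N t)) (le_trans (ler_normD _ _))//.
  by apply: lerD; [exact: tail|rewrite distrC; exact: Hm].
have ctv : continuous v.
  move=> t; apply/(@cvgrPdist_le _ _ _ (nbhs t)) => e e0.
  have e30 : 0 < e / 3 by rewrite divr_gt0.
  have [n Hn] := small _ e30.
  have /cvgrPdist_le/(_ _ e30) := cv n t; apply: filterS => s H.
  have H1 := le_trans (close n t) Hn; have H2 := le_trans (close n s) Hn.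
  rewrite distrC in H1.
  rewrite -[X in `|X|](subrKA (v_ n t)) (le_trans (ler_normD _ _))//.
  rewrite -[X in _ + `|X|](subrKA (v_ n s)).
  have := ler_normD (v_ n t - v_ n s) (v_ n s - v s); lra.
exists v => // t t0 ttau.
have -> : duhamel t x0 (fun s => F s (v s)) = Phi v t by rewrite /Phi clampE.
apply/eqP; rewrite -subr_eq0 -normr_le0; apply/ler_addgt0Pr => e e0.
(* [K] dominates the exponential weight on the window; each of the two remaining errors is at most
   [K] times half of [2 * E / 2 ^+ n]. *)
rewrite add0r; pose K := expR (2 * L * tau).
have K1 : 1 <= K by rewrite /K -expR0 ler_expR !mulr_ge0//; exact: ltW.
have eK : 0 < e / (2 * K) by rewrite divr_gt0//; lra.
have [n Hn] := small _ eK.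
have Kt : expR (2 * L * t) <= K by rewrite ler_expR ler_wpM2l// mulr_ge0// ltW.
have Et : 1 <= expR (2 * L * t) by rewrite -expR0 ler_expR !mulr_ge0//; exact: ltW.
have c0 : 0 <= 2 * E / 2 ^+ n by rewrite divr_ge0 ?exprn_ge0// mulr_ge0// ltW.
have H1 : `|Phi (v_ n) t - Phi v t| <= 2 * E / 2 ^+ n / 2 * expR (2 * L * t).
  apply: Phi_contract => // s s0 st; apply: le_trans (close n s) _.
  by rewrite ler_peMr// -expR0 ler_expR !mulr_ge0//; exact: ltW.
have H2 := close n.+1 t; rewrite exprS invfM in H2.
rewrite distrC -[X in `|X|](subrKA (v_ n.+1 t)) (le_trans (ler_normD _ _))//.
rewrite -[v_ n.+1]/(Phi (v_ n)) [X in X + _]distrC.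
rewrite -[v_ n.+1]/(Phi (v_ n)) in H2.
move: Hn; rewrite ler_pdivlMr; last by lra.
have H3 : 2 * E / 2 ^+ n / 2 * expR (2 * L * t) <= 2 * E / 2 ^+ n / 2 * K.
  by rewrite ler_wpM2l// divr_ge0.
have H4 : 2 * E * (2^-1 / 2 ^+ n) <= 2 * E / 2 ^+ n / 2 * K.
  rewrite (_ : 2 * E * (2^-1 / 2 ^+ n) = 2 * E / 2 ^+ n / 2); last by ring.
  by rewrite ler_peMr// divr_ge0.
move: H1 H2 H3 H4; set A := 2 * E / _ => *; lra.
Qed.

End Picard.

End MildEquations.

(** * Weighted moments of the positive part *)

Section PositivePartFunctionals.
Context {R : realType} {p : R}.
Local Notation X := (l1w p).
Implicit Types (x y : X) (W : nat -> R).

(** Domination by [wgt p] makes the moment finite on the whole space and 1-Lipschitz for its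
    norm. *)
Definition subweight W := forall n, (1 <= n)%N -> 0 <= W n <= wgt p n.

Lemma subweight_wgt : subweight (wgt p).
Proof. by move=> n _; rewrite wgt_ge0 lexx. Qed.

(** A half-norm: sublinear and blind to negative coordinates. Evaluated at [- x] with [W = wgt p] it
    vanishes exactly on the positive cone. *)
Definition posq W x : R := tsum (fun n => W n * Num.max 0 (x n)).

Lemma max0D (c d : R) : Num.max 0 (c + d) <= Num.max 0 c + Num.max 0 d.
Proof. by rewrite ge_max; apply/andP; split; rewrite /Order.max; do 2 case: ifP; lra. Qed.

Lemma max0_ge0 (c : R) : 0 <= Num.max 0 c. Proof. by rewrite le_max lexx. Qed.

Lemma max0_norm (c : R) : Num.max 0 c <= `|c|.
Proof. by rewrite ge_max normr_ge0 ler_norm. Qed.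

Variable W : nat -> R.
Hypothesis Ww : subweight W.

Lemma posq_term_ge0 x n : (1 <= n)%N -> 0 <= W n * Num.max 0 (x n).
Proof. by move=> n1; rewrite mulr_ge0 ?max0_ge0//; case/andP: (Ww n1). Qed.

Lemma posq_term_le x n : (1 <= n)%N -> W n * Num.max 0 (x n) <= wgt p n * `|x n|.
Proof.
move=> n1; case/andP: (Ww n1) => W0 Wn.
by rewrite ler_pM ?max0_ge0 ?max0_norm.
Qed.

Lemma posq_bdsum x : bdsum (fun n => W n * Num.max 0 (x n)).
Proof. by apply: bdsum_le (l1w_bdsum x) => n; exact: posq_term_le. Qed.

Lemma posq_ge0 x : 0 <= posq W x.
Proof. exact/tsum_ge0/posq_bdsum. Qed.

Lemma posq_norm x : posq W x <= `|x|.
Proof.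
apply: tsum_le => N; apply: le_trans (psum_le_norm_l1w x N).
by apply: le_psum => n /andP[n1 _]; exact: posq_term_le.
Qed.

Lemma posqD x y : posq W (x + y) <= posq W x + posq W y.
Proof.
apply: tsum_le => N.
apply: le_trans (lerD (psum_le_tsum N (posq_bdsum x)) (psum_le_tsum N (posq_bdsum y))).
rewrite -psumD; apply: le_psum => n /andP[n1 _]; rewrite -mulrDr l1wDE.
by apply: ler_wpM2l (max0D _ _); case/andP: (Ww n1).
Qed.

Lemma posq_dist x y : posq W x <= posq W y + `|x - y|.
Proof.
by rewrite -{1}(subrK y x) addrC (le_trans (posqD _ _))// lerD2l posq_norm.
Qed.

Lemma psum_le_posq x N : psum (fun n => W n * Num.max 0 (x n)) N <= posq W x.
Proof. exact/psum_le_tsum/posq_bdsum. Qed.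

End PositivePartFunctionals.

(** * Dispersivity of fragmentation and of its closure *)

Section Dispersivity.
Context {R : realType} {p : R} (a : nat -> R) (b : nat -> nat -> R).
Local Notation X := (l1w p).
Hypothesis a_ge0 : forall n, (1 <= n)%N -> 0 <= a n.
Hypothesis b_ge0 : forall n j, (1 <= n)%N -> (1 <= j)%N -> 0 <= b n j.
Hypothesis b_eq0 : forall n j, (1 <= n)%N -> (j <= n)%N -> b n j = 0.
Variable W : nat -> R.
Hypothesis Ww : subweight (p := p) W.
Hypothesis Wb : forall j, (2 <= j)%N -> \sum_(1 <= n < j) (W n * b n j) <= W j.

Let W0 n : (1 <= n)%N -> 0 <= W n. Proof. by move=> /Ww/andP[]. Qed.

Lemma psum_frag_le j N : (1 <= j)%N -> psum (fun n => W n * b n j) N <= W j.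
Proof.
move=> j1; have Wj : psum (fun n => W n * b n j) j <= W j.
  case: j j1 => [//|[|j]] _; last exact: Wb.
  by rewrite /psum big_geq// W0.
have t0 n : (1 <= n)%N -> 0 <= W n * b n j by move=> n1; rewrite mulr_ge0 ?W0 ?b_ge0.
have [Nj|jN] := leqP N j.
  exact: le_trans (nondecreasing_psum t0 Nj) Wj.
rewrite /psum (big_cat_nat j1 (ltnW jN))/= -/(psum _ j).
rewrite [X in _ + X]big1_seq ?addr0// => n /=; rewrite mem_index_iota => /andP[jn _].
by rewrite b_eq0 ?mulr0// (leq_trans j1).
Qed.

(** The positive part of [x - h y] is at least [s n * (x n - h * y n)], with [s] the indicator of
    [x n > 0]. Tested against [W n * s n], the loss gives exactly minus the sum of [W n a n] times
    the positive part, finite because [x] is in the domain of [A]. The gain is at most the same sum,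
    by exchanging sums and using that fragments carry no more [W] than their parent. *)
Lemma dispersive_core (x y : X) h : 0 <= h -> domA p a x -> domB p a b x ->
  y = ABop a b x :> (nat -> R) -> posq W x <= posq W (x - h *: y).
Proof.
move=> h0 [_ Ax] [_ [cB _]] yE.
pose fp n := Num.max 0 (x n).
pose s n : R := (0 < x n)%R%:R.
have s01 n : 0 <= s n <= 1 by rewrite /s; case: (_ < _); rewrite ?lexx ler01.
have fpE n : fp n = s n * x n.
  by rewrite /fp /s /Order.max; case: ifP; rewrite ?mul1r ?mul0r.
have fp0 n : 0 <= fp n by exact: max0_ge0.
have xfp n : x n <= fp n by rewrite /fp le_max lexx orbT.
pose WA n := W n * (a n * fp n).
have WA0 n : (1 <= n)%N -> 0 <= WA n.
  by move=> n1; rewrite !mulr_ge0 ?W0 ?a_ge0.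
have bWA : bdsum WA.
  have /inl1wP[_] := Ax; apply: bdsum_le => n n1.
  case/andP: (Ww n1) => _ Wn; apply: ler_pM => //; rewrite ?W0 ?mulr_ge0 ?a_ge0//.
  rewrite /Aop gtn_eqF// normrN normrM ger0_norm ?a_ge0// ler_wpM2l ?a_ge0//.
  exact: max0_norm.
pose Bs M n := \sum_(n.+1 <= j < M) (a j * b n j * x j).
(* The rows of [B] are limits, so the bound is proved for the truncations [Bs M], where all sums are
   finite and can be exchanged. *)
have HB N : psum (fun n => W n * s n * Bop a b x n) N <= tsum WA.
  have cv : psum (fun n => W n * s n * Bs M n) N @[M --> \oo] -->
            psum (fun n => W n * s n * Bop a b x n) N.
    apply: cvg_psum_term => n n1; apply: cvgMr.
    by rewrite /Bop gtn_eqF//; exact: cB.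
  rewrite -(cvg_lim _ cv)//; apply: limr_le; first by apply/cvg_ex; eexists; exact: cv.
  apply: nearW => M; apply: le_trans (psum_le_tsum M bWA).
  apply: (@le_trans _ _ (psum (fun n => psum (fun j => a j * fp j * (W n * b n j)) M) N)).
    apply: le_psum => n /andP[n1 _].
    apply: (@le_trans _ _ (W n * s n * psum (fun j => a j * b n j * fp j) M)).
      rewrite ler_wpM2l//; first by rewrite mulr_ge0 ?W0//; case/andP: (s01 n).
      have g0 j : (1 <= j)%N -> 0 <= a j * b n j * fp j.
        by move=> j1; rewrite !mulr_ge0 ?a_ge0 ?b_ge0.
      have [Mn|nM] := leqP M n.+1; first by rewrite /Bs big_geq// psum_ge0.
      rewrite /psum (big_cat_nat (isT : (1 <= n.+1)%N) (ltnW nM))/= -[leLHS]add0r lerD//.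
        exact: psum_ge0.
      rewrite /Bs !big_nat; apply: ler_sum => j /andP[nj _].
      have j1 : (1 <= j)%N by exact: leq_trans nj.
      by rewrite ler_wpM2l// mulr_ge0 ?a_ge0 ?b_ge0.
    rewrite -psumZ; apply: le_psum => j /andP[j1 _].
    rewrite (_ : _ * _ = s n * (a j * fp j * (W n * b n j))); last by ring.
    rewrite ler_piMl ?mulr_ge0 ?W0 ?a_ge0 ?b_ge0//; by case/andP: (s01 n).
  rewrite /psum exchange_big_nat/=; apply: le_psum => j /andP[j1 _].
  rewrite -mulr_sumr /WA mulrC; apply: ler_wpM2r; first by rewrite mulr_ge0 ?a_ge0.
  exact: psum_frag_le.
(* At finite [N] the loss is only a partial sum while the gain is bounded by the full one; their
   gap, times [h], vanishes as [N] grows. *)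
have HN N : psum (fun n => W n * fp n) N + h * psum WA N - h * tsum WA <=
    posq W (x - h *: y).
  apply: le_trans (psum_le_posq Ww _ N).
  apply: (@le_trans _ _ (psum (fun n => W n * fp n) N + h * psum WA N
     - h * psum (fun n => W n * s n * Bop a b x n) N)).
    by rewrite lerB// ler_wpM2l.
  rewrite -!psumZ lerBlDr -!psumD; apply: le_psum => n /andP[n1 _].
  rewrite l1wBE l1wZE -lerBlDr.
  apply: (@le_trans _ _ (W n * (s n * (x n - h * y n)))).
    rewrite yE /ABop /Aop gtn_eqF// /WA fpE le_eqVlt; apply/orP; left; apply/eqP; ring.
  rewrite ler_wpM2l ?W0// /s; case: (_ < _); rewrite ?mul1r ?mul0r ?max0_ge0//.
  by rewrite le_max lexx orbT.
apply/ler_addgt0Pr => e e0.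
have e'0 : 0 < e / (1 + h) by rewrite divr_gt0//; lra.
have [N1 H1] := tsum_approx WA0 bWA e'0.
have [N2 H2] := tsum_approx (posq_term_ge0 Ww x) (posq_bdsum Ww x) e'0.
have {}H1 := H1 _ (leq_maxl N1 N2); have {}H2 := H2 _ (leq_maxr N1 N2).
have := HN (maxn N1 N2); rewrite -/(posq W x) -/fp in H2 *.
have {}H1 : h * tsum WA <= h * (psum WA (maxn N1 N2) + e / (1 + h)).
  by rewrite ler_wpM2l// ltW.
have : h * (e / (1 + h)) + e / (1 + h) = e by field; apply/eqP; lra.
by move: H1 H2; rewrite mulrDr /fp /posq; lra.
Qed.

(** The inequality is stable under graph convergence because [posq W] is 1-Lipschitz. The tolerance
    [e / (2 + h)] pays twice for the error on [x] and [h] times for the error on [y]. *)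
Lemma dispersive (x y : X) h : 0 <= h -> Gclos p a b x y ->
  posq W x <= posq W (x - h *: y).
Proof.
move=> h0 [_ [_ [F [dF [cF cG]]]]].
have inF k : inl1w p (F k) by case: (dF k) => -[].
have inG k : inl1w p (ABop a b (F k)).
  case: (dF k) => -[_ iA] [_ [_ iB]].
  rewrite (_ : ABop _ _ _ = mkl1w p (Aop a (F k)) + mkl1w p (Bop a b (F k))).
    exact: l1w_in.
  by apply/funext => n; rewrite l1wDE !mkl1wE.
have cvgF (G : nat -> nat -> R) (z : X) : (forall k, inl1w p (G k)) ->
    l1w_cvg_seq p G z -> forall e, 0 < e -> exists k0, forall k, (k0 <= k)%N ->
    `|mkl1w p (G k) - z| <= e.
  move=> iG cz e e0.
  have /fine_cvg : (fun k => normw p (seqsub (G k) z)) @ \oo --> (0 : R)%:E by exact: cz.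
  move=> /cvgrPdist_le/(_ e e0)[k0 _ H]; exists k0 => k kk; have := H k kk.
  rewrite /= sub0r normrN (_ : seqsub _ _ = mkl1w p (G k) - z); last first.
    by apply/funext => n; rewrite l1wBE mkl1wE.
  by rewrite normw_l1w/= normr_id.
apply/ler_addgt0Pr => e e0.
have e'0 : 0 < e / (2 + h) by rewrite divr_gt0//; lra.
have [k1 H1] := cvgF F x inF cF _ e'0.
have [k2 H2] := cvgF _ y inG cG _ e'0.
have {}H1 := H1 _ (leq_maxl k1 k2); have {}H2 := H2 _ (leq_maxr k1 k2).
set k := maxn k1 k2 in H1 H2.
set xk := mkl1w p (F k) in H1; set yk := mkl1w p _ in H2.
have xkE : xk = F k :> (nat -> R) by exact: mkl1wE.
have [dA dB] := dF k; rewrite -xkE in dA dB.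
have ykE : yk = ABop a b xk :> (nat -> R) by rewrite /yk mkl1wE// xkE.
have C := dispersive_core h0 dA dB ykE.
have D1 := posq_dist Ww x xk.
have D2 := posq_dist Ww (xk - h *: yk) (x - h *: y).
have D3 : `|xk - h *: yk - (x - h *: y)| <= `|xk - x| + h * `|yk - y|.
  have -> : xk - h *: yk - (x - h *: y) = (xk - x) - h *: (yk - y).
    by rewrite scalerBr !opprB addrACA [RHS]addrACA [- x + _]addrC.
  by rewrite (le_trans (ler_normB _ _))// normrZ ger0_norm.
have D4 : h * `|yk - y| <= h * (e / (2 + h)) by rewrite ler_wpM2l.
have : h * (e / (2 + h)) + e / (2 + h) + e / (2 + h) = e by field; apply/eqP; lra.
rewrite distrC in D1; lra.
Qed.

End Dispersivity.

(** * The given semigroup as operators on the bundled space *)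

Section GeneratedSemigroup.
Context {R : realType} {p : R} (a : nat -> R) (b : nat -> nat -> R).
Variable S : R -> (nat -> R) -> (nat -> R).
Local Notation X := (l1w p).
Implicit Types x y : X.
Hypothesis SG : generated_by_G p a b S.

(** Negative times are sent to [0], where the semigroup is the identity. *)
Definition sgt (t : R) x : X := mkl1w p (S (Num.max 0 t) x).

Let max0 (t : R) : 0 <= Num.max 0 t. Proof. by rewrite le_max lexx. Qed.

Lemma sgtE t x : sgt t x = S (Num.max 0 t) x :> (nat -> R).
Proof.
by rewrite mkl1wE//; case: SG => -[H _] _; apply: H => //; exact: l1w_in.
Qed.

Lemma sgt_ge0E t x : 0 <= t -> sgt t x = S t x :> (nat -> R).
Proof. by move=> t0; rewrite sgtE max_r. Qed.

Lemma sgt_linear t c x y : sgt t (c *: x + y) = c *: sgt t x + sgt t y.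
Proof.
case: SG => -[_ [H _]] _; apply: l1wP => n _; rewrite l1wDE l1wZE !sgtE.
rewrite (_ : (c *: x + y : X) = (fun n => c * x n + y n) :> (nat -> R)) ?H//.
- exact: l1w_in.
- exact: l1w_in.
Qed.

Lemma sgtD t x y : sgt t (x + y) = sgt t x + sgt t y.
Proof. by rewrite -[in LHS](scale1r x) sgt_linear scale1r. Qed.

Lemma sgtZ t c x : sgt t (c *: x) = c *: sgt t x.
Proof.
have z : sgt t 0 = 0 by have := sgt_linear t (-1) 0 0; rewrite scaler0 addr0 scaleN1r addNr.
by rewrite -[c *: x]addr0 sgt_linear z addr0.
Qed.

Lemma sgtN t x : sgt t (- x) = - sgt t x.
Proof. by rewrite -[- x]scaleN1r sgtZ scaleN1r. Qed.

Lemma sgtB t x y : sgt t (x - y) = sgt t x - sgt t y.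
Proof. by rewrite sgtD -scaleN1r sgtZ scaleN1r. Qed.

Lemma sgt_bounded t : exists2 M, 0 < M & forall x, `|sgt t x| <= M * `|x|.
Proof.
case: SG => -[_ [_ [H _]]] _; have [M HM] := H _ (max0 t).
exists (`|M| + 1) => [|x]; first by rewrite ltr_wpDl.
have := HM x (l1w_in x); rewrite -sgtE !normw_l1w -EFinM lee_fin => /le_trans; apply.
by rewrite ler_wpM2r// (le_trans (ler_norm M))// lerDl.
Qed.

Lemma sgt0 x : sgt 0 x = x.
Proof.
apply: l1wP => n _; rewrite sgt_ge0E//.
by case: SG => -[_ [_ [_ [H _]]]] _; rewrite H//; exact: l1w_in.
Qed.

Lemma sgt_add t s x : 0 <= t -> 0 <= s -> sgt (t + s) x = sgt t (sgt s x).
Proof.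
move=> t0 s0; apply: l1wP => n _; rewrite !sgt_ge0E ?addr_ge0//.
by case: SG => -[_ [_ [_ [_ [H _]]]]] _; rewrite H//; exact: l1w_in.
Qed.

Lemma cvg_normw_at_right (f : R -> nat -> R) (g : R -> X) :
  (forall h, 0 < h -> f h = g h :> (nat -> R)) ->
  ((fun h => normw p (f h)) @ 0^'+ --> 0%E) <->
  (forall e, 0 < e -> exists2 d, 0 < d & forall h, 0 < h -> h < d -> `|g h| <= e).
Proof.
move=> fg; split.
  move=> /fine_cvg/cvgrPdist_le H e e0; have {H} := H e e0.
  move=> [d /= d0 H]; exists d => // h h0 hd; have := H h.
  rewrite /ball_/= sub0r normrN gtr0_norm// sub0r normrN fg// normw_l1w/= normr_id.
  by apply.
move=> H; apply: (@cvg_trans _ ((fun h => (`|g h|)%:E) @ 0^'+)).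
  apply: near_eq_cvg; have := @nbhs_right_gt R 0; apply: filterS => h h0.
  by rewrite fg// normw_l1w.
apply: cvg_EFin; first exact: nearW.
apply/cvgrPdist_le => e e0; have [d d0 {}H] := H e e0.
near=> h; rewrite /= sub0r normrN normr_id; apply: H.
- by near: h; exact: nbhs_right_gt.
- by near: h; exact: nbhs_right_lt.
Unshelve. all: by end_near. Qed.

Lemma sgt_right_continuous x e : 0 < e ->
  exists2 d, 0 < d & forall h, 0 < h -> h < d -> `|sgt h x - x| <= e.
Proof.
case: SG => -[_ [_ [_ [_ [_ H]]]]] _; move: e.
apply/cvg_normw_at_right; last by apply: H; exact: l1w_in.
by move=> h h0; apply/funext => n; rewrite /seqsub l1wBE sgt_ge0E ?ltW.
Qed.

Lemma sgt_generatorP x y : Gclos p a b x y <->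
  (forall e, 0 < e -> exists2 d, 0 < d & forall h, 0 < h -> h < d ->
     `|sgt h x - x - h *: y| <= e * h).
Proof.
case: SG => _ H; rewrite -H {H}/generator_rel.
have E : (fun h : R => normw p (seqsub (fun n => (S h x n - x n) / h) y)) @ 0^'+ --> 0%E <->
   (forall e, 0 < e -> exists2 d, 0 < d & forall h, 0 < h -> h < d ->
     `|h^-1 *: (sgt h x - x) - y| <= e).
  apply: cvg_normw_at_right => h h0; apply/funext => n.
  by rewrite l1wBE l1wZE l1wBE sgt_ge0E ?ltW// mulrC.
have E2 h : 0 < h -> h *: (h^-1 *: (sgt h x - x) - y) = sgt h x - x - h *: y.
  by move=> h0; rewrite scalerBr scalerA divff ?gt_eqF// scale1r.
split=> [[_ [_ /E H]] e e0|H].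
  have [d d0 {}H] := H e e0; exists d => // h h0 hd.
  rewrite -E2// normrZ gtr0_norm// mulrC; apply: ler_wpM2r; [exact: ltW|exact: H].
split; [exact: l1w_in|split; [exact: l1w_in|apply/E => e e0]].
have [d d0 {}H] := H e e0; exists d => // h h0 hd.
by have := H h h0 hd; rewrite -E2// normrZ gtr0_norm// mulrC ler_pM2r.
Qed.

(** [C0_semigroup] bounds each [S t] separately, while left continuity needs one bound near time
    [0]. Otherwise there are times tending to [0] with unbounded operator norms, although every
    orbit is bounded along them by right continuity at [0]; this contradicts Banach-Steinhaus. *)
Lemma sgt_locally_bounded : exists d M, [/\ 0 < d, 0 < M &
  forall h x, 0 <= h -> h <= d -> `|sgt h x| <= M * `|x|].
Proof.
apply: contrapT => H.
have {}H n : exists h, [/\ 0 <= h, h <= n.+1%:R^-1 & exists x, n.+1%:R * `|x| < `|sgt h x|].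
  apply: contrapT => H3; apply: H; exists n.+1%:R^-1, n.+1%:R; split => //.
  move=> h x h0 hn; rewrite leNgt; apply/negP => hx; apply: H3; exists h.
  by split => //; exists x.
have [h_ Hh] := choice H.
pose F : set (X -> X) := range (fun n => sgt (h_ n)).
have FF : forall f, F f -> bounded_fun_norm f /\ linear f.
  move=> _ [n _ <-]; split; last by move=> c x y; exact: sgt_linear.
  move=> r; have [M M0 HM] := sgt_bounded (h_ n).
  exists (M * `|r|) => x xr; apply: le_trans (HM x) _.
  by rewrite ler_wpM2l ?(ltW M0)// (le_trans xr)// ler_norm.
have PB : pointwise_bounded F.
  move=> x; have [d d0 Hd] := sgt_right_continuous x ltr01.
  have [N _ HN] : \forall n \near \oo, n.+1%:R^-1 < d :> R.
    by near=> n; near: n; exact: near_infty_natSinv_lt (PosNum d0).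
  (* The times from index [N] on lie within the radius of right continuity; the finitely many
     earlier ones are covered by the sum. *)
  pose C := `|x| + 1 + \sum_(0 <= n < N) `|sgt (h_ n) x|.
  have s0 : 0 <= \sum_(0 <= n < N) `|sgt (h_ n) x| by exact: sumr_ge0.
  exists C => _ [n _ <-]; have [Nn|nN] := leqP N n.
    have [h0 hn _] := Hh n.
    have [->|hn0] := eqVneq (h_ n) 0; first by rewrite sgt0 /C; lra.
    have := Hd (h_ n); rewrite lt_neqAle eq_sym hn0 h0 => /(_ isT).
    have -> : h_ n < d by apply: le_lt_trans hn _; exact: HN.
    move=> /(_ isT) H1; have := ler_normD (sgt (h_ n) x - x) x.
    by rewrite subrK /C; lra.
  rewrite /C (bigD1_seq n)/= ?mem_index_iota ?iota_uniq//.
  have : 0 <= \sum_(0 <= i < N | i != n) `|sgt (h_ i) x| by exact: sumr_ge0.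
  by have := normr_ge0 x; lra.
have [M HM] := Banach_Steinhauss FF PB 1.
pose n := Num.truncn M.
have [_ _ [x xn]] := Hh n.
have nM : M < n.+1%:R by exact: truncnS_gt.
have x0 : 0 < `|x|.
  rewrite normr_gt0; apply/eqP => x0; move: xn.
  by rewrite x0 -[0 : X](subrr 0) sgtB !subrr normr0 mulr0 ltxx.
have := HM (sgt (h_ n)) (ex_intro2 _ _ n I erefl) (`|x|^-1 *: x).
rewrite normrZ normfV normr_id mulVf ?gt_eqF// lexx => /(_ isT).
rewrite sgtZ normrZ normfV normr_id ler_pdivrMl// => H1.
have : `|x| * M < n.+1%:R * `|x| by rewrite mulrC ltr_pM2r.
lra.
Unshelve. all: by end_near. Qed.

(** [S t x - S (t - h) x] is [S (t - h)] applied to [S h x - x]. Writing [S (t - h)] as [S (r - h)]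
    after the fixed operator [S (t - r)] bounds it uniformly in [h]. *)
Lemma sgt_left_continuous t x e : 0 < t -> 0 < e ->
  exists2 d, 0 < d & forall h, 0 < h -> h < d -> `|sgt t x - sgt (t - h) x| <= e.
Proof.
move=> t0 e0; have [d0 [M [d00 M0 HM]]] := sgt_locally_bounded.
pose r := Num.min d0 t.
have r0 : 0 < r by rewrite lt_min d00.
have rd : r <= d0 by rewrite ge_min lexx.
have rt : r <= t by rewrite ge_min lexx orbT.
have [N N0 HN] := sgt_bounded (t - r).
have MN : 0 < M * N by exact: mulr_gt0.
have [d d_gt0 Hd] := sgt_right_continuous x (divr_gt0 e0 MN).
exists (Num.min d r); first by rewrite lt_min d_gt0.
move=> h h0; rewrite lt_min => /andP[hd hr].
have E y : sgt (t - h) y = sgt (r - h) (sgt (t - r) y).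
  by rewrite -sgt_add; [congr sgt; ring|lra|lra].
have -> : sgt t x = sgt (t - h) (sgt h x) by rewrite -sgt_add; [congr sgt; ring|lra|lra].
rewrite -sgtB E; apply: le_trans (HM _ _ _ _) _; [lra|lra|].
apply: le_trans (ler_wpM2l (ltW M0) (HN _)) _.
by rewrite mulrA mulrC -ler_pdivlMr// Hd.
Qed.

End GeneratedSemigroup.

(** * Positivity and contractivity of the semigroup *)

Section ContractionProperties.
Context {R : realType} {p : R} (a : nat -> R) (b : nat -> nat -> R).
Variable S : R -> (nat -> R) -> (nat -> R).
Local Notation X := (l1w p).
Implicit Types x y : X.
Hypothesis SG : generated_by_G p a b S.
Hypothesis a_ge0 : forall n, (1 <= n)%N -> 0 <= a n.
Hypothesis b_ge0 : forall n j, (1 <= n)%N -> (1 <= j)%N -> 0 <= b n j.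
Hypothesis b_eq0 : forall n j, (1 <= n)%N -> (j <= n)%N -> b n j = 0.

Local Notation St := (@sgt R p S).

(** Supplies a dense part of the domain. Fragmentation only moves mass to smaller sizes, so [A x]
    and [B x] vanish wherever [x] does from [M] on, and a constant sequence witnesses the
    closure. *)
Lemma finite_Gclos M x : (forall n, (M <= n)%N -> x n = 0) ->
  exists y : X, Gclos p a b x y.
Proof.
move=> xM.
have dA : domA p a x.
  split; first exact: l1w_in.
  apply: (@inl1w_fin _ _ _ M) => // n Mn; rewrite /Aop; case: ifP => // _.
  by rewrite xM// mulr0 oppr0.
have BE n K : (M <= K)%N ->
    \sum_(n.+1 <= j < K) (a j * b n j * x j) = \sum_(n.+1 <= j < maxn n.+1 M) (a j * b n j * x j).
  move=> MK; have [nK|Kn] := leqP n.+1 K; last first.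
    rewrite big_geq; last exact: ltnW.
    by rewrite (maxn_idPl _) ?big_geq// (leq_trans MK)// ltnW.
  rewrite (@big_cat_nat _ _ _ (maxn n.+1 M))//=; [|exact: leq_maxl|by rewrite geq_max nK].
  rewrite [X in _ + X]big1_seq ?addr0// => j /=.
  rewrite mem_index_iota geq_max => /andP[/andP[_ Mj] _]; by rewrite xM ?mulr0.
have cB n : (fun K => \sum_(n.+1 <= j < K) (a j * b n j * x j)) @ \oo -->
    \sum_(n.+1 <= j < maxn n.+1 M) (a j * b n j * x j).
  apply: cvg_near_cst; exists M => // K /= MK; exact: BE.
have dB : domB p a b x.
  split; first exact: l1w_in; split; first by move=> n _; apply/cvg_ex; eexists; exact: cB.
  apply: (@inl1w_fin _ _ _ M) => // n Mn; rewrite /Bop; case: ifP => // _.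
  rewrite (cvg_lim _ (cB n))//; apply: big1_seq => j /=.
  rewrite mem_index_iota => /andP[nj _].
  by rewrite xM ?mulr0// (leq_trans Mn)// ltnW.
have iAB : inl1w p (ABop a b x).
  case: dA dB => _ iA [_ [_ iB]].
  rewrite (_ : ABop _ _ _ = mkl1w p (Aop a x) + mkl1w p (Bop a b x)).
    exact: l1w_in.
  by apply/funext => n; rewrite l1wDE !mkl1wE.
exists (mkl1w p (ABop a b x)); split; first exact: l1w_in.
split; first exact: l1w_in.
have z (f : X) : (fun _ : nat => normw p (seqsub f f)) @ \oo --> 0%E.
  rewrite (_ : seqsub f f = (0 : X)); last by apply/funext => n; rewrite /seqsub subrr.
  by rewrite normw_l1w normr0; exact: cvg_cst.
exists (fun=> x); split; first by [].
split; first exact: z.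
by rewrite /l1w_cvg_seq -{1}(mkl1wE iAB); exact: z.
Qed.

(** [S t] is bounded and commutes with [S h], so the first-order expansion at [0] is transported
    along the orbit. *)
Lemma sgt_gen t x y : 0 <= t -> Gclos p a b x y -> Gclos p a b (St t x) (St t y).
Proof.
move=> t0 /(sgt_generatorP SG) H; apply/(sgt_generatorP SG) => e e0.
have [M M0 HM] := sgt_bounded SG t.
have [d d0 {}H] := H (e / M) (divr_gt0 e0 M0); exists d => // h h0 hd.
have -> : St h (St t x) = St t (St h x) by rewrite -!(sgt_add SG) ?(ltW h0)// addrC.
rewrite -(sgtZ SG) -!(sgtB SG); apply: le_trans (HM _) _.
by rewrite mulrC -ler_pdivlMr// mulrAC H.
Qed.

Section Functional.
Variable W : nat -> R.
Hypothesis Ww : subweight (p := p) W.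
Hypothesis Wb : forall j, (2 <= j)%N -> \sum_(1 <= n < j) (W n * b n j) <= W j.

(** Dispersivity is used as a backward Euler step: at the later time [s + h], the vector
    [S (s + h) x - h S (s + h) y] equals [S s x] up to [o(h)], so [posq W] has nonpositive right
    increments. *)
Lemma posq_sgt_domain t x y : 0 <= t -> Gclos p a b x y -> posq W (St t x) <= posq W x.
Proof.
move=> t0 Gxy; rewrite -[in leRHS](sgt0 SG x).
apply: (@dini_nonincreasing _ (fun t => posq W (St t x))) => //.
  move=> s s0 st e e0.
  have [M M0 HM] := sgt_bounded SG s.
  have e'0 : 0 < e / 2 / M by rewrite !divr_gt0.
  have [d1 d10 H1] := (sgt_generatorP SG _ _).1 Gxy _ e'0.
  have [d2 d20 H2] := sgt_right_continuous SG y e'0.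
  exists (Num.min d1 d2); first by rewrite lt_min d10.
  move=> h h0; rewrite lt_min => /andP[hd1 hd2].
  have {}H1 := H1 h h0 hd1; have {}H2 := H2 h h0 hd2.
  have sh : 0 <= s + h by rewrite addr_ge0// ltW.
  apply: le_trans (dispersive a_ge0 b_ge0 b_eq0 Ww Wb (ltW h0) (sgt_gen sh Gxy)) _.
  apply: le_trans (posq_dist Ww _ (St s x)) _; rewrite lerD2l.
  rewrite !(sgt_add SG) ?(ltW h0)// -(sgtZ SG) -!(sgtB SG).
  apply: le_trans (HM _) _; rewrite mulrC -ler_pdivlMr//.
  rewrite (_ : _ - _ = (St h x - x - h *: y) - h *: (St h y - y)); last first.
    rewrite scalerBr opprB addrA subrK addrAC //.
  rewrite (le_trans (ler_normB _ _))// normrZ gtr0_norm//.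
  have : h * `|St h y - y| <= h * (e / 2 / M) by rewrite ler_wpM2l// ltW.
  rewrite (_ : e * h / M = e / 2 / M * h + h * (e / 2 / M)); last by field; rewrite gt_eqF.
  lra.
move=> s s0 st e e0; have [d d0 H] := sgt_left_continuous SG x s0 e0.
exists d => // h h0 hd; apply: le_trans (posq_dist Ww _ (St (s - h) x)) _.
by rewrite lerD2l H.
Qed.

(** Truncations are dense and in the domain; both [posq W] and the operator at time [t] are
    Lipschitz. *)
Lemma posq_sgt t x : 0 <= t -> posq W (St t x) <= posq W x.
Proof.
move=> t0; apply/ler_addgt0Pr => e e0.
have [M M0 HM] := sgt_bounded SG t.
have M1 : 0 < M + 1 by lra.
have [K /(_ K (leqnn K)) HK] := truncl1w_cvg x (divr_gt0 e0 M1).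
have [|y Gy] := @finite_Gclos K (truncl1w K x).
  by move=> n Kn; rewrite truncl1wE ltnNge Kn.
apply: le_trans (posq_dist Ww _ (St t (truncl1w K x))) _.
have H1 := posq_sgt_domain t0 Gy.
have H2 := posq_dist Ww (truncl1w K x) x; rewrite distrC in H2.
have : `|St t x - St t (truncl1w K x)| <= M * (e / (M + 1)).
  by rewrite -(sgtB SG); apply: le_trans (HM _) _; rewrite ler_wpM2l// ltW.
have : M * (e / (M + 1)) + e / (M + 1) = e by field; rewrite gt_eqF.
move: H1 H2; lra.
Qed.

End Functional.

Hypothesis bw : forall j, (2 <= j)%N -> \sum_(1 <= n < j) (wgt p n * b n j) <= wgt p j.

Lemma norm_posq x : `|x| = posq (wgt p) x + posq (wgt p) (- x).
Proof.
have sw := @subweight_wgt R p.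
have E N : psum (fun n => wgt p n * `|x n|) N =
   psum (fun n => wgt p n * Num.max 0 (x n)) N +
   psum (fun n => wgt p n * Num.max 0 ((- x) n)) N.
  rewrite -psumD; apply: eq_psum => n; rewrite -mulrDr l1wNE; congr (_ * _).
  have [x0|x0] := leP 0 (x n).
    have -> : Num.max 0 (- x n) = 0 by rewrite max_l// oppr_le0.
    by rewrite ger0_norm// addr0.
  have -> : Num.max 0 (- x n) = - x n by rewrite max_r// oppr_ge0 ltW.
  by rewrite ltr0_norm// add0r.
have f0 y n : (1 <= n)%N -> 0 <= wgt p n * Num.max 0 (y n) by exact: posq_term_ge0.
have H1 := cvgD (cvg_psum (f0 x) (posq_bdsum sw x))
  (cvg_psum (f0 (- x)) (posq_bdsum sw (- x))).
have {}H1 := H1 eventually_filter.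
have H2 := cvg_psum (@wf_ge0 R p x) (l1w_bdsum x).
have H3 : psum (fun n => wgt p n * `|x n|) =
    psum (fun n => wgt p n * Num.max 0 (x n)) + psum (fun n => wgt p n * Num.max 0 ((- x) n)).
  by apply/funext => N; exact: E.
rewrite H3 in H2; rewrite norm_l1wE.
exact: (cvg_unique _ H2 H1).
Qed.

Lemma sgt_clip t : St t = St (Num.max 0 t).
Proof.
apply/funext => x; apply: l1wP => n _; rewrite !(sgtE SG).
by rewrite [Num.max 0 (Num.max 0 t)]max_r// le_max lexx.
Qed.

(** The norm is the sum of [posq] at [x] and at [- x], and neither part increases. *)
Lemma sgt_norm t x : `|St t x| <= `|x|.
Proof.
have sw := @subweight_wgt R p.
have t0 : 0 <= Num.max 0 t by rewrite le_max lexx.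
rewrite sgt_clip (norm_posq x) (norm_posq (St _ x)) lerD//; first exact: posq_sgt.
rewrite -(sgtN SG).
exact: posq_sgt.
Qed.

Lemma sgt_csg : contraction_semigroup St.
Proof.
split.
- exact: (sgt_linear SG).
- exact: sgt_norm.
- exact: (sgt0 SG).
- by move=> t s x t0 s0; exact: (sgt_add SG).
- move=> x t; apply/(@cvgrPdist_le _ _ _ (nbhs t)) => e e0.
  have [d d0 Hd] := sgt_right_continuous SG x e0.
  (* Contractivity reduces continuity at any time to right continuity at [0], with the same [d]
     everywhere. *)
  have core r s : 0 <= r -> r <= s -> s - r < d -> `|St s x - St r x| <= e.
    move=> r0; rewrite le_eqVlt => /predU1P[->|rs] srd.
      by rewrite subrr normr0 ltW.
    have -> : St s x = St r (St (s - r) x).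
      rewrite -(sgt_add SG)//; first by congr sgt; ring.
      by rewrite subr_ge0 ltW.
    rewrite -(sgtB SG); apply: le_trans (sgt_norm _ _) _.
    by apply: Hd => //; rewrite subr_gt0.
  near=> s.
  have ts : `|t - s| < d.
    by near: s; exact: (@cvgr_dist_lt _ _ _ (nbhs t) _ id t).
  rewrite sgt_clip (sgt_clip s).
  have m0 r : 0 <= Num.max 0 r :> R by rewrite le_max lexx.
  have D : `|Num.max 0 t - Num.max 0 s| < d.
    apply: le_lt_trans ts; rewrite /Order.max.
    by repeat case: ifPn; rewrite -?leNgt => *; rewrite ler_norml;
      have := ler_norm (t - s); have := lerNnormlW (lexx `|t - s|); lra.
  have [st|ts'] := leP (Num.max 0 s) (Num.max 0 t).
    by apply: core => //; rewrite (le_lt_trans (ler_norm _)).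
  by rewrite distrC; apply: core => //; rewrite ?ltW// (le_lt_trans (ler_norm _))// distrC.
Unshelve. all: by end_near. Qed.

Lemma monitor_posq W : subweight (p := p) W ->
  (forall j, (2 <= j)%N -> \sum_(1 <= n < j) (W n * b n j) <= W j) ->
  monitor St (posq W).
Proof.
move=> Ww Wb; split; [exact: posqD|exact: posq_ge0|exact: posq_norm|].
by move=> t x; exact: posq_sgt.
Qed.

Lemma monitor_negq : monitor St (fun x => posq (wgt p) (- x)).
Proof.
have sw := @subweight_wgt R p.
split=> [x y|x|x|t x t0].
- by rewrite opprD; exact: posqD.
- exact: posq_ge0.
- by rewrite -[leRHS]normrN; exact: posq_norm.
- by rewrite -(sgtN SG); exact: posq_sgt.
Qed.

End ContractionProperties.

(** * Absolutely convergent signed series and discrete convolutions *)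

Section SignedSums.
Context {R : realType}.
Implicit Types f g : nat -> R.

(** The limit occurring in the loss term of [Kop]; a supremum of partial sums would be wrong for
    signed terms. *)
Definition lsum f : R := limn (psum f).

Lemma cvg_lsum f : bdsum (fun n => `|f n|) -> psum f @ \oo --> lsum f.
Proof.
move=> bf; apply/cvg_ex.
have g0 n : (1 <= n)%N -> 0 <= f n + `|f n|.
  by move=> _; have := lerNnormlW (lexx `|f n|); lra.
have bg : bdsum (fun n => f n + `|f n|).
  case: bf => C fC; exists (C + C) => N; rewrite psumD lerD//.
  by apply: le_trans (fC N); apply: le_psum => n _; exact: ler_norm.
have H := cvgB (cvg_psum g0 bg) (cvg_psum (fun n _ => normr_ge0 (f n)) bf).
exists (tsum (fun n => f n + `|f n|) - tsum (fun n => `|f n|)).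
have {}H := H eventually_filter.
apply: cvg_trans H; apply: near_eq_cvg; apply: nearW => N.
by rewrite !fctE psumD addrK.
Qed.

Lemma norm_lsum_le f C : bdsum (fun n => `|f n|) ->
  (forall N, psum (fun n => `|f n|) N <= C) -> `|lsum f| <= C.
Proof.
move=> bf fC; have H := cvg_norm (cvg_lsum bf); have {}H := H eventually_filter.
rewrite -(cvg_lim _ H)//; apply: limr_le; first by apply/cvg_ex; eexists; exact: H.
apply: nearW => N; apply: le_trans (fC N); exact: ler_norm_sum.
Qed.

Lemma psum_le_lsum f N : (forall n, (1 <= n)%N -> 0 <= f n) ->
  bdsum (fun n => `|f n|) -> psum f N <= lsum f.
Proof.
move=> f0 bf; apply: nondecreasing_cvgn_le; first exact: nondecreasing_psum.
by apply/cvg_ex; eexists; exact: cvg_lsum.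
Qed.

Lemma lsumB f g : bdsum (fun n => `|f n|) -> bdsum (fun n => `|g n|) ->
  lsum f - lsum g = lsum (fun n => f n - g n).
Proof.
move=> bf bg; have H := cvgB (cvg_lsum bf) (cvg_lsum bg).
have {}H := H eventually_filter.
apply/esym/cvg_lim => //; apply: cvg_trans H; apply: near_eq_cvg; apply: nearW => N.
by rewrite !fctE /psum sumrB.
Qed.

Lemma lsum_fin f M : (forall n, (M <= n)%N -> f n = 0) -> (1 <= M)%N -> lsum f = psum f M.
Proof.
move=> fM M1; apply/cvg_lim => //; apply: cvg_near_cst; exists M => // N /= MN.
rewrite /psum (big_cat_nat M1 MN)/= [X in _ + X]big1_seq ?addr0// => n /=.
by rewrite mem_index_iota => /andP[/fM].
Qed.

(** The pairs [(n - j, j)] with [n < N] form a triangle inside the square of pairs below [N], and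
    all terms are nonnegative. *)
Lemma convolution_sum_le (g : nat -> nat -> R) N :
  (forall i j, (1 <= i)%N -> (1 <= j)%N -> 0 <= g i j) ->
  psum (fun n => psum (fun j => g (n - j)%N j) n) N <=
  psum (fun i => psum (fun j => g i j) N) N.
Proof.
move=> g0; pose F n j := if (j < n)%N then g (n - j)%N j else 0.
have F0 n j : (1 <= j)%N -> 0 <= F n j.
  by move=> j1; rewrite /F; case: ifP => // jn; rewrite g0// subn_gt0.
apply: (@le_trans _ _ (psum (fun n => psum (fun j => F n j) N) N)).
  apply: le_psum => n /andP[n1 nN].
  apply: (@le_trans _ _ (psum (fun j => F n j) n)).
    by apply: le_psum => j /andP[_ jn]; rewrite /F jn.
  by apply: nondecreasing_psum (ltnW nN) => j; exact: F0.
rewrite /psum exchange_big_nat/= [leRHS]exchange_big_nat/=.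
apply: le_psum => j /andP[j1 _]; rewrite -/(psum (F^~ j) N) -/(psum (g^~ j) N).
apply: (@le_trans _ _ (psum (F^~ j) (j + N))).
  by apply: nondecreasing_psum (leq_addl _ _) => n _; exact: F0.
suff : psum (F^~ j) (j + N) = psum (g^~ j) N by move=> ->.
elim: N => [|[|N] IH].
- rewrite addn0 psum0; apply: big1_seq => n /=; rewrite mem_index_iota => /andP[_ nj].
  by rewrite /F ltnNge (ltnW nj).
- rewrite [RHS]/psum big_geq//; apply: big1_seq => n /=.
  by rewrite mem_index_iota addn1 ltnS => /andP[_ nj]; rewrite /F ltnNge nj.
- rewrite addnS psumS ?addn_gt0 ?j1// IH [RHS]psumS//; congr (_ + _).
  by rewrite /F -{1}[j]addn0 ltn_add2l/= addKn.
Qed.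

End SignedSums.

(** A product is negative only when exactly one factor is. The bound is linear in the negative
    parts, so it closes a Gronwall estimate for them. *)
Lemma mul_negpart_le {R : realType} (u v : R) :
  - (u * v) <= `|u| * Num.max 0 (- v) + Num.max 0 (- u) * `|v|.
Proof.
have m0 (r : R) : 0 <= Num.max 0 (- r) by exact: max0_ge0.
have mN (r : R) : - r <= Num.max 0 (- r) by rewrite le_max lexx orbT.
have [u0|u0] := leP 0 u.
  rewrite (le_trans (_ : _ <= u * Num.max 0 (- v)))//.
    by rewrite -mulrN ler_wpM2l.
  by rewrite ger0_norm// lerDl mulr_ge0.
have [v0|v0] := leP 0 v.
  rewrite (le_trans (_ : _ <= Num.max 0 (- u) * v))//.
    by rewrite -mulNr ler_wpM2r.
  by rewrite (ger0_norm v0) lerDr mulr_ge0.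
have uv : 0 <= u * v by rewrite nmulr_rge0 ?ltW.
rewrite (le_trans (_ : _ <= 0)) ?oppr_le0//.
by rewrite addr_ge0 ?mulr_ge0.
Qed.

(** * The coagulation operator at a frozen time *)

Section CoagulationKernel.
Context {R : realType} {p : R}.
Local Notation X := (l1w p).
Implicit Types (x y z : X).
Hypothesis p_ge0 : 0 <= p.
Variables (kap : nat -> nat -> R) (c : R).
Hypothesis c_ge0 : 0 <= c.
Hypothesis kap_ge0 : forall n j, (1 <= n)%N -> (1 <= j)%N -> 0 <= kap n j.
Hypothesis kap_sym : forall n j, (1 <= n)%N -> (1 <= j)%N -> kap n j = kap j n.
Hypothesis kap_le : forall n j, (1 <= n)%N -> (1 <= j)%N ->
  kap n j <= c * wgt p n * wgt p j / wgt p (n + j).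
Local Notation w := (wgt p).

Lemma wgt_monotone n m : (n <= m)%N -> w n <= w m.
Proof. by move=> nm; rewrite /wgt ge0_ler_powR// ?nnegrE ?ler0n// ler_nat. Qed.

Lemma kap_le_wgt n j : (1 <= n)%N -> (1 <= j)%N -> kap n j <= c * w j.
Proof.
move=> n1 j1; apply: le_trans (kap_le n1 j1) _.
rewrite ler_pdivrMr ?wgt_gt0 ?addn_gt0 ?n1// -!mulrA ler_wpM2l// mulrC.
by rewrite ler_wpM2l ?wgt_ge0// wgt_monotone// leq_addr.
Qed.

(** The role of (CI): the weight of the merged cluster times the kernel factorises, so the gain is a
    bounded bilinear map. *)
Lemma kap_wgtD n j : (1 <= n)%N -> (1 <= j)%N -> w (n + j) * kap n j <= c * w n * w j.
Proof.
by move=> n1 j1; rewrite mulrC -ler_pdivlMr ?kap_le// wgt_gt0// addn_gt0 n1.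
Qed.

(** Kept bilinear, so that differences and negative parts are estimated one argument at a time. *)
Definition gain (f g : nat -> R) n : R := psum (fun j => kap (n - j)%N j * f (n - j)%N * g j) n.

Lemma gain_ge0 (f g : nat -> R) n : (forall i, 0 <= f i) -> (forall i, 0 <= g i) ->
  0 <= gain f g n.
Proof.
move=> f0 g0; rewrite /gain /psum big_nat; apply: sumr_ge0 => j /andP[j1 jn].
by rewrite !mulr_ge0 ?kap_ge0// subn_gt0.
Qed.

Definition Kraw (f : nat -> R) n : R := if (n == 0)%N then 0 else
  2^-1 * gain f f n - lsum (fun j => kap n j * f n * f j).

Lemma psum_gain_le (W f g : nat -> R) N : (forall n, (1 <= n)%N -> 0 <= W n) ->
  (forall n, 0 <= f n) -> (forall n, 0 <= g n) ->
  psum (fun n => W n * gain f g n) N <=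
  psum (fun i => psum (fun j => W (i + j)%N * kap i j * f i * g j) N) N.
Proof.
move=> W0 f0 g0.
pose h i j := W (i + j)%N * kap i j * f i * g j.
have h0 i j : (1 <= i)%N -> (1 <= j)%N -> 0 <= h i j.
  by move=> i1 j1; rewrite /h !mulr_ge0 ?kap_ge0 ?W0// addn_gt0 i1.
apply: le_trans (convolution_sum_le N h0).
apply: le_psum => n _; rewrite /gain -psumZ; apply: le_psum => j /andP[j1 jn].
by rewrite /h subnK ?(ltnW jn)// !mulrA.
Qed.

Lemma psum_wgain_le (f g : nat -> R) F G N :
  (forall n, 0 <= f n) -> (forall n, 0 <= g n) ->
  psum (fun n => w n * f n) N <= F -> psum (fun n => w n * g n) N <= G ->
  psum (fun n => w n * gain f g n) N <= c * F * G.
Proof.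
move=> f0 g0 fF gG.
apply: le_trans (psum_gain_le N (fun n _ => wgt_ge0 p n) f0 g0) _.
have wf0 n : (1 <= n)%N -> 0 <= w n * f n by move=> _; rewrite mulr_ge0 ?wgt_ge0.
have wg0 n : (1 <= n)%N -> 0 <= w n * g n by move=> _; rewrite mulr_ge0 ?wgt_ge0.
set Gs := psum (fun n => w n * g n) N in gG *.
apply: (@le_trans _ _ (psum (fun i => c * Gs * (w i * f i)) N)).
  apply: le_psum => i /andP[i1 _].
  rewrite (_ : c * Gs * _ = (c * w i * f i) * Gs); last by ring.
  rewrite -psumZ; apply: le_psum => j /andP[j1 _].
  rewrite (_ : _ * (w j * g j) = (c * w i * w j) * (f i * g j)); last by ring.
  by rewrite -mulrA ler_wpM2r ?mulr_ge0// kap_wgtD.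
rewrite psumZ -!mulrA ler_wpM2l// mulrC ler_pM//; exact: psum_ge0.
Qed.

Definition absl x : nat -> R := fun n => `|x n|.

Lemma bdsum_kap x n (r : R) : (1 <= n)%N ->
  bdsum (fun j => `|kap n j * r * x j|) /\
  forall N, psum (fun j => `|kap n j * r * x j|) N <= c * `|r| * `|x|.
Proof.
move=> n1.
have H N : psum (fun j => `|kap n j * r * x j|) N <= c * `|r| * `|x|.
  apply: le_trans (ler_wpM2l _ (psum_le_norm_l1w x N)); last by rewrite mulr_ge0.
  rewrite -psumZ; apply: le_psum => j /andP[j1 _].
  rewrite !normrM (ger0_norm (kap_ge0 n1 j1)) mulrAC [leRHS]mulrACA -!mulrA.
  rewrite [leRHS]mulrA [`|r| * _]mulrC ler_wpM2r ?mulr_ge0//.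
  by rewrite kap_le_wgt.
by split=> //; exists (c * `|r| * `|x|).
Qed.

(** Each product difference splits as [(x - y) i * x j + y i * (x - y) j]. The constant [3 / 2] is
    [1 / 2] from the gain plus [1] from the loss. *)
Lemma Kraw_lipschitz x y N :
  psum (fun n => w n * `|Kraw x n - Kraw y n|) N <=
  3 / 2 * c * (`|x| + `|y|) * `|x - y|.
Proof.
pose D := absl (x - y); pose ax := absl x; pose ay := absl y.
have D0 n : 0 <= D n by exact: normr_ge0.
have ax0 n : 0 <= ax n by exact: normr_ge0.
have ay0 n : 0 <= ay n by exact: normr_ge0.
have prod i j : `|x i * x j - y i * y j| <= D i * ax j + ay i * D j.
  rewrite (_ : _ - _ = (x - y) i * x j + y i * (x - y) j); last by rewrite !l1wBE; ring.
  by rewrite (le_trans (ler_normD _ _))// !normrM.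
have gainB n : `|gain x x n - gain y y n| <= gain D ax n + gain ay D n.
  rewrite /gain -sumrB -psumD; apply: le_trans (ler_norm_sum _ _ _) _.
  rewrite big_nat [leRHS]/psum big_nat; apply: ler_sum => j /andP[j1 jn].
  have nj1 : (1 <= n - j)%N by rewrite subn_gt0.
  set i := (n - j)%N in nj1 *.
  rewrite (_ : kap i j * x i * x j - _ = kap i j * (x i * x j - y i * y j)); last by ring.
  rewrite (_ : kap i j * D i * _ + _ = kap i j * (D i * ax j + ay i * D j)); last by ring.
  by rewrite normrM ger0_norm ?kap_ge0// ler_wpM2l ?kap_ge0.
have lossB n : (1 <= n)%N ->
    `|lsum (fun j => kap n j * x n * x j) - lsum (fun j => kap n j * y n * y j)| <=
    c * D n * `|x| + c * ay n * `|x - y|.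
  move=> n1; have [bx _] := bdsum_kap x (x n) n1; have [by_ _] := bdsum_kap y (y n) n1.
  rewrite lsumB//.
  have H M : psum (fun j => `|kap n j * x n * x j - kap n j * y n * y j|) M <=
      c * D n * `|x| + c * ay n * `|x - y|.
    have [_ H1] := bdsum_kap x (D n) n1; have [_ H2] := bdsum_kap (x - y) (ay n) n1.
    have {}H1 := H1 M; have {}H2 := H2 M.
    rewrite (ger0_norm (D0 n)) in H1; rewrite (ger0_norm (ay0 n)) in H2.
    apply: le_trans (lerD H1 H2); rewrite -psumD; apply: le_psum => j /andP[j1 _].
    rewrite (_ : kap n j * x n * x j - _ = kap n j * (x n * x j - y n * y j)); last by ring.
    rewrite !normrM (ger0_norm (kap_ge0 n1 j1)) (ger0_norm (D0 n)) (ger0_norm (ay0 n)).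
    rewrite [leRHS](_ : _ = kap n j * (D n * ax j + ay n * D j)); last first.
      by rewrite /ax /D /absl; ring.
    by rewrite ler_wpM2l ?kap_ge0.
  by apply: norm_lsum_le => //; eexists; exact: H.
have Dn : psum (fun n => w n * D n) N <= `|x - y| by exact: psum_le_norm_l1w.
have xn : psum (fun n => w n * ax n) N <= `|x| by exact: psum_le_norm_l1w.
have yn : psum (fun n => w n * ay n) N <= `|y| by exact: psum_le_norm_l1w.
have G1 := psum_wgain_le D0 ax0 Dn xn.
have G2 := psum_wgain_le ay0 D0 yn Dn.
have L1 : c * `|x| * psum (fun n => w n * D n) N <= c * `|x| * `|x - y|.
  by rewrite ler_wpM2l// mulr_ge0.
have L2 : c * `|x - y| * psum (fun n => w n * ay n) N <= c * `|x - y| * `|y|.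
  by rewrite ler_wpM2l// mulr_ge0.
apply: (@le_trans _ _ (2^-1 * (psum (fun n => w n * gain D ax n) N +
    psum (fun n => w n * gain ay D n) N) +
   (c * `|x| * psum (fun n => w n * D n) N + c * `|x - y| * psum (fun n => w n * ay n) N))).
  rewrite -!psumZ -!psumD -psumZ -psumD; apply: le_psum => n /andP[n1 _].
  rewrite /Kraw gtn_eqF//.
  set A := gain x x n; set B := gain y y n; set A' := lsum _; set B' := lsum _.
  have H1 := gainB n; have H2 := lossB n n1; rewrite -/A -/B in H1; rewrite -/A' -/B' in H2.
  apply: (@le_trans _ _ (w n * (2^-1 * (gain D ax n + gain ay D n) +
     (c * D n * `|x| + c * ay n * `|x - y|)))).
    rewrite ler_wpM2l ?wgt_ge0//.
    rewrite (_ : _ - _ = 2^-1 * (A - B) - (A' - B')); last by ring.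
    rewrite (le_trans (ler_normB _ _))// lerD// normrM ger0_norm// ler_wpM2l//.
  rewrite le_eqVlt; apply/orP; left; apply/eqP; ring.
move: G1 G2 L1 L2.
set a1 := psum _ N; set a2 := psum _ N; set a3 := c * _ * psum _ N; set a4 := c * _ * psum _ N.
lra.
Qed.

Lemma Kraw_inl1w x : inl1w p (Kraw x).
Proof.
apply: (@inl1w_le _ _ _ (3 / 2 * c * (`|x| + `|0 : X|) * `|x - 0|)) => // N.
apply: le_trans (Kraw_lipschitz x 0 N); apply: le_psum => n /andP[n1 _].
suff -> : Kraw (0 : X) n = 0 by rewrite subr0.
rewrite /Kraw gtn_eqF// /gain (_ : psum _ n = 0); last first.
  by apply: big1 => j _; rewrite l1w0E mulr0.
rewrite mulr0 sub0r (@lsum_fin _ _ 1%N)//; last by move=> j _; rewrite l1w0E mulr0.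
by rewrite /psum big_geq// oppr0.
Qed.

(** Two clusters below size [M] merge below [M + M], so only finitely many kernel values enter;
    continuity in time relies on this. *)
Lemma Kraw_finite x M n : (1 <= M)%N -> (forall j, (M <= j)%N -> x j = 0) ->
  Kraw x n = if (n < M + M)%N then (if (n == 0)%N then 0 else
    2^-1 * gain x x n - psum (fun j => kap n j * x n * x j) M) else 0.
Proof.
move=> M1 xM; rewrite /Kraw; case: eqP => [->|/eqP n0].
  by rewrite addn_gt0 M1.
rewrite (@lsum_fin _ _ M)//; last by move=> j Mj; rewrite [x j]xM// mulr0.
case: ltnP => // nM; rewrite /gain [X in 2^-1 * X]big1_seq; last first.
  move=> j /=; rewrite mem_index_iota => /andP[_ jn].
  have [jM|Mj] := ltnP j M; last by rewrite [x j]xM// mulr0.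
  rewrite [x (n - j)%N]xM ?mulr0 ?mul0r//.
  by rewrite leq_subRL ?(ltnW jn)// (leq_trans _ nM)// leq_add2r ltnW.
rewrite /psum big1 ?mulr0 ?subr0// => j _.
by rewrite [x n]xM ?mulr0 ?mul0r// (leq_trans (leq_addl M M)).
Qed.

Definition loss_rate x n : R := lsum (fun j => kap n j * x j).

Lemma loss_rate_bound x n : (1 <= n)%N -> `|loss_rate x n| <= c * `|x|.
Proof.
move=> n1; have [b1 H1] := bdsum_kap x 1 n1.
have E N : psum (fun j => `|kap n j * x j|) N = psum (fun j => `|kap n j * 1 * x j|) N.
  by apply: eq_psum => j; rewrite mulr1.
have H N : psum (fun j => `|kap n j * x j|) N <= c * `|x|.
  by rewrite E -[c]mulr1 -[X in c * X]normr1; exact: H1.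
by apply: norm_lsum_le => //; exists (c * `|x|).
Qed.

Lemma Kraw_lossE x n : (1 <= n)%N ->
  Kraw x n = 2^-1 * gain x x n - x n * loss_rate x n.
Proof.
move=> n1; rewrite /Kraw gtn_eqF//; congr (_ - _).
have [b1 _] := bdsum_kap x 1 n1.
have b2 : bdsum (fun j => `|kap n j * x j|).
  by apply: bdsum_le b1 => j _; rewrite mulr1.
apply/cvg_lim => //; rewrite (_ : psum _ = fun N => x n * psum (fun j => kap n j * x j) N).
  by apply: cvgMr; exact: cvg_lsum.
by apply/funext => N; rewrite -psumZ; apply: eq_psum => j; ring.
Qed.

Definition Kl x : X := mkl1w p (Kraw x).

Lemma KlE x : Kl x = Kraw x :> (nat -> R).
Proof. by rewrite mkl1wE//; exact: Kraw_inl1w. Qed.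

Lemma Kl_lipschitz x y : `|Kl x - Kl y| <= 3 / 2 * c * (`|x| + `|y|) * `|x - y|.
Proof.
apply: norm_l1w_le => N; apply: le_trans (Kraw_lipschitz x y N).
by apply: le_psum => n _; rewrite l1wBE !KlE.
Qed.

Lemma Kl_step_coord x h n : (1 <= n)%N ->
  (x + h *: Kl x) n = x n * (1 - h * loss_rate x n) + h * (2^-1 * gain x x n).
Proof. by move=> n1; rewrite l1wDE l1wZE KlE Kraw_lossE//; ring. Qed.

(** Step-size restriction: for such [h] the loss alone cannot reverse the sign of a coordinate. *)
Lemma loss_factor_ge0 x h n : (1 <= n)%N -> 0 <= h -> h * (c * `|x|) <= 1 ->
  0 <= 1 - h * loss_rate x n.
Proof.
move=> n1 h0 hc; rewrite subr_ge0 (le_trans _ hc)// ler_wpM2l//.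
by rewrite (le_trans (ler_norm _))// loss_rate_bound.
Qed.

(** The rate [2 * c * |x|] collects [c * |x|] from the loss factor, whose rate may be negative while
    [x] is signed, and half of two gain terms [c * |x|]. *)
Lemma negpart_step x h : 0 <= h -> h * (c * `|x|) <= 1 ->
  posq w (- (x + h *: Kl x)) <= (1 + 2 * c * `|x| * h) * posq w (- x).
Proof.
move=> h0 hc; pose m n := Num.max 0 (- x n); pose ax := absl x.
have sw := @subweight_wgt R p.
have m0 n : 0 <= m n by exact: max0_ge0.
have ax0 n : 0 <= ax n by exact: normr_ge0.
have mM N : psum (fun n => w n * m n) N <= posq w (- x) by exact: (psum_le_posq sw (- x) N).
have gain_neg n : - gain x x n <= gain ax m n + gain m ax n.
  rewrite /gain -psumD -sumrN; apply: le_psum => j /andP[j1 jn].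
  have nj1 : (1 <= n - j)%N by rewrite subn_gt0.
  set i := (n - j)%N in nj1 *.
  rewrite (_ : kap i j * ax i * _ + _ = kap i j * (ax i * m j + m i * ax j)); last by ring.
  rewrite -!mulrA -mulrN ler_wpM2l ?kap_ge0// /ax /m /absl.
  exact: mul_negpart_le.
apply: tsum_le => N.
have G1 := psum_wgain_le (N := N) ax0 m0 (psum_le_norm_l1w x N) (mM N).
have G2 := psum_wgain_le (N := N) m0 ax0 (mM N) (psum_le_norm_l1w x N).
apply: (@le_trans _ _ ((1 + h * (c * `|x|)) * psum (fun n => w n * m n) N +
   h * 2^-1 * (psum (fun n => w n * gain ax m n) N + psum (fun n => w n * gain m ax n) N))).
  rewrite -psumD -!psumZ -psumD; apply: le_psum => n /andP[n1 _].
  rewrite l1wNE Kl_step_coord//.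
  have L0 := loss_factor_ge0 n1 h0 hc.
  have L1 : 1 - h * loss_rate x n <= 1 + h * (c * `|x|).
    rewrite lerD2l -mulrN ler_wpM2l//; have := loss_rate_bound x n1.
    by rewrite -normrN; exact: le_trans (ler_norm _).
  apply: (@le_trans _ _ (w n * (m n * (1 + h * (c * `|x|)) +
     h * 2^-1 * (gain ax m n + gain m ax n)))).
    rewrite ler_wpM2l ?wgt_ge0// opprD (le_trans (max0D _ _))// lerD//.
      rewrite ge_max mulr_ge0 ?(le_trans L0 L1)//=.
      apply: (@le_trans _ _ (m n * (1 - h * loss_rate x n))); last by rewrite ler_wpM2l.
      by rewrite -(mulNr (x n)) ler_wpM2r// /m le_max lexx orbT.
    have gg0 : 0 <= gain ax m n + gain m ax n.
      by rewrite addr_ge0// gain_ge0.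
    rewrite ge_max; apply/andP; split; first by rewrite !mulr_ge0.
    by rewrite mulrA -mulrN ler_wpM2l ?mulr_ge0.
  rewrite le_eqVlt; apply/orP; left; apply/eqP; ring.
have P0 : 0 <= psum (fun n => w n * m n) N.
  by apply: psum_ge0 => n _; rewrite mulr_ge0 ?wgt_ge0.
have Q0 : (1 + h * (c * `|x|)) * psum (fun n => w n * m n) N <=
   (1 + h * (c * `|x|)) * posq w (- x).
  by rewrite ler_wpM2l// addr_ge0// !mulr_ge0.
have Q1 : h * 2^-1 * (psum (fun n => w n * gain ax m n) N + psum (fun n => w n * gain m ax n) N)
   <= h * 2^-1 * (c * `|x| * posq w (- x) + c * posq w (- x) * `|x|).
  by rewrite ler_wpM2l ?mulr_ge0// lerD.
apply: le_trans (lerD Q0 Q1) _; rewrite le_eqVlt; apply/orP; left; apply/eqP; by field.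
Qed.

(** Weak form of coagulation: the moment changes at half the double sum of [W (i + j) - W i - W j],
    hence the factor in [2 * B]. The step stays nonnegative, so its positive part is itself. *)
Lemma moment_step (W : nat -> R) x h B : subweight (p := p) W ->
  0 <= h -> h * (c * `|x|) <= 1 -> (forall n, 0 <= x n) ->
  (forall N, psum (fun i => psum (fun j =>
     (W (i + j)%N - W i - W j) * kap i j * x i * x j) N) N <= 2 * B) ->
  posq W (x + h *: Kl x) <= posq W x + h * B.
Proof.
move=> Ww h0 hc x0 HB; apply: tsum_le => N.
have W0 n : (1 <= n)%N -> 0 <= W n by move=> /Ww/andP[].
have gain0 n : 0 <= gain x x n by exact: gain_ge0.
have step0 n : (1 <= n)%N -> 0 <= (x + h *: Kl x) n.
  move=> n1; rewrite Kl_step_coord// addr_ge0 ?mulr_ge0//.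
  exact: loss_factor_ge0.
have KN : psum (fun n => W n * Kraw x n) N <= B.
  apply: (@le_trans _ _ (2^-1 * psum (fun n => W n * gain x x n) N
     - psum (fun n => psum (fun j => W n * kap n j * x n * x j) N) N)).
    rewrite -psumZ lerBrDr -psumD; apply: le_psum => n /andP[n1 _].
    rewrite /Kraw gtn_eqF// mulrBr.
    have [bx _] := bdsum_kap x (x n) n1.
    have : psum (fun j => kap n j * x n * x j) N <= lsum (fun j => kap n j * x n * x j).
      by apply: psum_le_lsum => // j j1; rewrite !mulr_ge0 ?kap_ge0.
    move=> /(ler_wpM2l (W0 n n1)); rewrite -psumZ.
    rewrite (eq_psum (g := fun j => W n * kap n j * x n * x j)); last by move=> j; ring.
    by move=> ?; lra.
  have G := psum_gain_le N W0 x0 x0.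
  (* Symmetry of the kernel lets the loss be shared equally between [W i] and [W j]. *)
  have sym : psum (fun n => psum (fun j => W n * kap n j * x n * x j) N) N =
             psum (fun n => psum (fun j => W j * kap n j * x n * x j) N) N.
    rewrite /psum exchange_big_nat/=; apply: eq_big_nat => n /andP[n1 _].
    by apply: eq_big_nat => j /andP[j1 _]; rewrite (kap_sym n1 j1); ring.
  have := HB N.
  rewrite (_ : psum _ N = psum (fun i => psum (fun j => W (i + j)%N * kap i j * x i * x j) N) N
     - psum (fun n => psum (fun j => W n * kap n j * x n * x j) N) N
     - psum (fun n => psum (fun j => W j * kap n j * x n * x j) N) N).
    by rewrite -sym; lra.
  rewrite /psum -!sumrB; apply: eq_bigr => i _; rewrite -!sumrB; apply: eq_bigr => j _.
  by ring.
apply: (@le_trans _ _ (psum (fun n => W n * Num.max 0 (x n)) N + h * psum (fun n => W n * Kraw x n) N)).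
  rewrite -psumZ -psumD; apply: le_psum => n /andP[n1 _].
  rewrite max_r ?step0// max_r// l1wDE l1wZE KlE.
  by rewrite le_eqVlt; apply/orP; left; apply/eqP; ring.
by rewrite lerD ?psum_le_posq// ler_wpM2l.
Qed.

End CoagulationKernel.

(** * The moment inequality and its constant *)

Section MomentInequality.
Context {R : realType}.
Implicit Types (p q r s x y : R).

(* Concavity of [ln] through the tangent bound [ln z <= z - 1] at [(1 + r) / (1 + q r)] and at [1 / (1 + q r)]. *)
Lemma bernoulli_powR q r : 0 <= q -> q <= 1 -> 0 <= r -> (1 + r) `^ q <= 1 + q * r.
Proof.
move=> q0 q1 r0; pose A := 1 + q * r.
have A0 : 0 < A by rewrite ltr_wpDr ?mulr_ge0.
have r10 : 0 < 1 + r by lra.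
have lnle z : 0 < z -> ln z <= z - 1 :> R.
  move=> z0; have := @le_ln1Dx R (z - 1).
  by rewrite (_ : 1 + (z - 1) = z); [apply; lra|ring].
have H1 := lnle _ (divr_gt0 r10 A0).
have H2 : ln A^-1 <= A^-1 - 1 by apply: lnle; rewrite invr_gt0.
rewrite lnM ?posrE ?invr_gt0// in H1; rewrite lnV ?posrE// in H1 H2.
have H3 : q * ((1 + r) / A - 1) + (1 - q) * (A^-1 - 1) = 0.
  by rewrite /A; field; rewrite -/A gt_eqF.
have H4 : q * (ln (1 + r) - ln A) <= q * ((1 + r) / A - 1) by rewrite ler_wpM2l.
have H5 : (1 - q) * (- ln A) <= (1 - q) * (A^-1 - 1) by rewrite ler_wpM2l// subr_ge0.
rewrite -ler_ln ?posrE ?powR_gt0// ln_powR; lra.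
Qed.

(** [bernoulli_powR] with exponent [p - 1] makes the left side polynomial apart from [r^p]. The
    terms [p r] then cancel, leaving [(2 p - 1) r^2 + (p - 1) r^3 <= (p + 1 + r) r^p], which follows
    from [r^2 <= r^p] and [p <= 2]. *)
Lemma moment_ratio_le2 p r : 1 < p -> p <= 2 -> 0 < r -> r <= 1 ->
  (1 + r) * ((1 + r) `^ p - 1 - r `^ p) <= p * (r + r `^ p).
Proof.
move=> p1 p2 r0 r1.
have rp : r ^+ 2 <= r `^ p.
  by rewrite -powR_mulrn ?(ltW r0)// ger_powR// r0 r1.
have B : (1 + r) `^ (p - 1) <= 1 + (p - 1) * r by apply: bernoulli_powR; lra.
have E : (1 + r) `^ p = (1 + r) * (1 + r) `^ (p - 1).
  have r10 : 0 < 1 + r by lra.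
  rewrite [in LHS](_ : p = 1 + (p - 1)); last by ring.
  rewrite [LHS]powRD ?powRr1 ?(ltW r10)//.
  by apply/implyP => _; rewrite gt_eqF.
have H1 : (1 + r) `^ p <= (1 + r) * (1 + (p - 1) * r).
  by rewrite E ler_wpM2l//; lra.
have H2 : (1 + r) * ((1 + r) `^ p - 1 - r `^ p) <=
   (1 + r) * ((1 + r) * (1 + (p - 1) * r) - 1 - r `^ p).
  by rewrite ler_wpM2l//; lra.
apply: le_trans H2 _; set z := r `^ p in rp *.
have H3 : (2 * p - 1) * r ^+ 2 <= (p + 1) * r ^+ 2 by rewrite ler_wpM2r ?sqr_ge0//; lra.
have H4 : (p - 1) * r ^+ 2 <= 1 * r ^+ 2 by rewrite ler_wpM2r ?sqr_ge0//; lra.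
have H5 : r * ((p - 1) * r ^+ 2) <= r * (1 * r ^+ 2) by rewrite ler_wpM2l// ltW.
have H6 : (p + 1) * r ^+ 2 <= (p + 1) * z by rewrite ler_wpM2l//; lra.
have H7 : r * r ^+ 2 <= r * z by rewrite ler_wpM2l// ltW.
lra.
Qed.

(* With [J s = r (s + 1)^p + (1 - r) s^p - (s + r)^p] the claim reads [J r <= J 1];
   [J] is nondecreasing since [s^(p - 1)] is convex. *)
Lemma moment_ratio_ge2 p r : 2 <= p -> 0 < r -> r <= 1 ->
  (1 + r) * ((1 + r) `^ p - 1 - r `^ p) <= (2 `^ p - 2) * (r + r `^ p).
Proof.
move=> p2 r0 r1.
pose J s := r * (s + 1) `^ p + (1 - r) * s `^ p - (s + r) `^ p.
pose dJ s := r * (p * (s + 1) `^ (p - 1)) + (1 - r) * (p * s `^ (p - 1))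
  - p * (s + r) `^ (p - 1).
have DJ s : 0 < s -> is_derive s 1 J (dJ s).
  move=> s0.
  have Dc c : 0 <= c -> is_derive s 1 (fun s => (s + c) `^ p) (p * (s + c) `^ (p - 1)).
    move=> c0; have s1 : 0 < s + c by rewrite ltr_wpDr.
    have D1 : is_derive s 1 (fun s => s + c) 1.
      by apply: is_derive_eq; rewrite addr0.
    have := @is_derive1_comp R (fun z => z `^ p) (fun s => s + c) s _ _ (is_derive1_powR p s1) D1.
    by rewrite mulr1.
  have D1 := Dc 1 ler01; have D2 := Dc r (ltW r0); have D3 := is_derive1_powR p s0.
  by rewrite /J /dJ; apply: is_derive_eq.
have dJ0 s : 0 < s -> 0 <= dJ s.
  move=> s0.
  have q1 : 1 <= p - 1 by lra.
  have r0' := ltW r0.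
  have H : (r * (s + 1) + (1 - r) * s) `^ (p - 1) <=
      r * (s + 1) `^ (p - 1) + (1 - r) * s `^ (p - 1).
    apply: (@convex_powR R (p - 1) q1 (Itv01 r0' r1) (s + 1 : R) (s : R));
      rewrite inE/= in_itv/= andbT; lra.
  rewrite (_ : r * (s + 1) + (1 - r) * s = s + r) in H; last by ring.
  rewrite /dJ.
  rewrite (_ : _ - _ = p * (r * (s + 1) `^ (p - 1) + (1 - r) * s `^ (p - 1) - (s + r) `^ (p - 1)));
    last by ring.
  by rewrite mulr_ge0 ?subr_ge0//; lra.
have [s||c] := @MVT_segment R J dJ r 1 r1.
- by rewrite in_itv/= => /andP[rs _]; apply: DJ; exact: lt_trans rs.
- apply: derivable_within_continuous => s; rewrite in_itv/= => /andP[rs _].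
  by apply: ex_derive; apply: DJ; exact: lt_le_trans rs.
rewrite in_itv/= => /andP[rc _] JE.
have : 0 <= J 1 - J r.
  by rewrite JE; apply: mulr_ge0; [apply: dJ0; exact: lt_le_trans rc|lra].
(* The inequality [J r <= J 1] becomes the claim through [(1 + r) (1 + r^p) - 2 (r + r^p) = (1 - r)
   (1 - r^p)]. *)
rewrite /J !powR1 -[1 + 1]/(2 : R) (_ : (r + r) `^ p = 2 `^ p * r `^ p); last first.
  by rewrite -powRM ?(ltW r0)//; congr powR; ring.
rewrite [r + 1]addrC; set u := (1 + r) `^ p; set v := r `^ p; set z := 2 `^ p; lra.
Qed.

(** Both sides are symmetric and homogeneous of degree [p + 1], so only [r = x / y <= 1] has to be
    treated. *)
Lemma moment_ineq p x y : 1 < p -> 0 < x -> 0 < y ->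
  (x + y) * ((x + y) `^ p - x `^ p - y `^ p) <= cp p * (x * y `^ p + y * x `^ p).
Proof.
move=> p1; wlog xy : x y / x <= y => [H x0 y0|].
  have [xy|yx] := leP x y; first exact: H.
  have := H y x (ltW yx) y0 x0; rewrite [y + x]addrC [_ - y `^ p - _]addrAC.
  by rewrite [X in _ <= cp p * X]addrC.
move=> x0 y0; pose r := x / y.
have r0 : 0 < r by rewrite divr_gt0.
have r1 : r <= 1 by rewrite ler_pdivrMr// mul1r.
have xE : x = r * y by rewrite /r divfK// gt_eqF.
have core : (1 + r) * ((1 + r) `^ p - 1 - r `^ p) <= cp p * (r + r `^ p).
  rewrite /cp; case: ifP => p2; first exact: moment_ratio_le2.
  by apply: moment_ratio_ge2 => //; move/negbT: p2; rewrite -ltNge => /ltW.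
have -> : x `^ p = r `^ p * y `^ p by rewrite xE powRM// ltW.
have -> : (x + y) `^ p = (1 + r) `^ p * y `^ p.
  by rewrite -powRM ?ltW//; [congr powR; rewrite xE; ring|lra].
rewrite xE.
have := ler_wpM2r (_ : 0 <= y * y `^ p) core.
rewrite mulr_ge0 ?powR_ge0 ?(ltW y0)// => /(_ isT).
rewrite (_ : _ * (y * y `^ p) = (r * y + y) * ((1 + r) `^ p * y `^ p - r `^ p * y `^ p - y `^ p));
  last by ring.
rewrite (_ : cp p * _ * (y * y `^ p) = cp p * (r * y * y `^ p + y * (r `^ p * y `^ p))) //; ring.
Qed.

End MomentInequality.

Lemma max_dist {R : realType} (M r s : R) :
  `|Num.max M r - Num.max M s| <= `|r - s|.
Proof.
rewrite /Order.max; have := ler_norm (r - s); have := lerNnormlW (lexx `|r - s|).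
by repeat case: ifPn; rewrite -?leNgt => *; rewrite ler_norml; lra.
Qed.

(** * Time dependence of the coagulation operator and its radial cut-off *)

Section TimeDependentKernel.
Context {R : realType} {p : R}.
Local Notation X := (l1w p).
Local Notation w := (wgt p).
Implicit Types (x y z : X) (v : R -> X) (s t : R).
Hypothesis p_ge0 : 0 <= p.
Variables (kk : nat -> nat -> R -> R) (c : R).
Hypothesis c_ge0 : 0 <= c.
Hypothesis kk_ge0 : forall s n j, (1 <= n)%N -> (1 <= j)%N -> 0 <= kk n j s.
Hypothesis kk_le : forall s n j, (1 <= n)%N -> (1 <= j)%N ->
  kk n j s <= c * w n * w j / w (n + j).
Hypothesis kk_cont : forall n j, (1 <= n)%N -> (1 <= j)%N -> continuous (kk n j).

Definition Kt : R -> X -> X := locked (fun s x => Kl (fun n j => kk n j s) x).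

Lemma KtE s x : Kt s x = Kraw (fun n j => kk n j s) x :> (nat -> R).
Proof. by rewrite /Kt -lock; exact: (KlE p_ge0 c_ge0 (kk_ge0 s) (kk_le s)). Qed.

Lemma Kt_lipschitz s x y :
  `|Kt s x - Kt s y| <= 3 / 2 * c * (`|x| + `|y|) * `|x - y|.
Proof. by rewrite /Kt -lock; exact: (Kl_lipschitz p_ge0 c_ge0 (kk_ge0 s) (kk_le s)). Qed.

(** Continuity of the kernel is available for one pair of indices at a time; for finitely supported
    [z] finitely many pairs suffice. *)
Lemma continuous_Kt_fin M z : (1 <= M)%N -> (forall j, (M <= j)%N -> z j = 0) ->
  continuous (fun s => Kt s z).
Proof.
move=> M1 zM s0; apply/(@cvgrPdist_le _ _ _ (nbhs s0)) => e e0.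
pose D s n := if (n == 0)%N then 0 else w n * `|Kt s0 z n - Kt s z n|.
have cc n : (1 <= n)%N -> {for s0, continuous (fun s => Kt s z n)}.
  move=> n1; rewrite (_ : (fun s => _) = fun s => if (n < M + M)%N then
    2^-1 * gain (fun n j => kk n j s) z z n - psum (fun j => kk n j s * z n * z j) M else 0); last first.
    apply/funext => s; rewrite KtE (Kraw_finite _ _ M1)//; case: ifP => //.
    by rewrite gtn_eqF.
  case: (n < M + M)%N; last exact: cvg_cst.
  apply: cvgB.
    apply: cvgMr; rewrite /gain.
    (* The guard replaces the value at index [0], where nothing is known about the kernel; inside
       the sum [j < n], so it changes nothing. *)
    pose h s j := if (n - j == 0)%N then 0 else kk (n - j)%N j s * z (n - j)%N * z j.
    have hE s : psum (fun j => kk (n - j)%N j s * z (n - j)%N * z j) n = psum (h s) n.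
      apply: eq_big_nat => j /andP[j1 jn]; rewrite /h subn_eq0 leqNgt jn//.
    rewrite hE (_ : (fun s => _) = fun s => psum (h s) n); last exact/funext.
    apply: cvg_psum_term => j j1; rewrite /h; case: eqP => [_|/eqP nj]; first exact: cvg_cst.
    by do 2 apply: cvgMl; apply: kk_cont => //; rewrite lt0n.
  by apply: cvg_psum_term => j j1; do 2 apply: cvgMl; exact: kk_cont.
have cD : psum (D s) (M + M) @[s --> s0] --> psum (D s0) (M + M).
  apply: cvg_psum_term => n n1; rewrite /D gtn_eqF//.
  apply: cvgMr; apply: cvg_norm; apply: cvgB; [exact: cvg_cst|exact: cc].
have D0 : psum (D s0) (M + M) = 0.
  by apply: big1 => n _; rewrite /D subrr normr0 mulr0 if_same.
rewrite D0 in cD; move/cvgrPdist_le : cD => /(_ e e0); apply: filterS => s.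
rewrite sub0r normrN => H; apply: norm_l1w_le => N.
have Dp n : (1 <= n)%N -> 0 <= D s n.
  by move=> n1; rewrite /D gtn_eqF// mulr_ge0 ?wgt_ge0.
apply: le_trans (_ : psum (D s) N <= _).
  by apply: le_psum => n /andP[n1 _]; rewrite /D gtn_eqF// l1wBE.
apply: le_trans (le_trans (ler_norm _) H).
have [NM|MN] := leqP N (M + M); first exact: nondecreasing_psum.
have MM1 : (1 <= M + M)%N by rewrite addn_gt0 M1.
rewrite [leLHS]/psum (big_cat_nat MM1 (ltnW MN))/= [X in _ + X]big1_seq ?addr0// => n /=.
rewrite mem_index_iota => /andP[Mn _].
rewrite /D gtn_eqF ?(leq_trans MM1)// !KtE !(Kraw_finite _ _ M1)// ltnNge Mn/=.
by rewrite subrr normr0 mulr0.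
Qed.

(** A truncation [z] of [v s0] reduces to the finite case, the Lipschitz bound on bounded sets being
    uniform in time. *)
Lemma continuous_Kt v : continuous v -> continuous (fun s => Kt s (v s)).
Proof.
move=> cv s0; apply/(@cvgrPdist_le _ _ _ (nbhs s0)) => e e0.
(* Lipschitz constant of [Kt] on the ball of radius [|v s0| + 1], which contains [z] and [v s] for
   [s] near [s0]. *)
pose C := 3 / 2 * c * (2 * `|v s0| + 2).
have C0 : 0 <= C by rewrite !mulr_ge0// addr_ge0// mulr_ge0.
have C1 : 0 < C + 1 by rewrite ltr_wpDl.
have d0 : 0 < e / 4 / (C + 1) by rewrite !divr_gt0.
have Ce : C * (e / 4 / (C + 1)) <= e / 4.
  by rewrite mulrA ler_pdivrMr// mulrC ler_wpM2l//; lra.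
have Ce2 : C * (e / 4 / (C + 1)) + C * (e / 4 / (C + 1)) <= e / 2 by lra.
have m0 : 0 < Num.min 1 (e / 4 / (C + 1)) by rewrite lt_min ltr01.
have [M0 HM] := truncl1w_cvg (v s0) m0.
have {HM} := HM M0.+1 (leqnSn _).
set z := truncl1w M0.+1 (v s0); rewrite lt_min => /andP[zv1 zv].
have zfin j : (M0.+1 <= j)%N -> z j = 0 by move=> Mj; rewrite truncl1wE ltnNge Mj.
clearbody z.
have /cvgrPdist_le/(_ _ (divr_gt0 e0 (ltr0n _ 4))) H1 := @continuous_Kt_fin M0.+1 z isT zfin s0.
have /cvgrPdist_le/(_ _ m0) H2 := cv s0.
near=> s.
have A1 : `|Kt s0 z - Kt s z| <= e / 4 by near: s.
have : `|v s0 - v s| <= Num.min 1 (e / 4 / (C + 1)) by near: s.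
rewrite le_min => /andP[A2 A3].
have nz : `|z| <= `|v s0| + 1.
  by have := ler_normB (v s0) (v s0 - z); rewrite opprB addrC subrK; lra.
have nvs : `|v s| <= `|v s0| + 1.
  by have := ler_normB (v s0) (v s0 - v s); rewrite opprB addrC subrK; lra.
have L r y : `|y| <= `|v s0| + 1 -> `|Kt r y - Kt r z| <= C * `|y - z|.
  move=> ny; apply: le_trans (Kt_lipschitz _ _ _) _.
  by rewrite ler_wpM2r// /C ler_wpM2l ?mulr_ge0//; lra.
have B1 := L s0 (v s0) (ltac:(lra)).
have B2 := L s (v s) nvs.
have B3 : `|v s - z| <= e / 4 / (C + 1) + e / 4 / (C + 1).
  apply: le_trans (ler_distD (v s0) _ _) _; rewrite (distrC (v s)).
  by apply: lerD A3 _; exact: ltW.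

have B4 : C * `|v s0 - z| <= C * (e / 4 / (C + 1)) by rewrite ler_wpM2l// ltW.
have B5 : C * `|v s - z| <= C * (e / 4 / (C + 1) + e / 4 / (C + 1)) by rewrite ler_wpM2l.
rewrite mulrDr in B5.
have T1 := le_trans B1 (le_trans B4 Ce).
have T2 := le_trans B2 (le_trans B5 Ce2).
rewrite distrC in T2.
have T3 := le_trans (ler_distD (Kt s z) _ _) (lerD A1 T2).
have T4 := le_trans (ler_distD (Kt s0 z) _ _) (lerD T1 T3).
rewrite (_ : e = e / 4 + (e / 4 + e / 2)); last by field.
exact: T4.
Unshelve. all: by end_near. Qed.

Definition retract (M : R) x : X := (M / Num.max M `|x|) *: x.

Lemma retract_id M x : 0 < M -> `|x| <= M -> retract M x = x.
Proof. by move=> M0 xM; rewrite /retract max_l// divff ?scale1r// gt_eqF. Qed.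

Lemma norm_retract M x : 0 < M -> `|retract M x| <= M.
Proof.
move=> M0; have m0 : 0 < Num.max M `|x| by rewrite lt_max M0.
rewrite normrZ ger0_norm ?divr_ge0 ?(ltW M0) ?(ltW m0)//.
by rewrite mulrAC ler_pdivrMr// ler_wpM2l ?(ltW M0)// le_max lexx orbT.
Qed.

(** One unit comes from scaling [x - y] by a factor at most [1], the other from the change of that
    factor, which is applied to [y] and controlled because [|y| <= my]. *)
Lemma retract_lipschitz M x y : 0 < M -> `|retract M x - retract M y| <= 2 * `|x - y|.
Proof.
move=> M0; set mx := Num.max M `|x|; set my := Num.max M `|y|.
have mx0 : 0 < mx by rewrite lt_max M0.
have my0 : 0 < my by rewrite lt_max M0.
have Mmx : M <= mx by rewrite le_max lexx.
have Mmy : M <= my by rewrite le_max lexx.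
have ymy : `|y| <= my by rewrite le_max lexx orbT.
have dm : `|mx - my| <= `|x - y|.
  by apply: le_trans (max_dist _ _ _) _; exact: ler_dist_dist.
rewrite (_ : _ - _ = (M / mx) *: (x - y) + (M / mx - M / my) *: y); last first.
  by rewrite /retract -/mx -/my scalerBr scalerBl addrA subrK.
rewrite (le_trans (ler_normD _ _))// mulr2n mulrDl !mul1r lerD// normrZ.
  rewrite ger0_norm ?divr_ge0 ?(ltW M0) ?(ltW mx0)//.
  by rewrite ler_piMl// ler_pdivrMr// mul1r.
have -> : M / mx - M / my = M / mx * ((my - mx) / my).
  by field; rewrite !gt_eqF.
have q0 : 0 <= M / mx by rewrite divr_ge0 ?(ltW M0) ?(ltW mx0).
rewrite normrM (ger0_norm q0) normrM normfV (gtr0_norm my0).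
rewrite -mulrA; apply: (@le_trans _ _ (1 * (`|my - mx| / my * `|y|))).
  by rewrite ler_wpM2r ?mulr_ge0 ?invr_ge0 ?(ltW my0)// ler_pdivrMr// mul1r.
rewrite mul1r mulrAC ler_pdivrMr// distrC.
by apply: ler_pM.
Qed.

Lemma Kt_retract_lipschitz M s x y : 0 < M ->
  `|Kt s (retract M x) - Kt s (retract M y)| <= (6 * c * M) * `|x - y|.
Proof.
move=> M0; apply: le_trans (Kt_lipschitz _ _ _) _.
have H1 := norm_retract x M0; have H2 := norm_retract y M0.
have H3 := retract_lipschitz x y M0.
apply: (@le_trans _ _ (3 / 2 * c * (M + M) * (2 * `|x - y|))).
  by rewrite ler_pM// ?mulr_ge0 ?addr_ge0// ler_wpM2l ?mulr_ge0// lerD.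
by rewrite le_eqVlt; apply/orP; left; apply/eqP; field.
Qed.

Lemma continuous_retract M v : 0 < M -> continuous v -> continuous (fun s => retract M (v s)).
Proof.
move=> M0 cv s; apply/(@cvgrPdist_le _ _ _ (nbhs s)) => e e0.
have e20 : 0 < e / 2 by rewrite divr_gt0.
have /cvgrPdist_le/(_ _ e20) := cv s; apply: filterS => t H.
by have := retract_lipschitz (v s) (v t) M0; lra.
Qed.

End TimeDependentKernel.

(** * Positivity, mass and norm bounds for mild solutions *)

Section AprioriBounds.
Context {R : realType} {p : R}.
Local Notation X := (l1w p).
Local Notation w := (wgt p).
Implicit Types (x y : X) (s t h : R).
Hypothesis p_gt1 : 1 < p.

Definition idw (n : nat) : R := n%:R.

Lemma subweight_idw : subweight (p := p) idw.
Proof.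
move=> n n1; rewrite /idw ler0n /wgt -{1}[n%:R](@powRr1 R)// ler_powR ?ler1n//.
exact: ltW.
Qed.

Lemma cp_ge0 : 0 <= cp p.
Proof.
rewrite /cp; case: ifPn => [_|]; first by rewrite ltW// (lt_trans _ p_gt1).
rewrite -ltNge subr_ge0 => p2; rewrite -{1}[2](@powRr1 R)// ler_powR ?ler1n//; exact: ltW.
Qed.

Lemma moment_ineq_wgt i j : (1 <= i)%N -> (1 <= j)%N ->
  (i + j)%:R * (w (i + j) - w i - w j) <= cp p * (i%:R * w j + j%:R * w i).
Proof.
by move=> i1 j1; rewrite /wgt natrD; apply: moment_ineq; rewrite ?ltr0n.
Qed.

Lemma posq_nonneg W x : (forall n, 0 <= x n) -> posq W x = tsum (fun n => W n * x n).
Proof. by move=> x0; congr tsum; apply/funext => n; rewrite max_r. Qed.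

Lemma posq_wgt_nonneg x : (forall n, 0 <= x n) -> posq w x = `|x|.
Proof.
move=> x0; rewrite posq_nonneg// norm_l1wE; congr tsum; apply/funext => n.
by rewrite ger0_norm.
Qed.

Lemma posq_negpart_eq0 x : (forall n, 0 <= x n) -> posq w (- x) = 0.
Proof.
move=> x0; apply/eqP; rewrite eq_le posq_ge0 ?andbT; last exact: subweight_wgt.
apply: tsum_le => N; rewrite /psum big1// => n _.
by rewrite l1wNE max_l ?oppr_le0// mulr0.
Qed.

Lemma posq_negpart_le0 x : posq w (- x) <= 0 -> forall n, 0 <= x n.
Proof.
have sw := @subweight_wgt R p.
move=> x0 [|n]; first by rewrite l1w_coord0.
have := le_tsum_term (@posq_term_ge0 R p w sw (- x)) (posq_bdsum sw (- x)) (ltn0Sn n).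
move=> /le_trans/(_ x0); rewrite pmulr_rle0 ?wgt_gt0// l1wNE => H.
by rewrite -oppr_le0 (le_trans _ H)// le_max lexx orbT.
Qed.

Section Kernel.
Variables (kk : nat -> nat -> R -> R) (c m : R).
Hypothesis c_ge0 : 0 <= c.
Hypothesis m_ge0 : 0 <= m.
Hypothesis kk_ge0 : forall s n j, (1 <= n)%N -> (1 <= j)%N -> 0 <= kk n j s.
Hypothesis kk_sym : forall s n j, (1 <= n)%N -> (1 <= j)%N -> kk n j s = kk j n s.
Hypothesis kk_le : forall s n j, (1 <= n)%N -> (1 <= j)%N ->
  kk n j s <= c * w n * w j / w (n + j).
Hypothesis kk_lin : forall s n j, (1 <= n)%N -> (1 <= j)%N ->
  kk n j s <= m * (n + j)%:R.
Hypothesis kk_cont : forall n j, (1 <= n)%N -> (1 <= j)%N -> continuous (kk n j).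

Let p_ge0 : 0 <= p. Proof. by rewrite ltW// (lt_trans _ p_gt1). Qed.

Lemma KtKl s x : Kt kk s x = Kl (fun n j => kk n j s) x.
Proof. by rewrite /Kt -lock. Qed.

(** The kernel bound [m (i + j)] supplies the factor that [moment_ineq] expects; the two symmetric
    terms each sum to mass times norm, hence the [2]. *)
Lemma moment_wgt_sum_le s x N : (forall n, 0 <= x n) ->
  psum (fun i => psum (fun j =>
     (w (i + j)%N - w i - w j) * kk i j s * x i * x j) N) N <=
  2 * (cp p * m * posq idw x * posq w x).
Proof.
move=> x0; pose P1 := psum (fun i => i%:R * x i) N; pose Pw := psum (fun i => w i * x i) N.
have H1 : P1 <= posq idw x.
  by rewrite posq_nonneg//; have := psum_le_posq subweight_idw x N;
    rewrite (eq_psum (g := fun n => idw n * x n)) ?posq_nonneg// => n; rewrite max_r.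
have sw := @subweight_wgt R p.
have H2 : Pw <= posq w x.
  by rewrite posq_nonneg//; have := psum_le_posq sw x N;
    rewrite (eq_psum (g := fun n => w n * x n)) ?posq_nonneg// => n; rewrite max_r.
have P10 : 0 <= P1 by apply: psum_ge0 => n _; rewrite mulr_ge0.
have Pw0 : 0 <= Pw by apply: psum_ge0 => n _; rewrite mulr_ge0 ?wgt_ge0.
apply: (@le_trans _ _ (2 * (cp p * m * (P1 * Pw)))); last first.
  rewrite -[in leRHS]mulrA ler_wpM2l// ler_wpM2l ?mulr_ge0 ?cp_ge0//.
  exact: ler_pM.
apply: (@le_trans _ _ (psum (fun i => cp p * m * Pw * (i%:R * x i) + cp p * m * P1 * (w i * x i)) N)).
  apply: le_psum => i /andP[i1 _].
  rewrite [leRHS](_ : _ = (cp p * m * (i%:R * x i)) * Pw + (cp p * m * (w i * x i)) * P1);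
    last by ring.
  rewrite -!psumZ -psumD; apply: le_psum => j /andP[j1 _].
  rewrite [leRHS](_ : _ = (m * (cp p * (i%:R * w j + j%:R * w i))) * (x i * x j)); last by ring.
  rewrite -mulrA ler_wpM2r ?mulr_ge0//.
  have M := moment_ineq_wgt i1 j1.
  (* The upper bound on the kernel may be inserted only where the bracket is nonnegative; elsewhere
     the term is at most [0]. *)
  have [D0|D0] := leP 0 (w (i + j)%N - w i - w j).
    apply: (@le_trans _ _ ((w (i + j)%N - w i - w j) * (m * (i + j)%:R))).
      by rewrite ler_wpM2l// kk_lin.
    by rewrite mulrCA ler_wpM2l// mulrC.
  apply: (@le_trans _ _ 0); first by rewrite nmulr_rle0// kk_ge0.
  by rewrite !mulr_ge0 ?cp_ge0// addr_ge0// mulr_ge0 ?wgt_ge0.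
rewrite psumD !psumZ -/P1 -/Pw le_eqVlt; apply/orP; left; apply/eqP; ring.
Qed.

Variable S : R -> X -> X.
Hypothesis Ssg : contraction_semigroup S.
Hypothesis mon_neg : monitor S (fun x => posq w (- x)).
Hypothesis mon_id : monitor S (posq idw).
Hypothesis mon_w : monitor S (posq w).
Variables (tau : R) (x0 : X) (U : R -> X).
Hypothesis tau_ge0 : 0 <= tau.
Hypothesis x0_ge0 : forall n, 0 <= x0 n.
Hypothesis U_cont : continuous U.
Hypothesis U_mild : forall t, 0 <= t -> t <= tau ->
  U t = duhamel S t x0 (fun s => Kt kk s (U s)).

Let g_cont : continuous (fun s => Kt kk s (U s)).
Proof. exact: (continuous_Kt p_ge0 c_ge0 kk_ge0 kk_le kk_cont U_cont). Qed.

(** One step size for the whole window, from the bound of the continuous [U] on it. *)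
Lemma small_step : exists C d, [/\ 0 <= C, 0 < d & forall t, 0 <= t -> t <= tau ->
  `|U t| <= C /\ forall h, 0 < h -> h < d -> h * (c * `|U t|) <= 1].
Proof.
have [C C0 HC] := continuous_bounded tau_ge0 U_cont.
exists C, (c * C + 1)^-1.
have c1 : 0 < c * C + 1 by rewrite ltr_wpDl// mulr_ge0// ltW.
split; [exact: ltW|by rewrite invr_gt0|move=> t t0 tt; split; first exact: HC].
move=> h h0 hd; apply: (@le_trans _ _ (h * (c * C + 1))).
  rewrite ler_wpM2l ?(ltW h0)//; have := ler_wpM2l c_ge0 (HC t t0 tt); lra.
by rewrite -ler_pdivlMr// mul1r ltW.
Qed.

(** Gronwall for the negative part, which starts at [0]. *)
Lemma mild_nonneg t : 0 <= t -> t <= tau -> forall n, 0 <= U t n.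
Proof.
move=> t0 tt; apply: posq_negpart_le0.
have [C [d [C0 d0 H]]] := small_step.
have K0 : 0 <= 2 * c * C by rewrite !mulr_ge0.
have := @monitor_gronwall R p S Ssg (fun x => posq w (- x)) (2 * c * C) tau U x0 _
  mon_neg tau_ge0 K0 U_cont g_cont U_mild.
rewrite posq_negpart_eq0// => G.
rewrite -(mul0r (expR (2 * c * C * t))); apply: G => // s s0 st.
have [HC Hs] := H s s0 (ltW st); exists d => // h h0 hd.
rewrite KtKl; apply: le_trans.
  by apply: (negpart_step p_ge0 c_ge0 (kk_ge0 s) (kk_le s) (ltW h0)); exact: Hs.
rewrite ler_wpM2r ?posq_ge0//; first exact: subweight_wgt.
by rewrite lerD2l ler_wpM2r ?(ltW h0)// ler_wpM2l// mulr_ge0.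
Qed.

(** Coagulation conserves mass: [W (i + j) - W i - W j] vanishes for [W = idw], so the step bound
    holds with rate [0]. *)
Lemma mild_mass t : 0 <= t -> t <= tau -> posq idw (U t) <= posq idw x0.
Proof.
move=> t0 tt; have [C [d [C0 d0 H]]] := small_step.
have := @monitor_gronwall R p S Ssg (posq idw) 0 tau U x0 _
  mon_id tau_ge0 (lexx 0) U_cont g_cont U_mild.
move=> G; rewrite -[leRHS]mulr1 -expR0 -(mul0r t); apply: G => // s s0 st.
have [HC Hs] := H s s0 (ltW st); exists d => // h h0 hd.
rewrite mul0r addr0 mul1r KtKl.
have := @moment_step R p p_ge0 _ c c_ge0 (kk_ge0 s) (kk_sym s) (kk_le s) idw (U s) h 0
  subweight_idw (ltW h0) (Hs h h0 hd) (mild_nonneg s0 (ltW st)).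
rewrite !mulr0 addr0; apply => N; rewrite /psum big1// => i _; rewrite big1// => j _.
by rewrite /idw natrD -addrA -opprD subrr !mul0r.
Qed.

(** The rate contains the current mass; [mild_mass] replaces it by the initial one, which makes the
    inequality linear. *)
Lemma mild_norm t : 0 <= t -> t <= tau ->
  `|U t| <= `|x0| * expR (cp p * m * posq idw x0 * t).
Proof.
move=> t0 tt; have [C [d [C0 d0 H]]] := small_step.
have q0 : 0 <= posq idw x0 by apply: posq_ge0; exact: subweight_idw.
have K0 : 0 <= cp p * m * posq idw x0 by rewrite !mulr_ge0 ?cp_ge0.
rewrite -(posq_wgt_nonneg (mild_nonneg t0 tt)) -(posq_wgt_nonneg x0_ge0).
apply: (@monitor_gronwall R p S Ssg (posq w) _ tau U x0 _
  mon_w tau_ge0 K0 U_cont g_cont U_mild) => // s s0 st.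
have [HC Hs] := H s s0 (ltW st); exists d => // h h0 hd; rewrite KtKl.
have Us0 := mild_nonneg s0 (ltW st).
apply: le_trans (@moment_step R p p_ge0 _ c c_ge0 (kk_ge0 s) (kk_sym s) (kk_le s) w (U s) h _
  (@subweight_wgt R p) (ltW h0) (Hs h h0 hd) Us0
  (fun N => moment_wgt_sum_le s N Us0)) _.
rewrite mulrDl mul1r lerD2l.
rewrite [leRHS](_ : _ = h * (cp p * m * posq idw x0 * posq w (U s))); last by ring.
rewrite ler_wpM2l ?(ltW h0)//.
rewrite ler_wpM2r//; first by apply: posq_ge0; exact: subweight_wgt.
by rewrite ler_wpM2l ?mulr_ge0 ?cp_ge0// mild_mass// ltW.
Qed.

End Kernel.

End AprioriBounds.

(** * Continuation beyond a finite maximal time and the final estimate *)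

Section GlobalExistence.
Context {R : realType} (T : \bar R) (p : R).
Variables (a : nat -> R) (b : nat -> nat -> R) (k : nat -> nat -> R -> R).
Variables (S : R -> (nat -> R) -> (nat -> R)) (mu : R -> R).
Variables (u0 : nat -> R) (tmax : \bar R) (u : R -> nat -> R).
Local Notation X := (l1w p).
Local Notation St := (@sgt R p S).
Local Notation w := (wgt p).
Hypothesis p_gt1 : 1 < p.
Hypothesis a_ge0 : forall n, (1 <= n)%N -> 0 <= a n.
Hypothesis b_ge0 : forall n j, (1 <= n)%N -> (1 <= j)%N -> 0 <= b n j.
Hypothesis b_eq0 : forall n j, (1 <= n)%N -> (j <= n)%N -> b n j = 0.
Hypothesis k_ge0 : forall n j, (1 <= n)%N -> (1 <= j)%N ->
  forall t, 0 <= t -> (t%:E < T)%E -> 0 <= k n j t.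
Hypothesis k_cont : forall n j, (1 <= n)%N -> (1 <= j)%N ->
  {within [set t | 0 <= t /\ (t%:E < T)%E], continuous (k n j)}.
Hypothesis k_sym : forall n j, (1 <= n)%N -> (1 <= j)%N -> forall t, k n j t = k j n t.
Hypothesis bw : forall j, (2 <= j)%N -> \sum_(1 <= n < j) (w n * b n j) <= w j.
Hypothesis b1 : forall j, (2 <= j)%N -> \sum_(1 <= n < j) (n%:R * b n j) <= j%:R.
Hypothesis k_CI : forall t', 0 < t' -> (t'%:E < T)%E ->
  exists c : R, 0 < c /\
    forall n j, (1 <= n)%N -> (1 <= j)%N -> forall t, 0 <= t -> t <= t' ->
      k n j t <= c * w n * w j / w (n + j).
Hypothesis SG : generated_by_G p a b S.
Hypothesis mu_gt0 : forall t, 0 < t -> (t%:E < T)%E -> 0 < mu t.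
Hypothesis k_lin : forall t', 0 < t' -> (t'%:E < T)%E ->
  forall n j, (1 <= n)%N -> (1 <= j)%N -> forall t, 0 <= t -> t <= t' ->
    k n j t <= mu t' * (n + j)%:R.
Hypothesis u0_in : inl1w p u0.
Hypothesis u0_ge0 : forall n, 0 <= u0 n.

Let p_ge0 : 0 <= p. Proof. by rewrite ltW// (lt_trans _ p_gt1). Qed.

(** Clamping the time makes the kernel bounds of the window valid at all times, as the preceding
    sections require. *)
Definition kclamp tau n j s := k n j (clamp tau s).

Let x0 : X := mkl1w p u0.

Let x0_ge0 n : 0 <= x0 n.
Proof. by rewrite mkl1wE. Qed.

Let csg : contraction_semigroup St.
Proof. exact: (sgt_csg SG a_ge0 b_ge0 b_eq0 bw). Qed.

Lemma within_continuous_comp (A : set R) (f g : R -> R) :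
  {within A, continuous f} -> continuous g -> (forall s, A (g s)) ->
  continuous (fun s => f (g s)).
Proof.
move=> /subspace_continuousP cf cg Ag s.
apply: (@cvg_comp _ _ _ g f _ (within A (nbhs (g s)))); last exact: cf.
move=> P /= HP; have H := cg s _ HP.
by apply: (@filterS _ (nbhs s) _ _ _ _ H) => r /= Hr; exact: (Hr (Ag r)).
Qed.

Lemma kclampE tau s n j : 0 <= s -> s <= tau -> kclamp tau n j s = k n j s.
Proof. by move=> s0 st; rewrite /kclamp clampE. Qed.

Lemma kclamp_bound tau (B : nat -> nat -> R) : 0 < tau ->
  (forall n j, (1 <= n)%N -> (1 <= j)%N -> forall t, 0 <= t -> t <= tau -> k n j t <= B n j) ->
  forall s n j, (1 <= n)%N -> (1 <= j)%N -> kclamp tau n j s <= B n j.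
Proof.
by move=> t0 H s n j n1 j1; apply: H => //; [exact: clamp_ge0|apply: clamp_le; exact: ltW].
Qed.

Section Window.
Variable tau : R.
Hypotheses (tau_gt0 : 0 < tau) (tauT : (tau%:E < T)%E).

Lemma clamp_in s : 0 <= clamp tau s /\ ((clamp tau s)%:E < T)%E.
Proof.
split; first exact: clamp_ge0.
by apply: le_lt_trans tauT; rewrite lee_fin clamp_le// ltW.
Qed.

Lemma kclamp_ge0 s n j : (1 <= n)%N -> (1 <= j)%N -> 0 <= kclamp tau n j s.
Proof. by move=> n1 j1; have [s0 sT] := clamp_in s; exact: k_ge0. Qed.

Lemma kclamp_sym s n j : (1 <= n)%N -> (1 <= j)%N -> kclamp tau n j s = kclamp tau j n s.
Proof. by move=> n1 j1; exact: k_sym. Qed.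

Lemma kclamp_cont n j : (1 <= n)%N -> (1 <= j)%N -> continuous (kclamp tau n j).
Proof.
move=> n1 j1; apply: within_continuous_comp (k_cont n1 j1) _ clamp_in.
exact: continuous_clamp.
Qed.

Lemma kclamp_CI : exists2 c, 0 <= c & forall s n j, (1 <= n)%N -> (1 <= j)%N ->
  kclamp tau n j s <= c * w n * w j / w (n + j).
Proof.
have [c [c0 H]] := k_CI tau_gt0 tauT; exists c; first exact: ltW.
exact: (kclamp_bound tau_gt0 H).
Qed.

Lemma continuous_Kclamp v : continuous v -> continuous (fun s => Kt (kclamp tau) s (v s : X)).
Proof.
have [c c0 kc] := kclamp_CI.
exact: (continuous_Kt p_ge0 c0 kclamp_ge0 kc kclamp_cont).
Qed.

Lemma Kclamp_KopE s (x : X) : 0 <= s -> s <= tau ->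
  Kt (kclamp tau) s x = Kop k s x :> (nat -> R).
Proof.
move=> s0 st; have [c c0 kc] := kclamp_CI.
rewrite (KtE p_ge0 c0 kclamp_ge0 kc) (_ : (fun n j => kclamp tau n j s) = (fun n j => k n j s))//.
by apply/funext => n; apply/funext => j; exact: kclampE.
Qed.

Lemma mild_bound m v : 0 <= m ->
  (forall n j, (1 <= n)%N -> (1 <= j)%N -> forall t, 0 <= t -> t <= tau ->
     k n j t <= m * (n + j)%:R) ->
  continuous v ->
  (forall t, 0 <= t -> t <= tau ->
     v t = duhamel St t x0 (fun s => Kt (kclamp tau) s (v s : X))) ->
  forall t, 0 <= t -> t <= tau ->
    `|v t| <= `|x0| * expR (cp p * m * posq idw x0 * t).
Proof.
move=> m0 km cv vE t t0 tt; have [c c0 kc] := kclamp_CI.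
have bid j : (2 <= j)%N -> \sum_(1 <= n < j) (idw n * b n j) <= idw j :> R by exact: b1.
exact: (mild_norm p_gt1 c0 m0 kclamp_ge0 kclamp_sym kc (kclamp_bound tau_gt0 km)
  kclamp_cont csg (monitor_negq SG a_ge0 b_ge0 b_eq0 bw)
  (monitor_posq SG a_ge0 b_ge0 b_eq0 (subweight_idw p_gt1) bid)
  (monitor_posq SG a_ge0 b_ge0 b_eq0 (@subweight_wgt R p) bw)
  (ltW tau_gt0) x0_ge0 cv vE t0 tt).
Qed.

End Window.

Lemma duhamel_coord t g n : 0 <= t -> continuous g ->
  duhamel St t x0 g n = S t u0 n +
    Rintegral lebesgue_measure `[0, t] (fun s => S (t - s) (g s : X) n).
Proof.
move=> t0 cg; rewrite /duhamel l1wDE (sgt_ge0E SG)// mkl1wE//; congr (_ + _).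
rewrite vintE; last exact: continuous_integrand.
by apply: eq_rint => s s0 st; rewrite (sgt_ge0E SG)// subr_ge0.
Qed.

Lemma mild_solution_continuous tau t1 : 0 <= tau -> (tau%:E < t1)%E ->
  mild_solution p S k u0 t1 u ->
  continuous (fun t => mkl1w p (u (clamp tau t))).
Proof.
move=> tau0 taut1 [uin [uc _]] t; apply/(@cvgrPdist_le _ _ _ (nbhs t)) => e e0.
have r1 s : ((clamp tau s)%:E < t1)%E.
  by apply: le_lt_trans taut1; rewrite lee_fin clamp_le.
have r0 s := clamp_ge0 tau s.
have [d [d0 H]] := uc _ (r0 t) (r1 t) e e0.
near=> s.
have st : `|clamp tau s - clamp tau t| < d.
  apply: le_lt_trans (clamp_dist _ _ _) _; rewrite distrC.
  by near: s; exact: (@cvgr_dist_lt _ _ _ (nbhs t) _ id t).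
have := H _ (r0 s) (r1 s) st.
rewrite (_ : seqsub _ _ = mkl1w p (u (clamp tau s)) - mkl1w p (u (clamp tau t))); last first.
  by apply/funext => n; rewrite l1wBE !mkl1wE//; exact: uin.
by rewrite normw_l1w lte_fin distrC => /ltW.
Unshelve. all: by end_near. Qed.

Lemma mild_solution_typed tau t1 : 0 < tau -> (tau%:E < t1)%E -> (t1 <= T)%E ->
  mild_solution p S k u0 t1 u ->
  forall t, 0 <= t -> t <= tau ->
  mkl1w p (u (clamp tau t)) =
  duhamel St t x0 (fun s => Kt (kclamp tau) s (mkl1w p (u (clamp tau s)))).
Proof.
move=> tau0 taut1 t1T ms t t0 tt; have tauT := lt_le_trans taut1 t1T.
have cU := mild_solution_continuous (ltW tau0) taut1 ms.
have [uin [_ uE]] := ms.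
have tt1 s : s <= tau -> (s%:E < t1)%E by move=> st; apply: le_lt_trans taut1; rewrite lee_fin.
apply: l1wP => n n1; rewrite duhamel_coord//; last exact: continuous_Kclamp.
rewrite clampE// mkl1wE; last by apply: uin => //; exact: tt1.
rewrite uE//; last exact: tt1.
congr (_ + _); apply: eq_rint => s s0 st.
have stau := le_trans st tt.
by rewrite Kclamp_KopE// clampE// mkl1wE//; apply: uin => //; exact: tt1.
Qed.

Hypothesis u_max : maximal_mild_solution p T S k u0 tmax u.

(** The constant [m] is left free: the continuation argument takes [mu] at a time beyond [tmax], for
    a bound uniform up to [tmax], while the final estimate takes [mu t]. *)
Lemma mild_solution_bound t m : 0 < t -> (t%:E < tmax)%E -> 0 <= m ->
  (forall n j, (1 <= n)%N -> (1 <= j)%N -> forall s, 0 <= s -> s <= t ->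
     k n j s <= m * (n + j)%:R) ->
  forall s, 0 <= s -> s <= t ->
  `|mkl1w p (u (clamp t s))| <= `|x0| * expR (cp p * m * posq idw x0 * s).
Proof.
move=> t0 tm m0 km; have [_ [tT [ms _]]] := u_max.
apply: (mild_bound t0 (lt_le_trans tm tT) m0 km).
  exact: (mild_solution_continuous (ltW t0) tm ms).
exact: (mild_solution_typed t0 tm tT ms).
Qed.

Lemma subset_kclamp tau s t (x : X) : 0 <= s -> s <= t -> t <= tau ->
  Kt (kclamp t) s x = Kt (kclamp tau) s x.
Proof.
move=> s0 st ttau; rewrite !KtKl; congr Kl; apply/funext => n; apply/funext => j.
by rewrite !kclampE// (le_trans st).
Qed.

(* The Picard solution for the kernel composed with a radial retraction is global
   on [[0, tau]], and the a priori bound keeps it inside the ball up to [tm]. *)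
Lemma truncated_solution tm tau : 0 < tm -> tmax = tm%:E -> tm < tau -> (tau%:E < T)%E ->
  exists M (v : R -> X), [/\ 0 < M, continuous v,
    forall t, 0 <= t -> t <= tau ->
      v t = duhamel St t x0 (fun s => Kt (kclamp tau) s (retract M (v s))),
    forall t, 0 <= t -> t < tm -> v t = mkl1w p (u t) &
    forall t, 0 <= t -> t < tm -> `|v t| <= M - 1].
Proof.
move=> tm0 tmE tmtau tauT; have tau0 : 0 < tau by exact: lt_trans tmtau.
have mt0 := mu_gt0 tau0 tauT.
have q0 : 0 <= posq idw x0 by apply: posq_ge0; exact: (subweight_idw p_gt1).
pose E := cp p * mu tau * posq idw x0.
have E0 : 0 <= E by rewrite !mulr_ge0 ?(cp_ge0 p_gt1)// ltW.
(* The [+ 1] leaves room for the solution to move past [tm] before the retraction acts. *)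
pose M := `|x0| * expR (E * tau) + 1.
have M0 : 0 < M by rewrite ltr_wpDl// mulr_ge0// expR_ge0.
have [c c0 kc] := kclamp_CI tau0 tauT.
pose F s (x : X) := Kt (kclamp tau) s (retract M x).
pose L := 6 * c * M + 1.
have cM : 0 <= 6 * c * M by rewrite !mulr_ge0// ltW.
have L0 : 0 < L by rewrite ltr_wpDl.
have Fc v : continuous v -> continuous (fun s => F s (v s)).
  move=> cv; apply: (continuous_Kclamp tau0 tauT).
  exact: continuous_retract.
have FL s (x y : X) : `|F s x - F s y| <= L * `|x - y|.
  apply: le_trans (Kt_retract_lipschitz p_ge0 c0 (kclamp_ge0 tau0 tauT) kc s x y M0) _.
  by rewrite ler_wpM2r// lerDl.
have [v cv vE] := picard csg x0 L0 (ltW tau0) Fc FL.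
have ub t : 0 < t -> t < tm -> forall s, 0 <= s -> s <= t ->
    `|mkl1w p (u (clamp t s))| <= M - 1.
  move=> t0 ttm s s0 st; rewrite /M addrK.
  have ttau : t <= tau by rewrite ltW// (lt_trans ttm).
  apply: le_trans (mild_solution_bound (m := mu tau) t0 _ (ltW mt0) _ s0 st) _.
  - by rewrite tmE lte_fin.
  - move=> n j n1 j1 r r0 rt; apply: (k_lin tau0 tauT n1 j1 r0).
    exact: le_trans ttau.
  - by rewrite ler_wpM2l// ler_expR ler_wpM2l// (le_trans st).
(* Uniqueness: inside the ball [u] solves the truncated equation too, so the difference has zero
   initial value and Lipschitz forcing, and Gronwall for the norm makes it vanish. *)
have veq t : 0 < t -> t < tm -> forall s, 0 <= s -> s <= t -> v s = mkl1w p (u (clamp t s)).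
  move=> t0 ttm s s0 st.
  have ttau : t <= tau by rewrite ltW// (lt_trans ttm).
  have ttmax : (t%:E < tmax)%E by rewrite tmE lte_fin.
  have [_ [tT [ms _]]] := u_max.
  pose U r := mkl1w p (u (clamp t r)).
  have cU : continuous U by exact: (mild_solution_continuous (ltW t0) ttmax ms).
  have UE r : 0 <= r -> r <= t -> U r = duhamel St r x0 (fun r' => F r' (U r')).
    move=> r0 rt; rewrite /U (mild_solution_typed t0 ttmax tT ms)//.
    apply: eq_duhamel => r' r'0 r'r; have r't := le_trans r'r rt.
    rewrite (subset_kclamp _ r'0 r't ttau) /F retract_id//.
    by apply: le_trans (ub t t0 ttm r' r'0 r't) _; rewrite gerBl.
  pose D r := v r - U r.
  have cD : continuous D by move=> r; apply: cvgB; [exact: cv|exact: cU].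
  pose g r := F r (v r) - F r (U r).
  have cg : continuous g by move=> r; apply: cvgB; exact: Fc.
  have DE r : 0 <= r -> r <= t -> D r = duhamel St r 0 g.
    move=> r0 rt; rewrite /D vE ?(le_trans rt)// UE//.
    by rewrite (duhamelB csg)//; [rewrite subrr|exact: Fc|exact: Fc].
  have := monitor_gronwall csg (monitor_norm csg) (ltW t0) (ltW L0) cD cg DE.
  move=> /(_ _ s s0 st); rewrite normr0 mul0r normr_le0 subr_eq0 => H.
  apply/eqP; apply: H => r r0 rt; exists 1 => // h h0 _.
  apply: le_trans (ler_normD _ _) _; rewrite mulrDl mul1r lerD2l normrZ gtr0_norm//.
  by rewrite [L * h]mulrC -mulrA ler_wpM2l ?(ltW h0)// FL.
have v0 : v 0 = mkl1w p (u 0).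
  have h0 : 0 < tm / 2 by rewrite divr_gt0.
  have h1 : tm / 2 < tm by rewrite gtr_pMr// invf_lt1// ltr1n.
  by rewrite (veq _ h0 h1 0 (lexx 0) (ltW h0)) clampE// ltW.
exists M, v; split => // t t0 ttm.
  move: t0; rewrite le_eqVlt => /predU1P[<-//|t0].
  by rewrite (veq t t0 ttm t (ltW t0) (lexx t)) clampE// ltW.
move: t0; rewrite le_eqVlt => /predU1P[t0|t0].
  subst t; have h0 : 0 < tm / 2 by rewrite divr_gt0.
  have h1 : tm / 2 < tm by rewrite gtr_pMr// invf_lt1// ltr1n.
  by rewrite (veq _ h0 h1 0 (lexx 0) (ltW h0)) ub// ltW.
by rewrite (veq t t0 ttm t (ltW t0) (lexx t)) ub// ltW.
Qed.

Lemma typed_mild_solution tau t1 (v : R -> X) g : 0 < tau -> (tau%:E < T)%E -> t1 <= tau ->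
  continuous v -> continuous g ->
  (forall t, 0 <= t -> t < t1 -> g t = Kt (kclamp tau) t (v t)) ->
  (forall t, 0 <= t -> t < t1 -> v t = duhamel St t x0 g) ->
  mild_solution p S k u0 t1%:E (fun t => v t).
Proof.
move=> tau0 tauT t1tau cv cg gE vE; split; first by move=> t _ _; exact: l1w_in.
split.
  move=> t _ _ e e0; have /cvgrPdist_lt/(_ e e0)/nbhs_ballP[d /= d0 H] := cv t.
  exists d; split => // s _ _ st.
  rewrite (_ : seqsub _ _ = v s - v t)//; rewrite normw_l1w lte_fin distrC.
  by apply: H; rewrite /ball/= distrC.
move=> t t0; rewrite lte_fin => tt n n1; rewrite vE// duhamel_coord//; congr (_ + _).
apply: eq_rint => s s0 st; have st1 := le_lt_trans st tt.
by rewrite gE// (Kclamp_KopE tau0 tauT)// ltW// (lt_le_trans st1).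
Qed.

(** Before [tm] the truncated solution has norm at most [M - 1]; by continuity it stays below [M]
    for a while after [tm]. There the retraction is the identity, so the original equation is solved
    beyond [tmax], against maximality. *)
Lemma tmax_eq : tmax = T.
Proof.
have [tmax0 [tmaxT [ms mx]]] := u_max.
move: tmaxT; rewrite le_eqVlt => /predU1P[//|tmaxT]; exfalso.
have tmf : tmax \is a fin_num.
  by rewrite fin_numElt (lt_trans _ tmax0) ?ltNy0//= (lt_le_trans tmaxT)// leey.
pose tm := fine tmax; have tmE : tmax = tm%:E by rewrite fineK.
have tm0 : 0 < tm by rewrite -lte_fin -tmE.
have [tau tmtau tauT] : exists2 tau, tm < tau & (tau%:E < T)%E.
  move: tmaxT; rewrite tmE; case: T => [r| |] //.
    rewrite lte_fin => tr; exists ((tm + r) / 2); rewrite ?lte_fin; lra.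
  by move=> _; exists (tm + 1); [rewrite ltrDl|rewrite ltry].
have tau0 : 0 < tau by exact: lt_trans tmtau.
have [M [v [M0 cv vE vu vM]]] := truncated_solution tm0 tmE tmtau tauT.
have h2 : 0 < 2^-1 :> R by rewrite invr_gt0.
have /cvgrPdist_le/(_ _ h2)/nbhs_ballP[d /= d0 H] := cv tm.
(* Makes [tm - r / 2] a nonnegative time before [tm] and within the radius of continuity, to carry
   the bound on [v] over to [tm]. *)
pose r := Num.min d tm.
have r0 : 0 < r by rewrite lt_min d0.
have rd : r <= d by rewrite ge_min lexx.
have rtm : r <= tm by rewrite ge_min lexx orbT.
have vtm : `|v tm| <= M - 2^-1.
  have B : ball tm d (tm - r / 2).
    rewrite /ball/= (_ : tm - (tm - r / 2) = r / 2); last by ring.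
    by rewrite ger0_norm ?divr_ge0 ?(ltW r0)//; lra.
  have s0 : 0 <= tm - r / 2 by lra.
  have s1 : tm - r / 2 < tm by lra.
  have := H _ B; have := vM _ s0 s1.
  have := ler_normD (v tm - v (tm - r / 2)) (v (tm - r / 2)); rewrite subrK; lra.
pose t1 := Num.min tau (tm + d).
have t1tau : t1 <= tau by rewrite ge_min lexx.
have t1d : t1 <= tm + d by rewrite ge_min lexx orbT.
have tmt1 : tm < t1 by rewrite lt_min tmtau ltrDl.
have vM1 t : 0 <= t -> t < t1 -> `|v t| <= M.
  move=> t0 tt1; have [ttm|tmt] := ltP t tm.
    by apply: le_trans (vM t t0 ttm) _; rewrite gerBl.
  have B : ball tm d t by rewrite /ball/= distrC ger0_norm; lra.
  have := H _ B; have := ler_normB (v tm) (v tm - v t).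
  rewrite opprB addrC subrK; lra.
apply: (mx t1%:E).
- by rewrite tmE lte_fin.
- by rewrite ltW// (le_lt_trans _ tauT)// lee_fin.
exists (fun t => v t); split; last first.
  move=> t t0; rewrite tmE lte_fin => ttm; rewrite vu// mkl1wE//.
  by case: ms => uin _; apply: uin => //; rewrite tmE lte_fin.
apply: (typed_mild_solution tau0 tauT t1tau cv (g := fun s => Kt (kclamp tau) s (retract M (v s)))).
- by apply: (continuous_Kclamp tau0 tauT); exact: continuous_retract.
- by move=> t t0 tt1; rewrite retract_id// vM1.
- by move=> t t0 tt1; rewrite vE// ltW// (lt_le_trans tt1).
Qed.

Lemma phi1_posq : phi1 u0 = posq idw x0.
Proof.
have sw := subweight_idw p_gt1.
have H := cvg_psum (@posq_term_ge0 R p _ sw x0) (posq_bdsum sw x0).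
apply/cvg_lim => //; apply: cvg_trans H; apply: near_eq_cvg; apply: nearW => N.
by apply: eq_bigr => n _; rewrite max_r// mkl1wE.
Qed.

(** The window is [[0, t]] itself, which yields [mu t] in the exponent. Time [0] is separate because
    [mu] is controlled only at positive times; there the exponent is [0]. *)
Lemma mild_solution_estimate t : 0 <= t -> (t%:E < tmax)%E ->
  (normw p (u t) <= normw p u0 * (expR (cp p * mu t * phi1 u0 * t))%:E)%E.
Proof.
move=> t0 ttm; have [_ [tT [[uin [_ uE]] _]]] := u_max.
have nx0 : normw p u0 = (`|x0|)%:E by rewrite -normw_l1w mkl1wE.
have ut : u t = mkl1w p (u t) by rewrite mkl1wE//; exact: uin.
rewrite ut normw_l1w nx0 -EFinM lee_fin phi1_posq.
move: t0; rewrite le_eqVlt => /predU1P[t0|t0].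
  subst t; rewrite mulr0 expR0 mulr1 (_ : mkl1w p (u 0) = x0)//.
  apply: l1wP => n n1; rewrite mkl1wE; last exact: uin.
  rewrite mkl1wE// uE// set_itv1 Rintegral_set1 addr0.
  by case: SG => -[_ [_ [_ [H _]]]] _; rewrite H.
have := mild_solution_bound t0 ttm (ltW (mu_gt0 t0 (lt_le_trans ttm tT)))
  (k_lin t0 (lt_le_trans ttm tT)) (ltW t0) (lexx t).
by rewrite clampE// ltW.
Qed.

End GlobalExistence.

Theorem theorem4p16 (R : realType) (T : \bar R) (p : R)
  (a : nat -> R) (b : nat -> nat -> R) (k : nat -> nat -> R -> R)
  (kappa : R) (S : R -> (nat -> R) -> (nat -> R)) (mu : R -> R)
  (u0 : nat -> R) (tmax : \bar R) (u : R -> nat -> R) :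
  (0 < T)%E ->
  1 < p ->
  (* standing assumptions *)
  (forall n, (1 <= n)%N -> 0 <= a n) ->
  (forall n j, (1 <= n)%N -> (1 <= j)%N -> 0 <= b n j) ->
  (forall n j, (1 <= n)%N -> (j <= n)%N -> b n j = 0) ->
  (forall n j, (1 <= n)%N -> (1 <= j)%N ->
     forall t, 0 <= t -> (t%:E < T)%E -> 0 <= k n j t) ->
  (forall n j, (1 <= n)%N -> (1 <= j)%N ->
     {within [set t | 0 <= t /\ (t%:E < T)%E], continuous (k n j)}) ->
  (forall n j, (1 <= n)%N -> (1 <= j)%N -> forall t, k n j t = k j n t) ->
  0 < kappa -> kappa <= 1 ->
  (forall j, (2 <= j)%N ->
     \sum_(1 <= n < j) (wgt p n * b n j) <= kappa * wgt p j) ->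
  (* case (CI) *)
  (forall t', 0 < t' -> (t'%:E < T)%E ->
     exists c : R, 0 < c /\
       forall n j, (1 <= n)%N -> (1 <= j)%N -> forall t, 0 <= t -> t <= t' ->
         k n j t <= c * wgt p n * wgt p j / wgt p (n + j)) ->
  (* the semigroup generated by G^(w) *)
  generated_by_G p a b S ->
  (* additional assumptions of the theorem *)
  (forall j, (2 <= j)%N -> \sum_(1 <= n < j) (n%:R * b n j) <= j%:R) ->
  (forall t, 0 < t -> (t%:E < T)%E -> 0 < mu t) ->
  (forall s t, 0 < s -> s <= t -> (t%:E < T)%E -> mu s <= mu t) ->
  (forall t', 0 < t' -> (t'%:E < T)%E ->
     forall n j, (1 <= n)%N -> (1 <= j)%N -> forall t, 0 <= t -> t <= t' ->
       k n j t <= mu t' * (n + j)%:R) ->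
  inl1w p u0 -> (forall n, 0 <= u0 n) ->
  maximal_mild_solution p T S k u0 tmax u ->
  tmax = T /\
  forall t, 0 <= t -> (t%:E < T)%E ->
    (normw p (u t) <= normw p u0 * (expR (cp p * mu t * phi1 u0 * t))%:E)%E.
Proof.
move=> _ p1 a0 b0 bz k0 kc ks _ kappa1 bw kCI SG b1 mu0 muh kl uin u00 umax.
(* Since [kappa <= 1], fragmentation does not increase the [p]-moment, which is the form that
   dispersivity uses. *)
have bw1 j : (2 <= j)%N -> \sum_(1 <= n < j) (wgt p n * b n j) <= wgt p j.
  by move=> j2; apply: le_trans (bw j j2) _; rewrite ler_piMl// powR_ge0.
have tE : tmax = T.
  exact: (tmax_eq p1 a0 b0 bz k0 kc ks bw1 b1 kCI SG mu0 kl uin u00 umax).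
split=> // t t0 tT.
apply: (mild_solution_estimate p1 a0 b0 bz k0 kc ks bw1 b1 kCI SG mu0 kl uin u00 umax t0).
by rewrite tE.
Qed.
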